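(* Consider the major-minor mean field game of stopping with entropy regularization in the major player's problem, as described in the context, and suppose that Assumptions (P), (R0) and (R1) stated there hold. Then for every $\lambda>0$ there exists a $\lambda$-regularized equilibrium, i.e. a pair $(\mu^*,m^* )\in\mathcal C_\mu\times\mathcal C_m$ with $(\mu^*,m^* )\in\Phi_\lambda(\mu^*,m^* )$.
   Context: **Setting.** Fix an integer $T\ge 1$ and let $\mathbb T=\{0,\dots,T\}$. $S^0=\{z_1,\dots,z_N\}$ is a finite set of $N$ distinct points (major player's states), $(S,d)$ is a nonempty compact metric space (minor players' states), and $A$ is the major player's action space, which is either a compact subset of $\mathbb R^\ell$ with positive Lebesgue measure, or $A=\{0,1\}$. $W=\{0,1\}^{(T+1)\times N}$ is the finite set of binary matrices, encoding paths of the major player. Finite sets carry the discrete metric. For a topological space $E$, $\mathcal P(E)$ and $\mathcal P^{sub}(E)$ are the Borel probability and subprobability measures on $E$ with the topology of weak convergence; products carry the product topology. Put $\mathcal A=\prod_{t=0}^{T-1}\mathcal P(A)^W$ (relaxed feedback controls), $\mathcal C_\mu=\prod_{t=0}^{T}\mathcal P^{sub}(S)^W$, $\mathcal C_m=\prod_{t=0}^{T-1}\mathcal P^{sub}(S)^W$, $\mathcal V=\prod_{t=0}^{T}\mathcal P^{sub}(S\times W)\times\prod_{t=0}^{T-1}\mathcal P^{sub}(S\times W)$. **Path encoding.** For $s\in\mathbb T$, $z\in S^0$, $M[s,z]\in W$ is the matrix whose $(r+1,j)$ entry is $1$ if $r=s$ and $z=z_j$, and $0$ otherwise. The major player's path process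 is $U_t=\sum_{s=0}^t M[s,X^0_s]$, where $X^0$ is the major player's state process. $\Psi_t(u)=z_j$ if $j$ is the unique index with $u(t+1,j)=1$ (for other $u$, never reached at time $t$, $\Psi_t(u)$ is a fixed arbitrary element of $S^0$). **Kernels.** $\tilde P^0_{k+1}(u,a,m,dx^0)$ is a probability on $S^0$ for $k<T$, $(u,a,m)\in W\times A\times\mathcal P^{sub}(S)$. $P^0_{k+1}(u,a,m,du')$ is a stochastic kernel to $W$ given, for each $u$ whose $(k+2)$-th row is zero, by $P^0_{k+1}(u,a,m,u')=\sum_{x^0\in S^0}1_{\{u+M[k+1,x^0]=u'\}}\tilde P^0_{k+1}(u,a,m,x^0)$ (for other, never reached, $u$ it is an arbitrary fixed stochastic kernel). $P_{k+1}(x,u,m,dx')$ is a probability on $S$ for $(x,u,m)\in S\times W\times\mathcal P^{sub}(S)$. For $\nu\in\mathcal P(A)$, $\pi^0_{k+1}(u,du';\nu,m)=\int_A P^0_{k+1}(u,a,m,du')\,\nu(da)$ and $\pi_{k+1}(x,u;\nu,m;dx',du')=P_{k+1}(x,u,m,dx')\,\pi^0_{k+1}(u,du';\nu,m)$. The joint initial law of $(X_0,U_0)$ is a fixed $m_0^*\in\mathcal P(S\times W)$ (with $U_0=M[0,X^0_0]$). **Major player's law.** For $(\alpha,m)\in\mathcal A\times\mathcal C_m$, $p_0(\cdot;\alpha,m)$ is the $W$-marginal of $m_0^*$ and $p_{t+1}(du;\alpha,m)=\int_W\pi^0_{t+1}(u',du;\alpha_t(u'),m_t(u'))\,p_t(du';\alpha,m)$.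 **Regularized problem of the major player.** Let $f^0_t:S^0\times A\times\mathcal P^{sub}(S)\to\mathbb R$ and $g^0:S^0\times\mathcal P^{sub}(S)\to\mathbb R$. For a probability density $\phi$ on $A$ w.r.t. Lebesgue measure (if $\mathrm{Leb}(A)>0$), resp. a probability mass function $\phi$ on $A=\{0,1\}$, the Shannon entropy is $\mathcal H(\phi)=-\int_A\phi\ln\phi\,da$, resp. $-\sum_{a}\phi(a)\ln\phi(a)$. $\mathcal D$ is the set of $\alpha\in\mathcal A$ such that each $\alpha_t(u)$ has a density (mass function) with $\mathcal H(\alpha_t(u))>-\infty$. For $\lambda>0$ and $\alpha\in\mathcal D$, $$J^0_\lambda(\alpha;\mu,m)=\mathbb E\Big[\sum_{t=0}^{T-1}\Big(\int_A f^0_t(\Psi_t(U_t),a,m_t(U_t))\,\alpha_t(U_t)(da)+\lambda\mathcal H(\alpha_t(U_t))\Big)+g^0(\Psi_T(U_T),\mu_T(U_T))\Big],$$ $U$ being the Markov chain with initial law $p_0$ and transitions $\pi^0_{t+1}(u,du';\alpha_t(u),m_t(u))$. $\alpha^\lambda(\mu,m)$ denotes the unique maximizer of $J^0_\lambda(\cdot;\mu,m)$ that is optimal from every $(t,u)$, obtained by dynamic programming: $V^\lambda(T,u)=g^0(\Psi_T(u),\mu_T(u))$, and for $t<T$, with $Q_t(u,a)=f^0_t(\Psi_t(u),a,m_t(u))+\sum_{u'\in W}V^\lambda(t+1,u')P^0_{t+1}(u,a,m_t(u),u')$, $V^\lambda(t,u)=\max_{\phi}\{\int_A Q_t(u,a)\phi(a)\,da+\lambda\mathcal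 H(\phi)\}$ and $\alpha^\lambda_t(u)(a)=e^{Q_t(u,a)/\lambda}/\int_A e^{Q_t(u,b)/\lambda}\,db$ (integrals replaced by sums when $A=\{0,1\}$). **Minor player (linear programming form).** For $\varphi\in C_b(\mathbb T\times S\times W)$ and $t<T$, $\mathcal L(\varphi)(t,x,u;\nu,\eta)=\int_{S\times W}[\varphi(t+1,x',u')-\varphi(t,x,u)]\,\pi_{t+1}(x,u;\nu,\eta;dx',du')$. $\mathcal R[m;\alpha]$ is the set of $(\tilde\mu,\tilde m)\in\mathcal V$ such that for all $\varphi\in C_b(\mathbb T\times S\times W)$ $$\sum_{t=0}^T\int\varphi(t,x,u)\,\tilde\mu_t(dx,du)=\int\varphi(0,x,u)\,m_0^*(dx,du)+\sum_{t=0}^{T-1}\int\mathcal L(\varphi)(t,x,u;\alpha_t(u),m_t(u))\,\tilde m_t(dx,du).$$ For $f_t,g_t:S\times W\times\mathcal P^{sub}(S)\to\mathbb R$, $$J^1(\tilde\mu,\tilde m;\mu,m)=\sum_{t=0}^{T-1}\int f_t(x,u,m_t(u))\,\tilde m_t(dx,du)+\sum_{t=0}^{T}\int g_t(x,u,\mu_t(u))\,\tilde\mu_t(dx,du),$$ and $\hat\Theta(\mu,m,\alpha)=\arg\max_{(\tilde\mu,\tilde m)\in\mathcal R[m;\alpha]}J^1(\tilde\mu,\tilde m;\mu,m)$. **Conditioning map.** $\Gamma((\tilde\mu,\tilde m),\alpha,m)$ is the set of $(\mu',m')\in\mathcal C_\mu\times\mathcal C_m$ with $\tilde\mu_t(dx,du)=\mu'_t(u)(dx)\,p_t(du;\alpha,m)$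 for $t\in\mathbb T$ and $\tilde m_t(dx,du)=m'_t(u)(dx)\,p_t(du;\alpha,m)$ for $t<T$. For a set $K\subseteq\mathcal V$, $\Gamma(K,\alpha,m)=\bigcup_{k\in K}\Gamma(k,\alpha,m)$. **Regularized equilibrium map.** $\Phi_\lambda(\mu,m)=\Gamma\big(\hat\Theta(\mu,m,\alpha^\lambda(\mu,m)),\alpha^\lambda(\mu,m),m\big)$. **Assumption (P).** (i) For each $k<T$, $u\in W$, $(a,m)\mapsto P^0_{k+1}(u,a,m,\cdot)\in\mathcal P(W)$ is continuous on $A\times\mathcal P^{sub}(S)$; moreover, when $\mathrm{Leb}(A)>0$, $a\mapsto P^0_{k+1}(u,a,m,u')$ is Lipschitz, uniformly in the other arguments. (ii) For each $k<T$, $u\in W$, $(x,m)\mapsto P_{k+1}(x,u,m,\cdot)\in\mathcal P(S)$ is continuous on $S\times\mathcal P^{sub}(S)$. **Assumption (R0).** (i) For each $t<T$, $x\in S^0$, $(a,m)\mapsto f^0_t(x,a,m)$ is continuous; moreover, when $\mathrm{Leb}(A)>0$, $a\mapsto f^0_t(x,a,m)$ is Lipschitz, uniformly in the other arguments. (ii) For each $x\in S^0$, $m\mapsto g^0(x,m)$ is continuous. **Assumption (R1).** For each $u\in W$: $(x,m)\mapsto f_t(x,u,m)$ is continuous for each $t<T$, and $(x,m)\mapsto g_t(x,u,m)$ is continuous for each $t\in\mathbb T$. *)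

(* Defs.v *)
From HB Require Import structures.
From mathcomp Require Import all_boot all_order all_algebra.
From mathcomp Require Import all_classical all_reals all_analysis.

Set Implicit Arguments.
Unset Strict Implicit.
Unset Printing Implicit Defensive.

Import Order.TTheory GRing.Theory Num.Theory.
Import numFieldNormedType.Exports.

Local Open Scope classical_set_scope.
Local Open Scope ring_scope.

(* Measurable types are pointed in the library, so nonempty metric spaces are
   pointed here; the distinguished point plays no role. *)
#[short(type="pmetricType")]
HB.structure Definition PointedMetric (K : numDomainType) :=
  {M of Metric K M & isPointed M}.

HB.instance Definition _ (E F : ptopologicalType) := Pointed.on (E * F)%type.

Definition borel (E : ptopologicalType) : measurableType _ :=
  g_sigma_algebraType (@open E).

Definition Psub (R : realType) (E : ptopologicalType) : Type :=
  subprobability (borel E) R.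
Definition Prob (R : realType) (E : ptopologicalType) : Type :=
  probability (borel E) R.

(* The topology of weak convergence.  Library measures are functions on all
   sets, so two measures agreeing on Borel sets may differ as terms; they are
   then indistinguishable for this topology. *)
Section WeakConvergence.
Context (R : realType) (E : ptopologicalType).

Definition Cb : Type := {f : E -> R | continuous f /\ bounded_fun f}.

Definition weak_sub (nu : Psub R E) : {ptws Cb -> R} :=
  fun f => \int[nu : subprobability (borel E) R]_x sval f x.

Definition weak_prob (nu : Prob R E) : {ptws Cb -> R} :=
  fun f => \int[nu : probability (borel E) R]_x sval f x.

HB.instance Definition _ := gen_eqMixin (Psub R E).
HB.instance Definition _ := gen_choiceMixin (Psub R E).
HB.instance Definition _ :=
  Topological.copy (Psub R E) (initial_topology weak_sub).

HB.instance Definition _ := Choice.copy (Prob R E) (probability (borel E) R).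
HB.instance Definition _ :=
  Topological.copy (Prob R E) (initial_topology weak_prob).

End WeakConvergence.

(* Lebesgue measure on R^l: the l-fold product of the measure on the line. *)
Fixpoint lebesgue (R : realType) (l : nat) : set 'rV[R]_l -> \bar R :=
  match l with
  | 0 => dirac (0 : borel 'rV[R]_0)
  | n.+1 => fun B =>
      product_measure1 (@lebesgue_measure R)
        (@lebesgue R n : set (borel 'rV[R]_n) -> \bar R)
        [set p | B (row_mx (p.1 : R)%:M (p.2 : 'rV[R]_n) : 'rV[R]_n.+1)]
  end.

(* The two kinds of action space.  Either one is a subset of an ambient
   space carrying a reference measure (Lebesgue, resp. counting), and P(A) is
   seen as the probabilities on the ambient space giving A full mass. *)
Variant action_space (R : realType) : Type :=
| Continuum (l : nat) (A : set 'rV[R]_l)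
| Binary.
Arguments Binary {R}.

Definition ambient (R : realType) (A : action_space R) : ptopologicalType :=
  match A with Continuum l _ => ('rV[R]_l : Type) | Binary => bool end.

Definition actions (R : realType) (A : action_space R) : set (ambient A) :=
  match A return set (ambient A) with
  | Continuum _ B => B
  | Binary => [set: bool]
  end.

Definition reference (R : realType) (A : action_space R) :
    set (borel (ambient A)) -> \bar R :=
  match A return set (borel (ambient A)) -> \bar R with
  | Continuum l _ => @lebesgue R l
  | Binary => @counting bool R
  end.

Definition admissible_actions (R : realType) (A : action_space R) : Prop :=
  match A with
  | Continuum l B => [/\ (0 < l)%N, compact B & (0 < lebesgue B)%E]
  | Binary => True
  end.

(* The Lipschitz conditions are only imposed in the Lebesgue case. *)
Definition lipschitz_actions (R : realType) (A : action_space R) (k : R) :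
    (ambient A -> R) -> Prop :=
  match A return (ambient A -> R) -> Prop with
  | Continuum _ B => fun F => forall a b, B a -> B b ->
      `|F a - F b| <= k * `|a - b|
  | Binary => fun=> True
  end.

Section Entropy.
Context (R : realType) (A : action_space R).

Definition ref_int (F : ambient A -> R) : \bar R :=
  (\int[@reference R A]_(a in @actions R A) (F a)%:E)%E.

Definition shannon (phi : ambient A -> R) : \bar R :=
  (- ref_int (fun a => (phi a * ln (phi a))%R))%E.

Definition density (nu : Prob R (ambient A)) (phi : ambient A -> R) : Prop :=
  [/\ measurable_fun (@actions R A : set (borel (ambient A))) phi,
      forall a, actions a -> 0 <= phi a
    & forall B : set (borel (ambient A)), measurable B ->
        (nu : probability _ _) B =
        (\int[@reference R A]_(a in @actions R A `&` B) (phi a)%:E)%E].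

Definition entropic_pdf (phi : ambient A -> R) : Prop :=
  [/\ measurable_fun (@actions R A : set (borel (ambient A))) phi,
      forall a, actions a -> 0 <= phi a,
      ref_int phi = 1%E
    & (-oo < shannon phi)%E].

Definition entropy (nu : Prob R (ambient A)) : \bar R :=
  shannon (get (density nu)).

End Entropy.

(* The state z_j is encoded by its index j, and the matrices of W have boolean
   entries; bool being discrete, so is the library topology on W. *)
Notation W T N := ('M[bool]_(T.+1, N)).

Section Paths.
Context (T N : nat).

Definition tnow (t : 'I_T) : 'I_T.+1 := widen_ord (leqnSn T) t.
Definition tnext (t : 'I_T) : 'I_T.+1 := lift ord0 t.

Definition Mmx (s : 'I_T.+1) (z : 'I_N) : W T N :=
  \matrix_(r, j) ((r == s) && (j == z)).

(* u + M[s, z], for u whose row of index s is zero. *)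
Definition extend (u : W T N) (s : 'I_T.+1) (z : 'I_N) : W T N :=
  map2_mx orb u (Mmx s z).

Definition Psi (z0 : 'I_N) (t : 'I_T.+1) (u : W T N) : 'I_N :=
  odflt z0 [pick j | u t j && [forall i, u t i ==> (i == j)]].

End Paths.

Section Game.
Context (R : realType) (T N : nat) (S : pmetricType R) (A : action_space R).

Local Notation SW := ((S * W T N)%type : Type).

(* Functions of an action are total on the ambient space, but only their
   restrictions to A are ever used. *)
Record mmgame : Type := MMGame {
  z0 : 'I_N;
  P0tilde : 'I_T -> W T N -> ambient A -> Psub R S -> 'I_N -> R;
  P0 : 'I_T -> W T N -> ambient A -> Psub R S -> Prob R (W T N);
  P1 : 'I_T -> S -> W T N -> Psub R S -> Prob R S;
  m0star : Prob R SW;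
  f0 : 'I_T -> 'I_N -> ambient A -> Psub R S -> R;
  g0 : 'I_N -> Psub R S -> R;
  f1 : 'I_T -> S -> W T N -> Psub R S -> R;
  g1 : 'I_T.+1 -> S -> W T N -> Psub R S -> R }.

Definition control : Type := 'I_T -> W T N -> Prob R (ambient A).
Definition Cmu : Type := 'I_T.+1 -> W T N -> Psub R S.
Definition Cm : Type := 'I_T -> W T N -> Psub R S.
Definition Vspace : Type :=
  (('I_T.+1 -> Psub R SW) * ('I_T -> Psub R SW))%type.

Definition relaxed (alpha : control) : Prop :=
  forall t u, (alpha t u : probability _ _) (@actions R A) = 1%E.

Variable G : mmgame.

Definition P0mass (t : 'I_T) (u : W T N) (a : ambient A) (m : Psub R S)
    (u' : W T N) : R :=
  fine ((P0 G t u a m : probability _ _) [set u']).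

Definition well_posed : Prop :=
  [/\ forall t u a m, actions a ->
        (forall z, 0 <= P0tilde G t u a m z) /\
        \sum_z P0tilde G t u a m z = 1,
      forall t (u : W T N) a m u', actions a ->
        (forall j, u (tnext t) j = false) ->
        P0mass t u a m u' =
        \sum_(z | extend u (tnext t) z == u') P0tilde G t u a m z
    & (m0star G : probability _ _)
        [set q | exists z, q.2 = Mmx ord0 z] = 1%E].

Definition assumption_P : Prop :=
  [/\ forall t u,
        {within @actions R A `*` [set: Psub R S],
          continuous (fun p : ambient A * Psub R S => P0 G t u p.1 p.2)},
      exists k, forall t u m u',
        lipschitz_actions k (fun a => P0mass t u a m u')
    & forall t u, continuous (fun p : S * Psub R S => P1 G t p.1 u p.2)].

Definition assumption_R0 : Prop :=
  [/\ forall t z,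
        {within @actions R A `*` [set: Psub R S],
          continuous (fun p : ambient A * Psub R S => f0 G t z p.1 p.2)},
      exists k, forall t z m, lipschitz_actions k (fun a => f0 G t z a m)
    & forall z, continuous (g0 G z)].

Definition assumption_R1 : Prop :=
  forall u,
    (forall t, continuous (fun p : S * Psub R S => f1 G t p.1 u p.2)) /\
    (forall t, continuous (fun p : S * Psub R S => g1 G t p.1 u p.2)).

(* The mass given to u' by pi^0_{t+1}(u, . ; nu, m). *)
Definition pi0 (t : 'I_T) (u : W T N) (nu : Prob R (ambient A)) (m : Psub R S)
    (u' : W T N) : R :=
  \int[nu : probability _ _]_(a in @actions R A) P0mass t u a m u'.

(* Mass function at time t of the chain started at time s with law q (equal to
   q for t <= s). *)
Fixpoint law_from (alpha : control) (m : Cm) (s : nat) (q : W T N -> R)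
    (t : nat) : W T N -> R :=
  if t is k.+1 then
    if (s <= k)%N then
      if insub k is Some i then fun u =>
        \sum_u' pi0 i u' (alpha i u') (m i u') u * law_from alpha m s q k u'
      else q
    else q
  else q.

Definition law0 (u : W T N) : R :=
  fine ((m0star G : probability _ _) [set q | q.2 = u]).

Definition law (alpha : control) (m : Cm) (t : nat) : W T N -> R :=
  law_from alpha m 0 law0 t.

Section MajorPlayer.
Variables (lambda : R) (mu : Cmu) (m : Cm).

Definition PsiG : 'I_T.+1 -> W T N -> 'I_N := Psi (z0 G).

Definition entropic_control (alpha : control) : Prop :=
  relaxed alpha /\
  forall t u, exists phi, density (alpha t u) phi /\ (-oo < shannon phi)%E.

Definition reward0 (alpha : control) (t : 'I_T) (u : W T N) : R :=
  \int[alpha t u : probability _ _]_(a in @actions R A)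
     f0 G t (PsiG (tnow t) u) a (m t u)
  + lambda * fine (entropy (alpha t u)).

Definition final0 (u : W T N) : R :=
  g0 G (PsiG ord_max u) (mu ord_max u).

(* Expected reward collected from time s on, by the chain started at time s
   with law q. *)
Definition J0_from (s : nat) (q : W T N -> R) (alpha : control) : R :=
  \sum_(t < T | (s <= t)%N)
     \sum_u law_from alpha m s q t u * reward0 alpha t u
  + \sum_u law_from alpha m s q T u * final0 u.

Definition J0 : control -> R := J0_from 0 law0.

Definition maximizer (J : control -> R) (alpha : control) : Prop :=
  entropic_control alpha /\
  forall beta, entropic_control beta -> J beta <= J alpha.

Definition Qfun (v : 'I_T.+1 -> W T N -> R) (t : 'I_T) (u : W T N)
    (a : ambient A) : R :=
  f0 G t (PsiG (tnow t) u) a (m t u)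
  + \sum_u' v (tnext t) u' * P0mass t u a (m t u) u'.

Definition value_function (v : 'I_T.+1 -> W T N -> R) : Prop :=
  (forall u, v ord_max u = final0 u) /\
  forall t u,
    let payoffs := [set (fine (ref_int (fun a => Qfun v t u a * phi a))
                         + lambda * fine (shannon phi))
                   | phi in @entropic_pdf R A] in
    payoffs (v (tnow t) u) /\ ubound payoffs (v (tnow t) u).

Definition gibbs (v : 'I_T.+1 -> W T N -> R) (t : 'I_T) (u : W T N)
    (a : ambient A) : R :=
  expR (Qfun v t u a / lambda)
  / fine (ref_int (fun b => expR (Qfun v t u b / lambda))).

(* alpha = alpha^lambda(mu, m): the maximizer that is optimal from every
   (t, u), given by dynamic programming. *)
Definition is_alpha_lambda (alpha : control) : Prop :=
  [/\ maximizer J0 alpha,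
      forall (t : 'I_T) u, maximizer (J0_from t (fun u' => (u' == u)%:R)) alpha
    & exists2 v, value_function v &
        forall t u, density (alpha t u) (gibbs v t u)].

End MajorPlayer.

(* As W is finite, the integral against the product measure
   P_{t+1}(x,u,eta,dx') pi^0_{t+1}(u,du';nu,eta) is a sum of integrals. *)
Definition generator (phi : 'I_T.+1 -> S * W T N -> R) (t : 'I_T) (x : S)
    (u : W T N) (nu : Prob R (ambient A)) (eta : Psub R S) : R :=
  \sum_u' pi0 t u nu eta u' *
    \int[P1 G t x u eta : probability _ _]_x'
       (phi (tnext t) (x', u') - phi (tnow t) (x, u)).

Definition Rset (m : Cm) (alpha : control) : set Vspace :=
  [set k : Vspace | forall phi : 'I_T.+1 -> S * W T N -> R,
     (forall t, continuous (phi t) /\ bounded_fun (phi t)) ->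
     \sum_t \int[k.1 t : subprobability _ _]_q phi t q =
     \int[m0star G : probability _ _]_q phi ord0 q
     + \sum_t \int[k.2 t : subprobability _ _]_q
         generator phi t q.1 q.2 (alpha t q.2) (m t q.2)].

Definition J1 (mu : Cmu) (m : Cm) (k : Vspace) : R :=
  \sum_t \int[k.2 t : subprobability _ _]_q f1 G t q.1 q.2 (m t q.2)
  + \sum_t \int[k.1 t : subprobability _ _]_q g1 G t q.1 q.2 (mu t q.2).

Definition Theta (mu : Cmu) (m : Cm) (alpha : control) : set Vspace :=
  [set k | Rset m alpha k /\
     forall k', Rset m alpha k' -> J1 mu m k' <= J1 mu m k].

(* nu(dx,du) = nu'(u)(dx) p(du). *)
Definition disintegrates (nu : Psub R SW)
    (nu' : W T N -> Psub R S) (p : W T N -> R) : Prop :=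
  forall B : set (borel SW), measurable B ->
    (nu : subprobability _ _) B =
    (\sum_u (p u)%:E *
       (nu' u : subprobability _ _) [set x | B (x, u)])%E.

Definition Gamma (K : set Vspace) (alpha : control) (m : Cm) : set (Cmu * Cm) :=
  \bigcup_(k in K) [set mm : Cmu * Cm |
    (forall t, disintegrates (k.1 t) (mm.1 t) (law alpha m t)) /\
    (forall t, disintegrates (k.2 t) (mm.2 t) (law alpha m t))].

Definition Phi (lambda : R) (mu : Cmu) (m : Cm) : set (Cmu * Cm) :=
  [set mm | exists2 alpha, is_alpha_lambda lambda mu m alpha &
     Gamma (Theta mu m alpha) alpha m mm].

End Game.

(* Main.v *)
Require Import Defs.
From HB Require Import structures.
From mathcomp Require Import all_boot all_order all_algebra all_fingroup.
From mathcomp Require Import all_classical all_reals all_analysis.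
From mathcomp Require Import measurable_realfun.
From mathcomp Require Import zify ring lra.
Set Implicit Arguments.
Unset Strict Implicit.
Unset Printing Implicit Defensive.
Import Order.TTheory GRing.Theory Num.Theory.
Import numFieldNormedType.Exports.

(** A fixed point of the equilibrium map is a consistent pair (mu, m): mu_t(u)
    and m_t(u) are the conditional laws, given the path u of the major player,
    of the state of a minor player who stops at time t, resp. goes on, and this
    minor player stops optimally against the rewards and transitions which mu
    and m generate.

    The equilibrium is looked for among stopping rules sigma_t(u, x), the
    probability of stopping at time t in the state x on the path u, rather than
    by a set-valued fixed point theorem on measures. A rule determines the
    conditional laws forward in time (flow_mu, flow_m) without any reference to
    the control of the major player, because the path u' reached at time t + 1
    determines the path it came from (parent): given u', the state is
    distributed as m_t(parent u') moved by the minor kernel. Backward in time,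
    these laws determine the Gibbs response of the major player, and then the
    rewards of stopping and of continuing for the minor player. What is asked
    for is complementarity: sigma > 0 only where stopping is as good as
    continuing, sigma < 1 only where continuing is as good as stopping.

    For rules of the form sum_i s_i theta_i, with theta a partition of unity of
    mesh 1/n, this is a complementarity problem on a finite-dimensional cube.
    It is solved by cube_complementarity, a form of Brouwer's theorem deduced
    from Kuhn's combinatorial lemma, and yields a rule for which
    complementarity holds up to a displacement by 1/n (approximate_rule). The
    rules need not converge as n grows, but their flows do along an ultrafilter,
    since the subprobabilities on a compact metric space are weakly compact
    (psub_compact, by the Riesz representation), and all rewards converge
    uniformly with them. In the limit, mu_t(u) does not charge the states where
    continuing is strictly better, nor m_t(u) those where stopping is
    (stopping_equilibrium).

    It remains to recognise an equilibrium. The Gibbs variational principle and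
    a telescoping of the Bellman equation show that the Gibbs control is the
    regularized optimum alpha^lambda (alpha_lambda_exists). Mixing mu_t(u) and
    m_t(u) by the law p_t of the path gives a pair k in R[m; alpha]
    (mixture_Rset). Testing the equation that defines R[m; alpha] against the
    value function v of the minor player writes the payoff of any competitor as
    the initial value minus the integrals of two nonnegative regrets,
    v - stop_reward and v - continue_reward (payoff_regret); for k both
    integrals vanish by complementarity, so k is optimal. *)

(** * Kuhn's lemma on labelled grids *)

(** Removing an orbit {x, f x} leaves a stable set with two elements fewer. The
    parity counts of this part are instances. *)
Lemma even_card_involution (X : finType) (A : {set X}) (f : X -> X) :
  {in A, forall x, [/\ f x \in A, f (f x) = x & f x != x]} -> ~~ odd #|A|.
Proof.
have [n] := ubnP #|A|; elim: n A => // n IHn A; rewrite ltnS => le_An fA.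
have [->|[x xA]] := set_0Vmem A; first by rewrite cards0.
have [fxA ffx fxN] := fA _ xA.
have fx' : f x \in A :\ x by rewrite finset.in_setD1 fxN.
rewrite (cardsD1 x) xA (cardsD1 (f x) (A :\ x)) fx' /= negbK.
apply: IHn => [|y].
  by move: le_An; rewrite (cardsD1 x) xA (cardsD1 (f x) (A :\ x)) fx'; lia.
rewrite !finset.in_setD1 => /and3P[yfx yx yA]; have [fyA ffy fyN] := fA _ yA.
split=> //; rewrite fyA andbT; apply/andP; split.
  by apply: contra yx => /eqP e; rewrite -ffy e ffx.
by apply: contra yfx => /eqP e; rewrite -ffy e.
Qed.

Section Kuhn.
Variables (K M : nat) (lab : {ffun 'I_K -> nat} -> nat).
Hypotheses (M_gt0 : 0 < M) (lab_le : forall v, lab v <= K).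
Hypothesis lab_lo : forall (v : {ffun 'I_K -> nat}) (c : 'I_K), v c = 0 -> lab v <= c.
Hypothesis lab_hi : forall (v : {ffun 'I_K -> nat}) (c : 'I_K), v c = M -> lab v != c.

(** Kuhn's triangulation of the grid {0, ..., M}^K: a cell is the corner p of a
    unit cube together with a permutation q, where q c is the step at which the
    coordinate c is increased along a monotone path from p to p + (1, ..., 1). *)
Definition kuhn_cell : Type := ({ffun 'I_K -> 'I_M.+1} * {perm 'I_K})%type.

Definition kuhn_vertex (s : kuhn_cell) (i : nat) : {ffun 'I_K -> nat} :=
  [ffun c => s.1 c + (s.2 c < i)].

(** The k-simplices of the face on which the coordinates from k on vanish. The
    permutation has to fix these coordinates, so that each simplex has only one
    code. *)
Definition kuhn_simplex (k : nat) (s : kuhn_cell) : bool :=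
  [forall c : 'I_K, if c < k then s.1 c < M
                    else ((s.1 c : nat) == 0) && (s.2 c == c)].

(** Sperner's completely labelled simplices. *)
Definition full (k : nat) (s : kuhn_cell) : bool :=
  kuhn_simplex k s &&
  [forall l : 'I_K.+1, (l <= k) ==>
    [exists i : 'I_K.+1, (i <= k) && (lab (kuhn_vertex s i) == l)]].

(** A door is a simplex with a marked vertex such that the labels below k all
    occur on the opposite facet. *)
Definition door (k : nat) (x : kuhn_cell * 'I_K.+1) : bool :=
  [&& kuhn_simplex k x.1, x.2 <= k &
   [forall l : 'I_K.+1, (l < k) ==>
    [exists i : 'I_K.+1,
      [&& i <= k, i != x.2 & lab (kuhn_vertex x.1 i) == l]]]].

Lemma doorP k (x : kuhn_cell * 'I_K.+1) : reflect
  [/\ kuhn_simplex k x.1, x.2 <= k & forall l, l < k -> l <= K ->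
     exists i : nat, [/\ i <= k, i <= K, i != x.2 & lab (kuhn_vertex x.1 i) = l]]
  (door k x).
Proof.
apply: (iffP and3P) => -[Hs Hj H]; split=> //.
  move=> l lk lK.
  have := forallP H (Ordinal (lK : l < K.+1)).
  move=> /implyP /(_ lk) /existsP[i /and3P[ik ij /eqP e]].
  by exists i; split=> //; rewrite -ltnS.
apply/forallP => l; apply/implyP => lk.
have [i [ik iK ij e]] := H l lk (ltn_ord l : l <= K).
apply/existsP; exists (Ordinal (iK : i < K.+1)).
by rewrite ik /= e eqxx -val_eqE /= ij.
Qed.

(** A vertex of a k-simplex has coordinate k equal to 0, so that lab_lo bounds
    its label. *)
Lemma simplex_lab k s i : k <= K -> i <= k -> kuhn_simplex k s ->
  lab (kuhn_vertex s i) <= k.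
Proof.
move=> kK ik /forallP Hs.
have [kK'|Kk] := ltnP k K; last by apply: leq_trans Kk.
have := Hs (Ordinal kK'); rewrite ltnn => /andP[/eqP p0 /eqP q0].
apply: (lab_lo (c := Ordinal kK')); rewrite ffunE q0 /= p0; lia.
Qed.

(** The facet of a door has k vertices and carries k labels, so each label
    below k occurs exactly once. *)
Lemma door_bij k (x : kuhn_cell * 'I_K.+1) : k <= K -> door k x ->
  (forall i, i <= k -> i != x.2 -> lab (kuhn_vertex x.1 i) < k) /\
  (forall i i', i <= k -> i' <= k -> i != x.2 -> i' != x.2 ->
  lab (kuhn_vertex x.1 i) = lab (kuhn_vertex x.1 i') -> i = i').
Proof.
move=> kK /doorP[Hs Hj Hl].
pose D := [set i : 'I_K.+1 | (i <= k) && (i != x.2)].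
pose L := [set l : 'I_K.+1 | l < k].
pose f (i : 'I_K.+1) : 'I_K.+1 := inord (lab (kuhn_vertex x.1 i)).
have fE i : f i = lab (kuhn_vertex x.1 i) :> nat by rewrite /f inordK // ltnS.
have cL n : n <= K -> #|[set l : 'I_K.+1 | l <= n]| = n.+1.
  move=> nK.
  have -> : [set l : 'I_K.+1 | l <= n] = [set widen_ord (nK : n.+1 <= K.+1) i | i in 'I_n.+1].
    apply/finset.setP => l; rewrite inE; apply/idP/imsetP => [ln|[i _ ->]].
      by exists (Ordinal (ln : l < n.+1)) => //; apply: val_inj.
    by rewrite /= -ltnS.
  by rewrite card_imset ?card_ord // => a b /(congr1 val) /= /val_inj.
have cLD : #|L| = #|D|.
  have -> : D = [set i : 'I_K.+1 | i <= k] :\ x.2.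
    by apply/finset.setP => i; rewrite !inE andbC.
  have := cardsD1 x.2 [set i : 'I_K.+1 | i <= k]; rewrite inE Hj cL // add1n => -[<-].
  rewrite /L; case: (k) kK => [|k'] kK'.
    by apply: eq_card0 => l; rewrite !inE.
  exact: (cL k' (ltnW kK')).
have LD : L \subset f @: D.
  apply/fintype.subsetP => l; rewrite inE => lk.
  have [i [ik iK ij e]] := Hl l lk (ltn_ord l : l <= K).
  apply/imsetP; exists (Ordinal (iK : i < K.+1)); last by apply: val_inj; rewrite /= fE.
  by rewrite inE /= ik -val_eqE.
have cfD : #|f @: D| = #|D|.
  by apply/eqP; rewrite eqn_leq leq_imset_card -cLD subset_leq_card.
have eLD : L = f @: D by apply/eqP; rewrite eqEcard LD cfD cLD leqnn.
split=> [i ik ij|].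
  have iK : i < K.+1 by lia.
  have : f (Ordinal iK) \in L.
    by rewrite eLD; apply: imset_f; rewrite inE /= ik -val_eqE.
  by rewrite inE fE.
have /imset_injP inj : #|f @: D| == #|D| by apply/eqP.
move=> i i' ik ik' ij ij' e.
have iK : i < K.+1 by lia.
have iK' : i' < K.+1 by lia.
have : Ordinal iK = Ordinal iK'.
  apply: inj; rewrite ?inE -?val_eqE /= ?ik ?ik' //.
  by apply: val_inj; rewrite /= !fE.
by case.
Qed.

Lemma fullP k s : k <= K -> reflect (kuhn_simplex k s /\
   forall l, l <= k -> exists2 i : nat, i <= k & lab (kuhn_vertex s i) = l) (full k s).
Proof.
move=> kK; apply: (iffP andP) => -[Hs H]; split=> //.
  move=> l lk; have lK : l < K.+1 by lia.
  have /implyP /(_ lk) /existsP[i /andP[ik /eqP e]] := forallP H (Ordinal lK).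
  by exists i.
apply/forallP => l; apply/implyP => lk; have [i ik e] := H l lk.
have iK : i < K.+1 by lia.
by apply/existsP; exists (Ordinal iK); rewrite /= ik e eqxx.
Qed.

(** The other vertex with the label of the marked vertex, when there is one. *)
Definition twin (k : nat) (x : kuhn_cell * 'I_K.+1) : kuhn_cell * 'I_K.+1 :=
  (x.1, odflt x.2 [pick i : 'I_K.+1 | [&& i <= k, i != x.2 &
     lab (kuhn_vertex x.1 i) == lab (kuhn_vertex x.1 x.2)]]).

Definition doors (k : nat) := [set x | door k x].

(** Doors counted simplex by simplex: a completely labelled simplex has a
    single door, marked at the vertex labelled k, and the doors marked at a
    vertex with a smaller label come in pairs exchanged by twin. *)
Lemma odd_full_doors k : k <= K -> odd #|[set s | full k s]| = odd #|doors k|.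
Proof.
move=> kK.
pose Y := [set x : kuhn_cell * 'I_K.+1 | lab (kuhn_vertex x.1 x.2) == k].
rewrite -(cardsID Y (doors k)) oddD.
suff -> : odd #|doors k :\: Y| = false.
  rewrite addbF; congr odd; symmetry.
  have inj1 : {in doors k :&: Y &, injective (fun x : kuhn_cell * 'I_K.+1 => x.1)}.
    move=> [s j] [s' j'] /=; rewrite !inE /= => /andP[d /eqP y] /andP[d' /eqP y'] ess.
    subst s'; congr pair; apply/val_inj/eqP; apply: contraFT (ltnn k) => jj'.
    have /doorP[_ /= Hj' _] := d'; have [H _] := door_bij kK d.
    by rewrite -{1}y' (H j') // eq_sym.
  rewrite -(card_in_imset inj1); congr #|pred_of_set _|; apply/finset.setP => s.
  rewrite inE; apply/imsetP/fullP => // [[[s' j] + ->]|[Hs H]] /=.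
    rewrite !inE /= => /andP[/doorP[/= Hs Hj H] /eqP y]; split=> // l.
    rewrite leq_eqVlt => /predU1P[->|lk]; first by exists j.
    by have [|i [ik _ _ <-]] := H l lk; [lia | exists i].
  have [j jk e] := H k (leqnn k).
  have jK : j < K.+1 by lia.
  exists (s, Ordinal jK) => //; rewrite !inE /= e eqxx andbT.
  apply/doorP; split=> //= l lk lK; have [i ik ei] := H l (ltnW lk).
  exists i; split=> //; first lia.
  by apply: contraTneq lk => ij; rewrite -ei ij e ltnn.
apply/negbTE/(@even_card_involution _ _ (twin k)) => -[s j].
move=> sjD; have := sjD; rewrite finset.in_setD [_ \in Y]inE [_ \in doors _]inE.
move=> /andP[/= Y' d]; have /doorP[/= Hs Hj H] := d.
have [Hlt Hinj] := door_bij kK d.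
have ljk : lab (kuhn_vertex s j) < k by rewrite ltn_neqAle Y' simplex_lab.
have [i [ik iK ij ei]] := H _ ljk (lab_le _).
have iK' : i < K.+1 by lia.
have tE (j1 j2 : 'I_K.+1) : j1 != j2 -> j2 <= k ->
   lab (kuhn_vertex s j1) = lab (kuhn_vertex s j2) ->
   (forall i1 i2, i1 <= k -> i2 <= k -> i1 != j1 -> i2 != j1 ->
     lab (kuhn_vertex s i1) = lab (kuhn_vertex s i2) -> i1 = i2) ->
   twin k (s, j1) = (s, j2).
  move=> n12 j2k e12 inj12; rewrite /twin /=; case: pickP => [j3|/(_ j2)] /=.
    move=> /and3P[j3k j3n /eqP e3]; congr pair; apply: val_inj => /=.
    by apply: inj12 => //; rewrite 1?eq_sym // e3.
  by rewrite j2k eq_sym n12 e12 eqxx.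
set i0 := Ordinal iK'.
have d' : door k (s, i0).
  apply/doorP; split=> //= l lk lK; have [i1 [i1k i1K i1j e1]] := H l lk lK.
  case: (eqVneq i1 i) => [i1i|i1i]; last by exists i1.
  exists j; split=> //; first lia; first by rewrite eq_sym.
  by rewrite -ei -i1i.
have [_ Hinj'] := door_bij kK d'.
have ji0 : j != i0 by rewrite -val_eqE /= eq_sym.
have ij0 : i0 != j by rewrite eq_sym.
rewrite (tE j i0) // (tE i0 j) //.
split=> //; first by rewrite finset.in_setD [_ \in Y]inE [_ \in doors _]inE /= ei Y' d'.
by rewrite xpair_eqE eqxx /= eq_sym.
Qed.

Section Step.
Variables (k : nat) (kK : k < K).
Let ck : 'I_K := Ordinal kK.

(** The renumbering of the steps 0, ..., k when the first step becomes the last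
    one. *)
Definition shift_fun (c : 'I_K) : 'I_K :=
  if c <= k then
    if (c : nat) == 0 then ck
    else Ordinal (leq_ltn_trans (leq_pred c) (ltn_ord c))
  else c.

Lemma shift_funE c : shift_fun c =
  (if c <= k then if (c : nat) == 0 then k else c.-1 else c) :> nat.
Proof. by rewrite /shift_fun; do 2 case: ifP => //. Qed.

Lemma shift_inj : injective shift_fun.
Proof.
move=> a b /(congr1 val); rewrite /= !shift_funE => e; apply: val_inj => /=.
move: e; do 2 case: ifP => ?; do ?[case: ifP => /eqP ?]; lia.
Qed.

Definition cshift : {perm 'I_K} := perm shift_inj.

Lemma cshiftE c : cshift c =
  (if c <= k then if (c : nat) == 0 then k else c.-1 else c) :> nat.
Proof. by rewrite permE shift_funE. Qed.

Lemma cshiftVE c : (cshift^-1)%g c =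
  (if (c : nat) == k then 0 else if c < k then c.+1 else c) :> nat.
Proof.
rewrite -{2 3 4 5}[c](permKV cshift); set d := (cshift^-1)%g c; rewrite cshiftE.
do ?case: ifP; lia.
Qed.

(** The other simplex with the same facet opposite to the vertex j. Giving up
    the first (last) vertex moves the corner forward (backward) by one step and
    renumbers the steps cyclically; giving up an inner vertex exchanges two
    consecutive steps. *)
Definition slide (x : kuhn_cell * 'I_K.+1) : kuhn_cell * 'I_K.+1 :=
  let: (p, q, j) := x in
  if (j : nat) == 0 then
    ([ffun c => inord (p c + ((q c : nat) == 0))], (q * cshift)%g, inord k.+1)
  else if (j : nat) == k.+1 then
    ([ffun c => inord (p c - ((q c : nat) == k))], (q * cshift^-1)%g, ord0)
  else (p, (q * tperm (insubd ck j.-1) (insubd ck (j : nat)))%g, j).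

Arguments slide : simpl never.

(** The facets contained in a hyperplane x_c = 0, where c is the coordinate
    increased last. Among doors only c = k occurs, as lab_lo bounds by c the
    labels of the facet. *)
Definition wall : {set kuhn_cell * 'I_K.+1} :=
  [set x : kuhn_cell * 'I_K.+1 | ((x.2 : nat) == k.+1) && (x.1.1 ((x.1.2)^-1%g ck) == 0 :> nat)].

Lemma simplexP (s : kuhn_cell) : reflect
  ((forall c : 'I_K, c <= k -> s.1 c < M /\ s.2 c <= k) /\
   (forall c : 'I_K, k < c -> s.1 c = 0 :> nat /\ s.2 c = c :> nat))
  (kuhn_simplex k.+1 s).
Proof.
apply: (iffP forallP) => [H|[H1 H2] c].
  have H2 (c : 'I_K) : k < c -> s.1 c = 0 :> nat /\ s.2 c = c :> nat.
    by move=> kc; have := H c; rewrite ltnS leqNgt kc /= => /andP[/eqP ? /eqP ->].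
  split=> // c ck'; split; first by have := H c; rewrite ltnS ck'.
  rewrite leqNgt; apply/negP => kq.
  have [_ /val_inj/perm_inj e] := H2 _ kq.
  by move: kq; rewrite e ltnNge ck'.
rewrite ltnS; case: (leqP c k) => kc; first by have [] := H1 c kc.
by have [-> /val_inj ->] := H2 c kc; rewrite !eqxx.
Qed.

(** The coordinate increased first cannot reach M on the facet: by lab_hi its
    label would then be missing. Hence the cell can be moved forward. *)
Lemma slide_first (p : {ffun 'I_K -> 'I_M.+1}) (q : {perm 'I_K}) (j : 'I_K.+1) :
  door k.+1 (p, q, j) -> j = 0 :> nat ->
  let y := slide (p, q, j) in
  [/\ y \in doors k.+1 :\: wall, slide y = (p, q, j) & y != (p, q, j)].
Proof.
move=> /doorP[/= /simplexP[/= H1 H2] _ Hl] j0.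
have kS : (inord k.+1 : 'I_K.+1) = k.+1 :> nat by rewrite inordK.
have pM c : p c + ((q c : nat) == 0) < M.+1.
  have := ltn_ord (p c); case: eqP => [qc0|_]; last by rewrite addn0.
  have [ck'|kc] := leqP c k; last by have [_ e] := H2 c kc; lia.
  by have [] := H1 c ck'; lia.
have pM' (c : 'I_K) : c <= k -> p c + ((q c : nat) == 0) < M.
  move=> ck'; have [pc qc] := H1 c ck'.
  case: eqP => [qc0|_]; last by rewrite addn0.
  rewrite ltn_neqAle; apply/andP; split; last by lia.
  apply/negP => /eqP e.
  have [i [ik iK ij ei]] := Hl c ck' (ltnW (ltn_ord c)).
  have := @lab_hi (kuhn_vertex (p, q) i) c; rewrite ei eqxx ffunE /= qc0.
  by have -> : 0 < i by [move: ij; rewrite j0; lia]; move=> /(_ e).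
pose p' := [ffun c => inord (p c + ((q c : nat) == 0)) : 'I_M.+1].
pose q' := (q * cshift)%g.
have -> : slide (p, q, j) = (p', q', inord k.+1) by rewrite /slide j0 eqxx.
have p'E c : p' c = p c + ((q c : nat) == 0) :> nat by rewrite ffunE inordK ?pM.
have q'E c : q' c = cshift (q c) by rewrite permM.
have vE i : i <= k -> kuhn_vertex (p', q') i = kuhn_vertex (p, q) i.+1.
  move=> ik; apply/ffunP => c; rewrite !ffunE /= inordK // q'E cshiftE.
  by do ?case: ifP; lia.
split.
- rewrite finset.in_setD !inE /= kS eqxx /=; apply/andP; split.
    rewrite p'E; set c := (q'^-1)%g ck.
    have : cshift (q c) = k :> nat by rewrite -q'E permKV.
    by rewrite cshiftE; do ?case: ifP; lia.
  apply/doorP; rewrite /= kS; split=> //.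
    apply/simplexP; split=> /= c kc.
      rewrite p'E q'E cshiftE; split; first exact: pM'.
      by have [_] := H1 c kc; do ?case: ifP; lia.
    have [p0 qc] := H2 c kc; rewrite p'E qc p0; split; first by lia.
    by rewrite q'E cshiftE qc; do ?case: ifP; lia.
  move=> l lk lK; have [i [ik iK ij ei]] := Hl l lk lK.
  have i0 : 0 < i by lia.
  by exists i.-1; rewrite vE ?prednK //; [split=> //; lia | lia].
- rewrite /slide kS /= eqxx; congr (_, _, _); last by apply: val_inj; rewrite /= j0.
    apply/ffunP => c; rewrite ffunE; apply: val_inj; rewrite /= p'E q'E cshiftE.
    rewrite inordK; last by have := pM c; lia.
    by have := ltn_ord (q c); do ?case: ifP; lia.
  by rewrite /q' mulgK.
- by rewrite !xpair_eqE negb_and -[inord _ == j]val_eqE /= kS j0 orbT.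
Qed.

(** Off the wall, the coordinate increased last is positive at the corner, so
    that the cell can be moved backward. *)
Lemma slide_last (p : {ffun 'I_K -> 'I_M.+1}) (q : {perm 'I_K}) (j : 'I_K.+1) :
  door k.+1 (p, q, j) -> j = k.+1 :> nat -> (p, q, j) \notin wall ->
  let y := slide (p, q, j) in
  [/\ y \in doors k.+1 :\: wall, slide y = (p, q, j) & y != (p, q, j)].
Proof.
move=> /doorP[/= /simplexP[/= H1 H2] _ Hl] jk; rewrite inE /= jk eqxx /= => pk.
have p_gt0 (c : 'I_K) : q c = k :> nat -> 0 < p c.
  move=> qc; have -> : c = (q^-1)%g ck by rewrite -[c](permK q); congr (_ _); apply: val_inj.
  by rewrite lt0n.
pose p' := [ffun c => inord (p c - ((q c : nat) == k)) : 'I_M.+1].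
pose q' := (q * cshift^-1)%g.
have -> : slide (p, q, j) = (p', q', ord0) by rewrite /slide jk /= eqxx.
have p'E c : p' c = p c - ((q c : nat) == k) :> nat.
  by rewrite ffunE inordK //; have := ltn_ord (p c); lia.
have q'E c : q' c = (cshift^-1)%g (q c) by rewrite permM.
have vE i : i <= k -> kuhn_vertex (p', q') i.+1 = kuhn_vertex (p, q) i.
  move=> ik; apply/ffunP => c; rewrite ffunE /= [in RHS]ffunE /= p'E q'E cshiftVE.
  have := @p_gt0 c; have := H1 c; have := H2 c.
  by do ?case: ifP; lia.
split.
- rewrite !inE /=; apply/doorP => /=; split=> //.
    apply/simplexP; split=> /= c kc.
      rewrite p'E q'E cshiftVE; have := H1 c kc; split; first by lia.
      by do ?case: ifP; lia.
    have [p0 qc] := H2 c kc; rewrite p'E qc p0; split; first by lia.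
    by rewrite q'E cshiftVE qc; do ?case: ifP; lia.
  move=> l lk lK; have [i [ik iK ij ei]] := Hl l lk lK.
  by exists i.+1; rewrite vE; [split=> //; lia | lia].
- rewrite /slide /=; congr (_, _, _).
  + apply/ffunP => c; rewrite ffunE; apply: val_inj; rewrite /= p'E q'E cshiftVE.
    have := @p_gt0 c; have := ltn_ord (p c).
    by move=> *; rewrite inordK; do ?case: ifP; lia.
  + by rewrite /q' mulgKV.
  + by apply: val_inj; rewrite /= jk (@inordK K) //; lia.
- by rewrite !xpair_eqE negb_and -[ord0 == j]val_eqE /= jk orbT.
Qed.

Lemma slide_mid (p : {ffun 'I_K -> 'I_M.+1}) (q : {perm 'I_K}) (j : 'I_K.+1) :
  door k.+1 (p, q, j) -> j != 0 :> nat -> j != k.+1 :> nat ->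
  let y := slide (p, q, j) in
  [/\ y \in doors k.+1 :\: wall, slide y = (p, q, j) & y != (p, q, j)].
Proof.
move=> /doorP[/= /simplexP[/= H1 H2] jk' Hl] j0 jk.
pose a := insubd ck j.-1; pose b := insubd ck (j : nat).
pose q' := (q * tperm a b)%g.
have -> : slide (p, q, j) = (p, q', j) by rewrite /slide (negbTE j0) (negbTE jk).
have aE : a = j.-1 :> nat by rewrite val_insubd; case: ifP; lia.
have bE : b = j :> nat by rewrite val_insubd; case: ifP; lia.
have q'E c : q' c = tperm a b (q c) by rewrite permM.
have tE c : tperm a b c = (if c == j.-1 :> nat then j : nat else
                           if c == j :> nat then j.-1 else c) :> nat.
  case: tpermP => [->|->|/eqP ca /eqP cb]; rewrite ?aE ?bE ?eqxx //.
    by case: ifP; lia.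
  by move: ca cb; rewrite -!val_eqE /= aE bE => /negbTE -> /negbTE ->.
have vE (i : nat) : i != j -> kuhn_vertex (p, q') i = kuhn_vertex (p, q) i.
  by move=> ij; apply/ffunP => c; rewrite !ffunE /= q'E tE; do ?case: ifP; lia.
split.
- rewrite !inE /= (negbTE jk) /=; apply/doorP => /=; split=> //.
    apply/simplexP; split=> /= c kc.
      by rewrite q'E tE; have := H1 c kc; split; [lia|do ?case: ifP; lia].
    have [p0 qc] := H2 c kc; rewrite p0; split=> //.
    by rewrite q'E tE qc; do ?case: ifP; lia.
  move=> l lk lK; have [i [ik iK ij ei]] := Hl l lk lK.
  by exists i; rewrite vE.
- rewrite /slide (negbTE j0) (negbTE jk) -/a -/b; congr (_, _, _).
  by rewrite /q' -mulgA tperm2 mulg1.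
- rewrite !xpair_eqE !eqxx /= andbT; apply/eqP => /permP /(_ ((q^-1)%g a)).
  by rewrite q'E permKV tpermL => /(congr1 val) /=; rewrite aE bE; lia.
Qed.

(** Doors counted facet by facet: an inner facet belongs to two simplices,
    exchanged by slide, and the facets in the wall are the completely labelled
    simplices of the dimension below. *)
Lemma odd_doors_full : odd #|doors k.+1| = odd #|[set s | full k s]|.
Proof.
rewrite -(cardsID wall (doors k.+1)) oddD.
suff -> : odd #|doors k.+1 :\: wall| = false.
  rewrite addbF; congr odd.
  have kS : (inord k.+1 : 'I_K.+1) = k.+1 :> nat by rewrite inordK.
  pose g s : kuhn_cell * 'I_K.+1 := (s, inord k.+1).
  have ginj : injective g by move=> s s' [].
  rewrite -(card_imset _ ginj); congr #|pred_of_set _|; apply/finset.setP => -[[p q] j].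
  rewrite !inE; apply/idP/imsetP => [/and3P[d /eqP/= jk /eqP pk]|].
    exists (p, q); last by rewrite /g; congr (_, _); apply: val_inj; rewrite /= kS.
    have /doorP[/= /simplexP[/= H1 H2] _ Hl] := d.
    set c := (q^-1)%g ck in pk; have qc : q c = ck by rewrite permKV.
    have ck' : c <= k.
      by rewrite leqNgt; apply/negP => /[dup] kc /H2[_]; rewrite qc /=; lia.
    have [i [ik iK ij ei]] := Hl k (leqnn _) (ltnW kK).
    have cE : c = ck.
      apply/val_inj/eqP; rewrite /= eqn_leq ck' -{1}ei; apply: lab_lo.
      by rewrite ffunE /= pk qc /=; lia.
    rewrite inE; apply/fullP; first exact: ltnW.
    split=> [|l lk]; last first.
      have [|i1 [i1k _ i1j <-]] := Hl l lk; first by lia.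
      by exists i1 => //; move: i1k i1j; rewrite jk; lia.
    apply/forallP => d'; case: ltngtP => [dk|kd|dk] /=.
    - by have [] := H1 d' (ltnW dk).
    - by have [-> /val_inj ->] := H2 d' kd; rewrite !eqxx.
    - have -> : d' = c by rewrite cE; apply: val_inj.
      by rewrite pk qc cE !eqxx.
  move=> [s +] [pE jE]; rewrite inE -{}pE => /fullP[|Hs Hl]; first exact: ltnW.
  have {}jE : j = k.+1 :> nat by rewrite jE kS.
  have := forallP Hs ck; rewrite ltnn => /andP[/eqP /= pk /eqP /= qk].
  have qVk : (q^-1)%g ck = ck by apply: (canLR (permK _)); rewrite qk.
  rewrite /= jE eqxx qVk pk eqxx !andbT.
  apply/doorP => /=; rewrite jE; split=> // [|l lk lK].
    apply/forallP => c; have := forallP Hs c; rewrite ltnS.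
    case: (ltngtP c k) => [//|//|ck' _].
    by have -> : c = ck; [apply: val_inj | rewrite /= pk].
  by have [i ik ei] := Hl l lk; exists i; split; lia.
apply/negbTE/(@even_card_involution _ _ slide) => -[[p q] j].
rewrite finset.in_setD [_ \in doors _]inE => /andP[w d].
have [j0|j0] := eqVneq (j : nat) 0; first exact: slide_first.
have [jk|jk] := eqVneq (j : nat) k.+1; first exact: slide_last.
exact: slide_mid.
Qed.
End Step.

(** Induction on the dimension: the two counts of the doors agree in parity,
    and in dimension 0 the only simplex is the origin. *)
Lemma odd_full k : k <= K -> odd #|[set s | full k s]|.
Proof.
elim: k => [_|k IH kK]; last by rewrite odd_full_doors // odd_doors_full // IH // ltnW.
have -> : [set s | full 0 s] = [set ([ffun=> ord0], 1%g)]; last by rewrite cards1.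
apply/finset.setP => s; rewrite !inE; apply/fullP/eqP => // [[Hs _]|->].
  case: s Hs => p q /forallP /= H; congr pair.
    by apply/ffunP => c; rewrite ffunE; have /andP[/eqP ? _] := H c; apply: val_inj.
  by apply/permP => c; rewrite perm1; have /andP[_ /eqP] := H c.
have Hs : kuhn_simplex 0 ([ffun=> ord0], 1%g).
  by apply/forallP => c; rewrite /= ffunE perm1 !eqxx.
split=> // l; rewrite leqn0 => /eqP ->; exists 0 => //.
by apply/eqP; rewrite -leqn0; exact: simplex_lab.
Qed.

Lemma kuhn : exists p : {ffun 'I_K -> nat}, (forall c, p c < M) /\
  forall l, l <= K -> exists2 v : {ffun 'I_K -> nat},
    forall c, p c <= v c <= (p c).+1 & lab v = l.
Proof.
have /odd_gt0/card_gt0P[[p q]] := odd_full (leqnn K).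
rewrite inE => /fullP[//|/forallP Hs Hl].
exists [ffun c => p c : nat]; split=> [c|l lK].
  by rewrite ffunE; have := Hs c; rewrite ltn_ord.
have [i _ <-] := Hl l lK; exists (kuhn_vertex (p, q) i) => // c.
by rewrite !ffunE /=; lia.
Qed.
End Kuhn.

Local Open Scope classical_set_scope.
Local Open Scope ring_scope.

(** * Complementarity on the cube *)

Section UltraLimits.
Context {I : Type} {U : set_system I} {UU : UltraFilter U}.

Lemma ultra_compact_cvg (X : topologicalType) (A : set X) (s : I -> X) :
  compact A -> (forall i, A (s i)) -> exists2 p, A p & s @ U --> p.
Proof.
move=> cA As; have sUA : (s @ U) A by apply: (@filterE _ U).
have [p [Ap cp]] := cA (s @ U) _ sUA.
exists p => // B Bp; have [//|UB] := in_ultra_setVsetC (s @^-1` B) UU.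
have [x []] := cp (~` B) B UB Bp.
by [].
Qed.

Lemma ultra_bounded_cvg (R : realType) (s : I -> R) (a b : R) :
  (forall i, a <= s i <= b) -> exists2 l, a <= l <= b & s @ U --> l.
Proof.
move=> sab.
have [|l] := ultra_compact_cvg (@segment_compact R a b) (s := s).
  by move=> i; rewrite /= in_itv /= sab.
by rewrite /= in_itv /= => lab sl; exists l.
Qed.

Lemma limit_le (R : realType) (f g : I -> R) (a b : R) :
  f @ U --> a -> g @ U --> b -> (\forall i \near U, f i <= g i) -> a <= b.
Proof.
move=> fa gb fg.
have gfab : (fun i => g i - f i) @ U --> b - a by apply: cvgB.
rewrite -subr_ge0.
apply: (@closed_cvg _ _ U _ (fun i => g i - f i) (fun x : R => 0 <= x)) gfab.
  exact: closed_ge.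
by apply: filterS fg => i; rewrite subr_ge0.
Qed.
End UltraLimits.

(** Brouwer's theorem in complementarity form. On the grid of mesh 1/(n+1), the
    label of a point is the first coordinate c which is 0, or which is below 1
    with F c positive, and K if there is none. Grid cubes carrying all labels
    shrink to a point s along U. The vertices labelled K give F s c <= 0 if s c
    < 1; those labelled c give F s c >= 0 if s c > 0. *)
Lemma cube_complementarity_ord (R : realType) (U : set_system nat)
    {UU : UltraFilter U} (leU : \oo `<=` U) (K : nat)
    (F : ('I_K -> R) -> 'I_K -> R) :
  (forall (s : nat -> 'I_K -> R) (l : 'I_K -> R),
     (forall n c, 0 <= s n c <= 1) -> (forall c, 0 <= l c <= 1) ->
     (forall c, (fun n => s n c) @ U --> l c) ->
     forall c, (fun n => F (s n) c) @ U --> F l c) ->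
  exists2 s : 'I_K -> R, forall c, 0 <= s c <= 1 &
    forall c, (s c < 1 -> F s c <= 0) /\ (0 < s c -> 0 <= F s c).
Proof.
move=> Fcont.
pose pt n (v : {ffun 'I_K -> nat}) : 'I_K -> R := fun c => (v c)%:R / n.+1%:R.
pose lo n (v : {ffun 'I_K -> nat}) c :=
  (v c == 0%N) || ((v c != n.+1) && (0 < F (pt n v) c)).
pose lab n v := find (lo n v) (enum 'I_K).
have lab_le n v : (lab n v <= K)%N.
  by rewrite -[leqRHS](size_enum_ord K); exact: find_size.
have lab_lo n (v : {ffun 'I_K -> nat}) (c : 'I_K) : v c = 0%N -> (lab n v <= c)%N.
  move=> vc; rewrite leqNgt; apply/negP => /(before_find c).
  by rewrite nth_ord_enum /lo vc eqxx.
have labE n (v : {ffun 'I_K -> nat}) (c : 'I_K) : lab n v = c -> lo n v c.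
  move=> e; have : has (lo n v) (enum 'I_K).
    by rewrite has_find size_enum_ord -/(lab n v) e.
  by move=> /(nth_find c); rewrite -/(lab n v) e nth_ord_enum.
have labK n (v : {ffun 'I_K -> nat}) c : lab n v = K -> ~~ lo n v c.
  move=> e; have : ~~ has (lo n v) (enum 'I_K).
    by rewrite has_find size_enum_ord -/(lab n v) e ltnn.
  by move=> /hasPn; apply; rewrite mem_enum.
have lab_hi n (v : {ffun 'I_K -> nat}) (c : 'I_K) : v c = n.+1 -> lab n v != c.
  by move=> vc; apply/negP => /eqP /labE; rewrite /lo vc eqxx.
have /choice[p Hp] n := kuhn (ltn0Sn n) (lab_le n) (lab_lo n) (lab_hi n).
have /choice[V HV] : forall nl : nat * nat, exists v : {ffun 'I_K -> nat},
    (nl.2 <= K)%N -> (forall c, (p nl.1 c <= v c <= (p nl.1 c).+1)%N) /\ lab nl.1 v = nl.2.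
  move=> [n l]; have [lK|lK] := boolP (l <= K)%N; last by exists [ffun=> 0%N].
  by have [_ /(_ l lK)[v vp vl]] := Hp n; exists v.
have pM n c : (p n c < n.+1)%N by have [] := Hp n.
have V01 n l c : (l <= K)%N -> 0 <= pt n (V (n, l)) c <= 1.
  move=> lK; have [/(_ c) /andP[_ h] _] := HV (n, l) lK.
  rewrite divr_ge0 //= ler_pdivrMr // mul1r ler_nat.
  by apply: leq_trans h _; exact: pM.
have /choice[s Hs] : forall c, exists x : R, 0 <= x <= 1 /\
    (fun n => pt n (V (n, K)) c) @ U --> x.
  move=> c; have [x x01 xc] := ultra_bounded_cvg (fun n => V01 n K c (leqnn K)).
  by exists x.
have s01 c : 0 <= s c <= 1 by have [] := Hs c.
have cvgV l c : (l <= K)%N -> (fun n => pt n (V (n, l)) c) @ U --> s c.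
  move=> lK.
  have d0 : (fun n => pt n (V (n, l)) c - pt n (V (n, K)) c) @ U --> 0.
    have inv0 : (fun n => n.+1%:R^-1 : R) @ U --> 0.
      by move=> B /(@cvg_harmonic R) B0; exact: leU.
    have invN0 : (fun n => - n.+1%:R^-1 : R) @ U --> 0.
      by rewrite -oppr0; exact: cvgN.
    apply: (squeeze_cvgr _ invN0 inv0); apply: filterE => n.
    rewrite -ler_norml /pt -mulrBl normrM [X in _ * X]ger0_norm ?invr_ge0 //.
    rewrite ler_piMl ?invr_ge0 //.
    have [/(_ c) h1 _] := HV (n, l) lK; have [/(_ c) h2 _] := HV (n, K) (leqnn K).
    rewrite /= in h1 h2.
    have : (V (n, l) c <= V (n, K) c + 1)%N by lia.
    have : (V (n, K) c <= V (n, l) c + 1)%N by lia.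
    by rewrite -!(ler_nat R) !natrD ler_norml => ? ?; apply/andP; split; lra.
  have h := cvgD d0 (proj2 (Hs c)); rewrite add0r in h.
  pose f n := pt n (V (n, l)) c - pt n (V (n, K)) c + pt n (V (n, K)) c.
  have -> : (fun n => pt n (V (n, l)) c) = f by apply/funext => n; rewrite /f subrK.
  exact: h.
exists s => // c; split=> sc.
- have Fc := Fcont _ _ (fun n c => V01 n K c (leqnn K)) s01
    (fun c => cvgV K c (leqnn K)) c.
  have : \forall n \near U, pt n (V (n, K)) c < 1 by exact: cvgr_lt (proj2 (Hs c)) _ sc.
  move=> near1; apply: (limit_le Fc (cvg_cst 0)).
  apply: filterS near1 => n; rewrite /pt ltr_pdivrMr // mul1r ltr_nat => lt1.
  have [_ e0] := HV (n, K) (leqnn K).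
  have := labK n _ c e0; rewrite /lo negb_or => /andP[_]; rewrite negb_and negbK -leNgt => /orP[/eqP e|//].
  by move: lt1; rewrite /= in e; rewrite e ltnn.
- have cK : (c <= K)%N by exact: ltnW.
  have Fc := Fcont _ _ (fun n c' => V01 n c c' cK) s01 (fun c' => cvgV c c' cK) c.
  have : \forall n \near U, 0 < pt n (V (n, c : nat)) c by exact: cvgr_gt (cvgV c c cK) _ sc.
  move=> near1; apply: (limit_le (cvg_cst 0) Fc).
  apply: filterS near1 => n; rewrite /pt; have [_ /labE] := HV (n, c : nat) cK.
  by rewrite /lo => /orP[/eqP /= ->|/andP[_ /ltW //]]; rewrite mul0r ltxx.
Qed.

Lemma cube_complementarity (R : realType) (U : set_system nat)
    {UU : UltraFilter U} (leU : \oo `<=` U) (I : finType)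
    (F : (I -> R) -> I -> R) :
  (forall (s : nat -> I -> R) (l : I -> R),
     (forall n c, 0 <= s n c <= 1) -> (forall c, 0 <= l c <= 1) ->
     (forall c, (fun n => s n c) @ U --> l c) ->
     forall c, (fun n => F (s n) c) @ U --> F l c) ->
  exists2 s : I -> R, forall c, 0 <= s c <= 1 &
    forall c, (s c < 1 -> F s c <= 0) /\ (0 < s c -> 0 <= F s c).
Proof.
move=> Fcont.
pose G (s : 'I_#|I| -> R) (k : 'I_#|I|) := F (fun i => s (enum_rank i)) (enum_val k).
have [|s s01 Hs] := cube_complementarity_ord leU (F := G).
  move=> s l s01 l01 sl c; apply: Fcont => [n i|i|i]; [exact: s01|exact: l01|exact: sl].
exists (fun i => s (enum_rank i)) => [c|c]; first exact: s01.
by have := Hs (enum_rank c); rewrite /G enum_rankK.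
Qed.

(** * Bounded measurable functions *)

Section BoundedMeasurable.
Context {d} {X : measurableType d} {R : realType}.
Implicit Types (D : set X) (f g : X -> R).

(** Such functions are integrable for every measure which is finite on D, which
    leaves the linearity lemmas for integrals without integrability side
    conditions. *)
Definition bmeas D f := measurable_fun D f /\ exists M : R, forall x, D x -> `|f x| <= M.

Lemma bmeas_cst D c : bmeas D (fun=> c).
Proof. by split; [exact: measurable_cst|exists `|c|]. Qed.

Lemma bmeasD D f g : bmeas D f -> bmeas D g -> bmeas D (fun x => f x + g x).
Proof.
move=> [mf [M fM]] [mg [M' gM]]; split; first exact: measurable_funD.
by exists (M + M') => x Dx; rewrite (le_trans (ler_normD _ _))// lerD ?fM ?gM.
Qed.

Lemma bmeasM D f g : bmeas D f -> bmeas D g -> bmeas D (fun x => f x * g x).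
Proof.
move=> [mf [M fM]] [mg [M' gM]]; split; first exact: measurable_funM.
by exists (M * M') => x Dx; rewrite normrM ler_pM ?fM ?gM.
Qed.

Lemma bmeasZ D c f : bmeas D f -> bmeas D (fun x => c * f x).
Proof. exact: bmeasM (bmeas_cst D c). Qed.

Lemma bmeasN D f : bmeas D f -> bmeas D (fun x => - f x).
Proof.
by move=> [mf [M fM]]; split; [exact: measurable_funN|exists M => x; rewrite normrN; exact: fM].
Qed.

Lemma bmeasB D f g : bmeas D f -> bmeas D g -> bmeas D (fun x => f x - g x).
Proof. by move=> bf /bmeasN; exact: bmeasD. Qed.

Lemma bmeas_sum (I : Type) (r : seq I) (P : pred I) D (F : I -> X -> R) :
  (forall i, bmeas D (F i)) -> bmeas D (fun x => \sum_(i <- r | P i) F i x).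
Proof.
move=> bF; have -> : (fun x => \sum_(i <- r | P i) F i x) = \sum_(i <- r | P i) F i.
  by apply/funext => x; rewrite fct_sumE.
elim/big_ind: _ => [||i _]; [exact: bmeas_cst|exact: bmeasD|exact: bF].
Qed.

Lemma bmeas_exp D f : bmeas D f -> bmeas D (fun x => expR (f x)).
Proof.
move=> [mf [M fM]]; split.
  by apply: (@measurableT_comp _ _ _ _ _ _ (@expR R)) => //; exact: measurable_expR.
exists (expR M) => x Dx; rewrite ger0_norm ?expR_ge0// ler_expR.
by apply: le_trans (fM _ Dx); exact: ler_norm.
Qed.

Variable mu : {measure set X -> \bar R}.

Section On.
Variable D : set X.
Hypotheses (mD : measurable D) (muD : (mu D < +oo)%E).

Lemma bmeas_integrable f : bmeas D f -> mu.-integrable D (EFin \o f).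
Proof.
move=> [mf [M fM]]; apply: measurable_bounded_integrable => //.
exists M; split; first exact: num_real.
by move=> y My x /= Dx; apply: le_trans (fM _ Dx) (ltW My).
Qed.
Local Hint Resolve bmeas_integrable : core.

Lemma bintD f g : bmeas D f -> bmeas D g ->
  \int[mu]_(x in D) (f x + g x) = \int[mu]_(x in D) f x + \int[mu]_(x in D) g x.
Proof. by move=> bf bg; apply: RintegralD; auto. Qed.

Lemma bintB f g : bmeas D f -> bmeas D g ->
  \int[mu]_(x in D) (f x - g x) = \int[mu]_(x in D) f x - \int[mu]_(x in D) g x.
Proof. by move=> bf bg; apply: RintegralB; auto. Qed.

Lemma bintZ c f : bmeas D f ->
  \int[mu]_(x in D) (c * f x) = c * \int[mu]_(x in D) f x.
Proof. by move=> bf; apply: RintegralZl; auto. Qed.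

Lemma bint_sum (I : Type) (r : seq I) (P : pred I) (F : I -> X -> R) :
  (forall i, bmeas D (F i)) ->
  \int[mu]_(x in D) (\sum_(i <- r | P i) F i x) = \sum_(i <- r | P i) \int[mu]_(x in D) F i x.
Proof.
move=> bF; elim: r => [|i r IH].
  under eq_Rintegral do rewrite big_nil.
  by rewrite big_nil Rintegral_cst// mul0r.
rewrite big_cons; case: ifP => Pi.
  under eq_Rintegral do rewrite big_cons Pi.
  by rewrite bintD ?IH//; exact: bmeas_sum.
by under eq_Rintegral do rewrite big_cons Pi.
Qed.

Lemma le_bint f g : bmeas D f -> bmeas D g -> (forall x, D x -> f x <= g x) ->
  \int[mu]_(x in D) f x <= \int[mu]_(x in D) g x.
Proof. by move=> bf bg; apply: le_Rintegral; auto. Qed.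

Lemma bint_bound c f : bmeas D f -> (forall x, D x -> `|f x| <= c) ->
  `|\int[mu]_(x in D) f x| <= c * fine (mu D).
Proof.
move=> bf fc; rewrite -Rintegral_cst// ler_norml -mulN1r -bintZ; last exact: bmeas_cst.
by apply/andP; split; apply: le_bint => //; do ?[exact: bmeas_cst|apply: bmeasZ];
  rewrite // ?mulN1r => x Dx; rewrite ?mulN1r; have := fc _ Dx; rewrite ler_norml => /andP[].
Qed.

End On.
End BoundedMeasurable.

Section Borel.
Context {R : realType} {E : ptopologicalType}.

Lemma borel_open (A : set E) : open A -> measurable (A : set (borel E)).
Proof. by move=> oA; apply: sub_sigma_algebra. Qed.

Lemma borel_closed (A : set E) : closed A -> measurable (A : set (borel E)).
Proof.
by move=> cA; rewrite -[A]setCK; apply: measurableC; apply: borel_open; rewrite openC.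
Qed.

Lemma within_continuous_measurable (A : set E) (f : E -> R) :
  measurable (A : set (borel E)) -> {within A, continuous f} ->
  measurable_fun (A : set (borel E)) f.
Proof.
move=> mA /continuousP cf; apply: (measurability _ (RGenOpens.measurableE R)).
move=> _ [_ [a [b ->] <-]].
have oU : open (f @^-1` `]a, b[%classic : set (subspace A)) by exact/cf/interval_open.
move/open_subspaceP : oU => [V oV VA].
rewrite setIC -VA; apply: measurableI => //; exact: borel_open.
Qed.

Lemma continuous_measurable (f : E -> R) :
  continuous f -> measurable_fun [set: borel E] f.
Proof.
by move=> cf; apply: within_continuous_measurable => //; exact: continuous_subspaceT.
Qed.

Lemma within_continuous_bmeas (A : set E) (f : E -> R) :
  measurable (A : set (borel E)) -> compact A -> {within A, continuous f} ->
  bmeas (A : set (borel E)) f.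
Proof.
move=> mA cA cf; split; first exact: within_continuous_measurable.
have [M [_ HM]] := compact_bounded (continuous_compact cf cA).
exists (M + 1) => x Ax; apply: (HM (M + 1)); first by rewrite ltrDl.
by exists x.
Qed.

End Borel.

(** * The Riesz representation on a compact metric space *)

Section Riesz.
Context {R : realType} {S : pmetricType R}.
Hypothesis compactS : compact [set: S].

Lemma lipschitz1_continuous (f : S -> R) :
  (forall x y, f x <= f y + mdist x y) -> continuous f.
Proof.
move=> flip x; apply/cvgrPdist_lt => e e0; near=> y.
have xy : mdist x y < e.
  near: y; have := nbhsx_ballx x e e0; rewrite ballEmdist.
  exact: filterS.
rewrite ltr_distl; have := flip x y; have := flip y x; rewrite (metric_sym y x); lra.
Unshelve. all: by end_near. Qed.

Lemma open_cozero (G : set S) : open G ->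
  exists phi : S -> R, [/\ continuous phi, forall x, 0 <= phi x & G = [set x | 0 < phi x]].
Proof.
move=> oG; have [CG0|/set0P[z0 Gz0]] := eqVneq (~` G) set0.
  exists (fun=> 1); split=> //; first by move=> x; exact: cvg_cst.
  by rewrite -[G]setCK CG0 setC0; apply/seteqP; split=> x //= _; exact: ltr01.
(* phi x is the distance from x to the complement of G *)
pose dS x := [set mdist x y | y in ~` G].
pose phi x := inf (dS x).
have dS0 x : dS x !=set0 by exists (mdist x z0), z0.
have dSlb x : lbound (dS x) 0 by move=> _ [y _ <-]; exact: mdist_ge0.
have hi x : has_inf (dS x) by split=> //; exists 0.
have phi_ge0 x : 0 <= phi x by apply: lb_le_inf.
exists phi; split=> //.
  apply: lipschitz1_continuous => x y; rewrite -lerBlDr; apply: lb_le_inf => // _ [z Gz <-].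
  rewrite lerBlDr; apply: le_trans (ge_inf _ _) _; [by exists 0; exact: dSlb|by exists z|].
  by rewrite addrC; exact: metric_triangle.
apply/seteqP; split=> x /=.
  move=> Gx; have /nbhs_ballP[e /= e0] : nbhs x G by exact: open_nbhs_nbhs.
  rewrite ballEmdist => eG; apply: (lt_le_trans e0); apply: lb_le_inf => // _ [z Gz <-].
  by rewrite leNgt; apply/negP => /eG.
move=> phix; apply: contrapT => Gx; move: phix; apply/negP; rewrite -leNgt.
by apply: ge_inf; [exists 0; exact: dSlb | exists x => //; exact: mdistxx].
Qed.

(** One half of Dini's theorem: by compactness, a lower bound reached pointwise
    by an increasing sequence is reached uniformly. *)
Lemma dini_lower (f : nat -> S -> R) (h : S -> R) (e : R) :
  (forall n, continuous (f n)) -> continuous h ->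
  (forall n x, f n x <= f n.+1 x) ->
  (forall x, exists n, h x - e < f n x) -> exists n, forall x, h x - e < f n x.
Proof.
move=> fc hc fmono hf.
have fm x : {homo f^~ x : m n / (m <= n)%N >-> m <= n}.
  by apply/nondecreasing_seqP => n; exact: fmono.
have cov := (compact_near_coveringP [set: S]).1 compactS nat \oo
  (fun n x => h x - e < f n x) _.
have [|N _ HN] := cov; last by exists N => x; apply: (HN N) => //=.
move=> x _; have [n0 n0x] := hf x.
have near0 : \forall x' \near x, h x' - e < f n0 x'.
  have c : continuous (fun x' => f n0 x' - (h x' - e)).
    by move=> y; apply: cvgB; [exact: fc|apply: cvgB; [exact: hc|exact: cvg_cst]].
  have n0x' : 0 < f n0 x - (h x - e) by rewrite subr_gt0.
  by apply: filterS (cvgr_gt _ (c x) _ n0x') => y; rewrite subr_gt0.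
exists ([set x' | h x' - e < f n0 x'], [set n | (n0 <= n)%N]); first by split=> //=; exists n0.
by move=> [x' n] /= [lt le]; apply: lt_le_trans lt _; exact: fm.
Qed.

Implicit Types (f g h : S -> R) (a : R).
Variable L : (S -> R) -> R.
Hypothesis L_lin : forall a f g, continuous f -> continuous g ->
  L (fun x => a * f x + g x) = a * L f + L g.
Hypothesis L_pos : forall f, continuous f -> (forall x, 0 <= f x) -> 0 <= L f.
Hypothesis L_1 : L (fun=> 1) <= 1.

Let cstc (c : R) : continuous (fun _ : S => c).
Proof. by move=> x; exact: cvg_cst. Qed.

Let L0 : L (fun=> 0) = 0.
Proof.
have := L_lin 1 (@cstc 0) (@cstc 0).
rewrite (_ : (fun x => _) = fun=> 0); last by apply/funext => x; rewrite mulr0 addr0.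
by rewrite mul1r -[X in X = _]addr0 => /addrI <-.
Qed.

Let LD f g : continuous f -> continuous g -> L (fun x => f x + g x) = L f + L g.
Proof.
by move=> cf cg; rewrite -[L f]mul1r -L_lin//; under [in RHS]eq_fun do rewrite mul1r.
Qed.

Let LZ a f : continuous f -> L (fun x => a * f x) = a * L f.
Proof.
by move=> cf; rewrite -[RHS]addr0 -L0 -L_lin//; under [in RHS]eq_fun do rewrite addr0.
Qed.

Let le_L f g : continuous f -> continuous g -> (forall x, f x <= g x) -> L f <= L g.
Proof.
move=> cf cg fg; rewrite -subr_ge0 addrC -mulN1r -L_lin//; apply: L_pos => [|x].
  by move=> x; apply: cvgD; [apply: cvgM; [exact: cvg_cst|exact: cf]|exact: cg].
by rewrite mulN1r addrC subr_ge0.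
Qed.

Let cD f g : continuous f -> continuous g -> continuous (fun x : S => f x + g x : R).
Proof. by move=> cf cg x; apply: cvgD; [exact: cf|exact: cg]. Qed.

Let cM f g : continuous f -> continuous g -> continuous (fun x : S => f x * g x : R).
Proof. by move=> cf cg x; apply: cvgM; [exact: cf|exact: cg]. Qed.

Let c_sum n (f : nat -> S -> R) : (forall k, continuous (f k)) ->
  continuous (fun x => \sum_(k < n) f k x).
Proof.
move=> fc; elim: n => [|n IH].
  by under eq_fun do rewrite big_ord0; exact: cstc.
by under eq_fun do rewrite big_ord_recr; exact: cD.
Qed.

Let L_sum n (f : nat -> S -> R) : (forall k, continuous (f k)) ->
  L (fun x => \sum_(k < n) f k x) = \sum_(k < n) L (f k).
Proof.
move=> fc; elim: n => [|n IH].
  by under eq_fun do rewrite big_ord0; rewrite big_ord0.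
under eq_fun do rewrite big_ord_recr; rewrite big_ord_recr /= -IH LD //.
exact: c_sum.
Qed.

(** Increasing sequences of continuous functions whose supremum is at least 1
    on E. Covering by sequences instead of single functions makes the infimum
    of their values countably subadditive with no regularity argument. *)
Definition rising_cover (E : set S) (f : nat -> S -> R) :=
  [/\ forall n, continuous (f n), forall n x, 0 <= f n x,
      forall n x, f n x <= f n.+1 x &
      forall x, E x -> forall e, 0 < e -> exists n, 1 - e < f n x].

Definition rising_value (f : nat -> S -> R) : \bar R :=
  ereal_sup (range (fun n => (L (f n))%:E)).

Definition riesz_outer (E : set S) : \bar R :=
  ereal_inf [set rising_value f | f in rising_cover E].

Local Open Scope ereal_scope.

Let rising_value_ub (f : nat -> S -> R) n : (L (f n))%:E <= rising_value f.
Proof. by apply: ereal_sup_ubound; exists n. Qed.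

Let outer_le E (f : nat -> S -> R) : rising_cover E f -> riesz_outer E <= rising_value f.
Proof. by move=> fE; apply: ereal_inf_lbound; exists f. Qed.

Let outer_ge0 E : 0 <= riesz_outer E.
Proof.
apply: le_ereal_inf_tmp => _ [f [fc f0 _ _] <-].
by apply: le_trans (rising_value_ub f 0%N); rewrite lee_fin; exact: L_pos.
Qed.

Let le_outer : {homo riesz_outer : A B / A `<=` B >-> A <= B}.
Proof.
move=> A B AB; apply: ereal_inf_le_tmp => _ [f [fc f0 fm fB] <-]; exists f => //.
by split=> // x /AB; exact: fB.
Qed.

Let outer_le1 E : riesz_outer E <= (L (fun=> 1%R))%:E.
Proof.
apply: le_trans (outer_le (f := fun _ _ => 1%R) _) _.
  by split=> //= x _ e e0; exists 0%N; rewrite ltrBlDr ltrDl.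
by apply: ge_ereal_sup => _ [n _ <-].
Qed.

Let outer_fin E : riesz_outer E \is a fin_num.
Proof.
rewrite ge0_fin_numE; last exact: outer_ge0.
by apply: le_lt_trans (outer_le1 E) _; rewrite ltry.
Qed.

Let outer0 : riesz_outer set0 = 0.
Proof.
apply/eqP; rewrite eq_le outer_ge0 andbT.
apply: le_trans (outer_le (f := fun _ _ => 0%R) _) _; first by split.
by apply: ge_ereal_sup => _ [n _ <-]; rewrite L0.
Qed.

Let outer_adherent E (e : R) : (0 < e)%R ->
  exists2 f : nat -> S -> R, rising_cover E f & rising_value f <= riesz_outer E + e%:E.
Proof.
move=> e0; have := lb_ereal_inf_adherent e0 (outer_fin E).
by move=> [_ [f fE <-]] /ltW; exists f.
Qed.

Let outer_subadditive : sigma_subadditive riesz_outer.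
Proof.
move=> A; apply/lee_addgt0Pr => e e0.
apply: le_trans (epsilon_trick _ _ (ltW e0)); last by move=> n; exact: outer_ge0.
have /choice[G HG] n : exists f : nat -> S -> R, rising_cover (A n) f /\
    rising_value f <= riesz_outer (A n) + (e / (2 ^ n.+1)%:R)%:E.
  have [|f fA fv] := @outer_adherent (A n) (e / (2 ^ n.+1)%:R).
    by rewrite divr_gt0 // ltr0n expn_gt0.
  by exists f.
have Gc k n : continuous (G k n) by have [[]] := HG k.
have G0 k n x : (0 <= G k n x)%R by have [[]] := HG k.
have Gm k n x : (G k n x <= G k n.+1 x)%R by have [[]] := HG k.
(* Diagonal sums of the covers of the A n cover the union. *)
pose g m x := (\sum_(k < m.+1) G k m x)%R.
have gA : rising_cover (\bigcup_n A n) g.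
  split=> [n|n x|n x|x [k _ Akx] d d0].
  - exact: (@c_sum n.+1 (fun k => G k n) (fun k => Gc k n)).
  - by apply: sumr_ge0.
  - rewrite /g [leRHS]big_ord_recr /= -[leLHS]addr0 lerD //.
    by apply: ler_sum => k _; exact: Gm.
  - have [[_ _ _ /(_ x Akx d d0)[n nx]] _] := HG k.
    have Ghomo : {homo (fun n => G k n x) : m n / (m <= n)%N >-> (m <= n)%R}.
      by apply/nondecreasing_seqP => i; exact: Gm.
    exists (maxn k n); apply: lt_le_trans nx _.
    have kM : (k < (maxn k n).+1)%N by rewrite ltnS leq_maxl.
    rewrite /g (bigD1 (Ordinal kM)) //= -[leLHS]addr0 lerD ?sumr_ge0 //.
    by apply: Ghomo; exact: leq_maxr.
apply: le_trans (outer_le gA) _; apply: ge_ereal_sup => _ [m _ <-].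
rewrite /g (@L_sum m.+1 (fun k => G k m)) // -sumEFin.
apply: le_trans (nneseries_lim_ge m.+1 _); last first.
  move=> n _ _; rewrite adde_ge0 // ?outer_ge0 // lee_fin divr_ge0 // ltW //.
rewrite big_mkord; apply: lee_sum => k _.
by apply: le_trans (HG k).2; exact: rising_value_ub.
Qed.

HB.instance Definition _ := isOuterMeasure.Build R S riesz_outer
  outer0 outer_ge0 le_outer outer_subadditive.

(** Caratheodory's inequality for {phi > 0}: if f rises to 1 on E, then f
    min(1, n phi) rises to 1 on the part of E in the set, and f (1 - min(1, n
    phi)) on the part outside; the two functions add up to f. *)
Let outer_cozero (phi : S -> R) : continuous phi -> (forall x, (0 <= phi x)%R) ->
  caratheodory_measurable riesz_outer [set x | (0 < phi x)%R].
Proof.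
move=> phic phi0; apply: le_caratheodory_measurable => E.
set A := [set x | _].
apply: le_ereal_inf_tmp => _ [f [fc f0 fm fE] <-].
have [->|fin] := eqVneq (rising_value f) +oo; first exact: leey.
pose ph n x := Num.min 1%R (n%:R * phi x)%R.
have phc n : continuous (ph n).
  apply: min_fun_continuous; first exact: cstc.
  by apply: cM => //; exact: cstc.
have ph0 n x : (0 <= ph n x)%R by rewrite le_min ler01 mulr_ge0.
have ph1 n x : (ph n x <= 1)%R by rewrite ge_min lexx.
have phm n x : (ph n x <= ph n.+1 x)%R.
  by rewrite le_min ge_min lexx /= ge_min ler_wpM2r ?orbT // ler_nat.
pose gA n x := (f n x * ph n x)%R.
pose gC k n x := (f n x * (1 - ph k x))%R.
have c1 k : continuous (fun x => 1 - ph k x)%R.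
  by move=> x; apply: cvgB; [exact: cvg_cst|exact: phc].
have gAc n : continuous (gA n) by apply: cM.
have gCc k n : continuous (gC k n) by apply: cM.
have fhomo x : {homo (fun n => f n x) : m n / (m <= n)%N >-> (m <= n)%R}.
  by apply/nondecreasing_seqP => n; exact: fm.
have phhomo x : {homo (fun n => ph n x) : m n / (m <= n)%N >-> (m <= n)%R}.
  by apply/nondecreasing_seqP => n; exact: phm.
have gAE : rising_cover (E `&` A) gA.
  split=> // [n x|n x|x [Ex Ax] e e0].
  - by rewrite mulr_ge0.
  - by rewrite ler_pM.
  - have [n nx] := fE x Ex e e0.
    pose m := maxn n (Num.bound (phi x)^-1).
    exists m; rewrite /gA; have -> : ph m x = 1%R.
      apply/eqP; rewrite eq_le ph1 /= le_min lexx /= -ler_pdivrMr // div1r.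
      apply: (le_trans (ltW (archi_boundP _))); first by rewrite invr_ge0.
      by rewrite ler_nat leq_maxr.
    by rewrite mulr1; apply: lt_le_trans nx _; apply: fhomo; exact: leq_maxl.
have gCE k : rising_cover (E `&` ~` A) (gC k).
  split=> // [n x|n x|x [Ex Ax] e e0].
  - by rewrite mulr_ge0 // subr_ge0.
  - by rewrite ler_wpM2r // subr_ge0.
  - have [n nx] := fE x Ex e e0; exists n; rewrite /gC.
    have -> : ph k x = 0%R.
      have -> : ph k x = Num.min 1%R (k%:R * phi x)%R by [].
      have -> : phi x = 0%R.
        by apply/eqP; rewrite eq_le phi0 andbT leNgt; apply/negP.
      by rewrite mulr0 min_r.
    by rewrite subr0 mulr1.
apply: le_trans (leeD (outer_le gAE) (lexx _)) _.
rewrite -leeBrDr ?outer_fin //; apply: ge_ereal_sup => _ [n _ <-].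
rewrite leeBrDr ?outer_fin // addeC -leeBrDr //.
apply: le_trans (outer_le (gCE n)) _; apply: ge_ereal_sup => _ [m _ <-].
rewrite leeBrDr // -EFinD.
apply: le_trans (rising_value_ub f (maxn n m)); rewrite lee_fin.
have -> : L (f (maxn n m)) =
    (L (fun x => f (maxn n m) x * (1 - ph n x)) + L (fun x => f (maxn n m) x * ph n x))%R.
  rewrite -LD; [|exact: cM|exact: cM].
  by congr L; apply/funext => x; rewrite -mulrDr subrK mulr1.
apply: lerD; (apply: le_L; [exact: cM|exact: cM|]) => x; rewrite ler_wpM2r ?subr_ge0 //.
  by apply: fhomo; exact: leq_maxr.
by apply: fhomo; exact: leq_maxl.
Qed.

(** Every open set is {phi > 0} for some continuous phi >= 0. *)
Let borel_caratheodory (A : set (borel S)) : measurable A ->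
  caratheodory_measurable riesz_outer A.
Proof.
suff : <<s @open S >> `<=` @measurable _ (caratheodory_type riesz_outer) by exact.
apply: smallest_sub; first exact: sigma_algebra_measurable.
by move=> G /open_cozero[phi [phic phi0 ->]]; exact: outer_cozero.
Qed.

Definition riesz_measure : set (borel S) -> \bar R := riesz_outer.

Let riesz_additive : semi_sigma_additive riesz_measure.
Proof.
move=> F mF tF mUF.
apply: (@caratheodory_measure_sigma_additive _ _ riesz_outer) => // [n|].
  exact/borel_caratheodory.
exact/borel_caratheodory.
Qed.

HB.instance Definition _ := isMeasure.Build _ (borel S) R riesz_measure
  outer0 outer_ge0 riesz_additive.

Let riesz_le1 : riesz_measure setT <= 1.
Proof. by apply: le_trans (outer_le1 _) _; rewrite lee_fin. Qed.

HB.instance Definition _ := Measure_isSubProbability.Build _ (borel S) R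
  riesz_measure riesz_le1.

Local Close Scope ereal_scope.
Local Notation nu := (riesz_measure : subprobability (borel S) R).

Let nu_fin (A : set (borel S)) : (nu A < +oo)%E.
Proof. by rewrite -ge0_fin_numE ?outer_fin// outer_ge0. Qed.

Let cb f : continuous f -> bmeas [set: borel S] f.
Proof.
move=> cf; apply: (within_continuous_bmeas (A := [set: S])) => //.
exact: continuous_subspaceT.
Qed.

Let measure_le_int (A : set (borel S)) f : measurable A -> continuous f ->
  (forall x, 0 <= f x) -> (forall x, A x -> 1 <= f x) ->
  fine (nu A) <= \int[nu]_x f x.
Proof.
move=> mA cf f0 f1.
have -> : fine (nu A) = \int[nu]_x (\1_A x).
  by rewrite /Rintegral integral_indic // setIT.
apply: le_bint => //; [exact: nu_fin| |exact: cb|].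
  split; first exact: measurable_indic.
  by exists 1 => x _; rewrite indicE ger0_norm // lern1 leq_b1.
move=> x _; rewrite indicE; case: (boolP (x \in A)) => [/set_mem /f1 //|_].
exact: f0.
Qed.

(** Up to e, a function below the indicator of A is below a member of any given
    rising cover of A, uniformly by Dini. *)
Let L_le_measure (A : set (borel S)) f : continuous f ->
  (forall x, f x <= 1) -> (forall x, ~ A x -> f x <= 0) ->
  L f <= fine (nu A).
Proof.
move=> cf f1 fA; rewrite -lee_fin fineK; last exact: outer_fin.
change ((L f)%:E <= riesz_outer A)%E; apply: le_ereal_inf_tmp => _ [g [gc g0 gm gA] <-].
apply/lee_addgt0Pr => e e0.
have [|N HN] := dini_lower gc cf gm (e := e).
  move=> x; have [Ax|nAx] := pselect (A x).
    by have [n nx] := gA x Ax e e0; exists n; apply: le_lt_trans nx; rewrite lerD2r.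
  by exists 0%N; apply: lt_le_trans (g0 0%N x); have := fA x nAx; lra.
apply: (@le_trans _ _ ((L (g N))%:E + e%:E)%E); last by rewrite leeD2r.
rewrite -EFinD lee_fin; apply: (@le_trans _ _ (L (fun x => g N x + e))).
  apply: le_L => //; first by apply: cD => //; exact: cstc.
  by move=> x; have := HN x; lra.
rewrite LD // lerD2l; have := LZ e (@cstc 1); under [in L _]eq_fun do rewrite mulr1.
by move=> ->; rewrite ler_piMr // ltW.
Qed.

(** f is the sum of its slices fi i between the levels i/m and (i+1)/m. The
    functional is at most 1/m times the measure of {f > i/m} on such a slice,
    the integral is at least 1/m times the measure of {f > (i+1)/m}; the shift
    by one level costs at most 1/m in total. *)
Let int_ge f : continuous f -> (forall x, 0 <= f x <= 1) -> L f <= \int[nu]_x f x.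
Proof.
move=> cf f01.
have nu0 : 0 <= fine (nu setT) by rewrite fine_ge0 // outer_ge0.
suff H n : L f <= n.+1%:R^-1 * fine (nu setT) + \int[nu]_x f x.
  apply/ler_addgt0Pr => e e0; have [n hn] : exists n, n.+1%:R^-1 * fine (nu setT) <= e.
    exists (Num.bound (fine (nu setT) / e)); rewrite mulrC ler_pdivrMr // mulrC.
    rewrite -ler_pdivrMr //; apply: le_trans (ltW (archi_boundP _)) _.
      by rewrite divr_ge0 // ltW.
    by rewrite ler_nat.
  by apply: le_trans (H n) _; rewrite addrC lerD2l.
pose m := n.+1; have m0 : 0 < m%:R :> R by rewrite ltr0n.
have m1 : 0 < m%:R^-1 :> R by rewrite invr_gt0.
pose g i x := Num.min (f x) (i%:R / m%:R).
pose fi i x := g i.+1 x - g i x.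
have gc i : continuous (g i) by apply: min_fun_continuous => //; exact: cstc.
have fic i : continuous (fi i).
  by move=> x; apply: cvgB; exact: gc.
have fE x : f x = \sum_(i < m) fi i x.
  rewrite -(big_mkord xpredT (fun i => fi i x)) telescope_sumr // /g mul0r divff ?gt_eqF //.
  by have /andP[f0 f1] := f01 x; rewrite min_l // min_r // subr0.
have fi_ge0 i x : 0 <= fi i x.
  rewrite subr_ge0 /g le_min ge_min lexx /= ge_min ler_pM2r ?invr_gt0 // ler_nat leqnSn.
  by rewrite orbT.
have fi_le i x : m%:R * fi i x <= 1.
  rewrite -ler_pdivlMl // mulr1 /fi /g -natr1 mulrDl mul1r.
  by rewrite /Num.min; do 2 (case: ifPn; rewrite -?leNgt => ?); lra.
have fi_1 i x : i.+1%:R / m%:R < f x -> 1 <= m%:R * fi i x.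
  rewrite -ler_pdivrMl // mulr1 /fi /g -natr1 mulrDl mul1r => h.
  by rewrite /Num.min; do 2 (case: ifPn; rewrite -?leNgt => ?); lra.
have fi_0 i x : f x <= i%:R / m%:R -> m%:R * fi i x <= 0.
  move=> h; rewrite pmulr_rle0 // /fi /g subr_le0 (min_l h) ge_min lexx //.
pose A i : set (borel S) := [set x | i%:R / m%:R < f x].
have mA i : measurable (A i).
  apply: borel_open; rewrite -/(open (A i)).
  by apply: (@open_comp _ _ f [set y | i%:R / m%:R < y]) => //.
have LfA i : m%:R * L (fi i) <= fine (nu (A i)).
  rewrite -LZ //; apply: L_le_measure => //.
    by apply: cM => //; exact: cstc.
  by move=> x /negP; rewrite -leNgt; exact: fi_0.
have Aint i : fine (nu (A i.+1)) <= m%:R * \int[nu]_x fi i x.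
  rewrite -bintZ //; [|exact: nu_fin|exact: cb].
  apply: measure_le_int => //.
  - by apply: cM => //; exact: cstc.
  - by move=> x; rewrite mulr_ge0.
  - by move=> x; exact: fi_1.
have Lfi i : L (fi i.+1) <= \int[nu]_x fi i x.
  by rewrite -(ler_pM2l m0); exact: le_trans (LfA _) (Aint _).
have -> : L f = \sum_(i < m) L (fi i).
  by rewrite -L_sum //; congr L; apply/funext.
have -> : \int[nu]_x f x = \sum_(i < m) \int[nu]_x fi i x.
  rewrite -(bint_sum (mu := nu) measurableT (nu_fin _) (index_enum 'I_m) xpredT
    (F := fun (i : 'I_m) (x : borel S) => fi i x)); last by move=> i; exact: cb.
  by apply: eq_Rintegral => x _.
rewrite big_ord_recl big_ord_recr /= lerD //.
  rewrite -(ler_pM2l m0) mulVKf ?gt_eqF //; apply: le_trans (LfA _) _.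
  by rewrite fine_le ?outer_fin // le_outer.
rewrite -[leLHS]addr0 lerD //; first by apply: ler_sum => i _; exact: Lfi.
by apply: Rintegral_ge0.
Qed.

(** By int_ge for f and for 1 - f, the functional and the integral agree if 0
    <= f <= 1; an affine change of f gives the general case. *)
Lemma riesz_subprobability : exists P : Psub R S,
  forall f, continuous f -> \int[P : subprobability (borel S) R]_x f x = L f.
Proof.
exists (riesz_measure : subprobability (borel S) R) => f cf.
have eq01 h : continuous h -> (forall x, 0 <= h x <= 1) -> \int[nu]_x h x = L h.
  move=> ch h01; apply/eqP; rewrite eq_le int_ge // andbT.
  have c1h : continuous (fun x => 1 - h x).
    by move=> x; apply: cvgB; [exact: cvg_cst|exact: ch].
  have /int_ge : forall x, 0 <= 1 - h x <= 1 by move=> x; have := h01 x; lra.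
  move=> /(_ c1h); rewrite bintB //; [|exact: nu_fin|exact: cb|exact: cb].
  rewrite Rintegral_cst // mul1r.
  have -> : (fun x => 1 - h x) = (fun x => (-1) * h x + 1).
    by apply/funext => x; rewrite mulN1r addrC.
  rewrite L_lin //.
  have : fine (nu setT) <= L (fun=> 1) by rewrite -lee_fin fineK ?outer_fin ?outer_le1.
  lra.
have [_ [M0 fM0]] := cb cf; pose M := `|M0| + 1.
have M1 : 0 < M by rewrite ltr_wpDl.
have fM x : `|f x| <= M.
  by apply: le_trans (fM0 x I) _; rewrite (le_trans (ler_norm _)) // lerDl.
pose h x := (f x + M) / (2 * M).
have ch : continuous h.
  by apply: cM; [apply: cD => //; exact: cstc|exact: cstc].
have h01 x : 0 <= h x <= 1.
  have := fM x; rewrite ler_norml => /andP[? ?].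
  by rewrite /h divr_ge0 ?ler_pdivrMr ?mulr_gt0 //; lra.
have fE : f = (fun x => (2 * M) * h x + - M).
  by apply/funext => x; rewrite /h mulrC divfK ?addrK // mulf_neq0 ?gt_eqF.
have c1 : L (fun=> -M) = - M * L (fun=> 1).
  by rewrite -LZ //; under [in RHS]eq_fun do rewrite mulr1.
rewrite [in RHS]fE L_lin //.
rewrite -(eq01 _ ch h01) c1 -(eq01 _ (@cstc 1)); last by move=> x; rewrite ler01 lexx.
rewrite {1}fE bintD //; [|exact: nu_fin|apply: cb; apply: cM => //; exact: cstc|exact: cb].
rewrite bintZ //; [|exact: nu_fin|exact: cb].
by rewrite !Rintegral_cst // mul1r.
Qed.
End Riesz.

(** * Weak convergence along an ultrafilter *)

(* The projections of a product topology are indexed by a type with an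
   equality. *)
HB.instance Definition _ (R : realType) (E : ptopologicalType) := gen_eqMixin (Cb R E).

Section WeakTopology.
Context {R : realType} {E : ptopologicalType}.

(** The weak topology is initial for the map into a product, where convergence
    is tested on each factor. *)
Lemma weak_sub_cvgP {I : Type} {F : set_system I} {FF : Filter F}
    (nu : I -> Psub R E) (l : Psub R E) :
  (forall f : Cb R E, (fun i => weak_sub (nu i) f) @ F --> weak_sub l f) ->
  nu @ F --> l.
Proof.
move=> H B [_ [[A oA <-] Al AB]].
have : (fun i => weak_sub (nu i)) @ F --> (weak_sub l : {ptws Cb R E -> R}).
  apply/cvg_sup => f C /= [_ [[V Voop <-] Vl VC]].
  have : nbhs (weak_sub l f) V by exact: open_nbhs_nbhs.
  by move=> /(H f) HV; apply: (@filterS _ F FF _ _ _ HV) => i Vi; exact: VC.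
have : nbhs (weak_sub l : {ptws Cb R E -> R}) A by exact: open_nbhs_nbhs.
by move=> /[swap] /[apply] HA; apply: (@filterS _ F FF _ _ _ HA) => i Ai; exact: AB.
Qed.

Lemma weak_sub_continuous (f : Cb R E) : continuous (fun nu : Psub R E => weak_sub nu f).
Proof.
move=> nu; apply: (@cvg_comp _ _ _ (@weak_sub R E) (fun g : {ptws Cb R E -> R} => g f)).
  exact: (@initial_continuous _ _ (@weak_sub R E)).
exact: (@proj_continuous _ (fun _ : Cb R E => R)).
Qed.

Lemma weak_prob_continuous (f : Cb R E) : continuous (fun nu : Prob R E => weak_prob nu f).
Proof.
move=> nu; apply: (@cvg_comp _ _ _ (@weak_prob R E) (fun g : {ptws Cb R E -> R} => g f)).
  exact: (@initial_continuous _ _ (@weak_prob R E)).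
exact: (@proj_continuous _ (fun _ : Cb R E => R)).
Qed.
End WeakTopology.

Section UniformLimits.
Context {U : set_system nat} {UU : UltraFilter U} {R : realType} {X : Type}.
Implicit Types (D : set X) (h k : nat -> X -> R) (g l : X -> R).

Definition ucvg D h g :=
  forall e : R, 0 < e -> \forall n \near U, forall x, D x -> `|h n x - g x| <= e.

Definition bounded_on D g := exists2 M : R, 0 < M & forall x, D x -> `|g x| <= M.

Lemma bounded_onP D g : (exists M : R, forall x, D x -> `|g x| <= M) -> bounded_on D g.
Proof.
move=> [M gM]; exists (`|M| + 1); first by rewrite ltr_wpDl.
by move=> x /gM /le_trans; apply; rewrite (le_trans (ler_norm _)) // lerDl.
Qed.

Lemma ucvg_cvg D h g x : D x -> ucvg D h g -> (fun n => h n x) @ U --> g x.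
Proof.
move=> Dx hg; apply/cvgrPdist_le => e e0.
by apply: filterS (hg e e0) => n /(_ x Dx); rewrite distrC.
Qed.

Lemma ucvg_same D g : ucvg D (fun=> g) g.
Proof. by move=> e e0; apply: filterE => n x _; rewrite subrr normr0 ltW. Qed.

Lemma ucvg_cst D (a : nat -> R) (b : R) : a @ U --> b ->
  ucvg D (fun n _ => a n) (fun=> b).
Proof.
by move=> /cvgrPdist_le ab e e0; apply: filterS (ab e e0) => n ? x _; rewrite distrC.
Qed.

Lemma ucvgD D h g k l : ucvg D h g -> ucvg D k l ->
  ucvg D (fun n x => h n x + k n x) (fun x => g x + l x).
Proof.
move=> hg kl e e0; have e2 : 0 < e / 2 by rewrite divr_gt0.
apply: filterS2 (hg _ e2) (kl _ e2) => n H1 H2 x Dx.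
rewrite opprD addrACA (le_trans (ler_normD _ _)) // [e]splitr.
by rewrite lerD ?H1 ?H2.
Qed.

Lemma ucvgM D h g k l : bounded_on D g -> bounded_on D l ->
  ucvg D h g -> ucvg D k l ->
  ucvg D (fun n x => h n x * k n x) (fun x => g x * l x).
Proof.
move=> [M M0 gM] [M' M'0 lM] hg kl e e0.
pose d := Num.min 1 (e / (M + M' + 1)).
have d0 : 0 < d by rewrite lt_min ltr01 divr_gt0 // !addr_gt0.
apply: filterS2 (hg _ d0) (kl _ d0) => n H1 H2 x Dx.
have -> : h n x * k n x - g x * l x =
   (h n x - g x) * (k n x - l x) + (h n x - g x) * l x + g x * (k n x - l x) by ring.
have {}H1 := H1 x Dx; have {}H2 := H2 x Dx.
have d1 : d <= 1 by rewrite ge_min lexx.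
have de : d * (M + M' + 1) <= e.
  by rewrite -ler_pdivlMr ?addr_gt0 // ge_min lexx orbT.
apply: le_trans de; rewrite [leRHS](_ : _ = d * 1 + d * M' + M * d); last by ring.
rewrite (le_trans (ler_normD _ _)) // lerD //.
  by rewrite (le_trans (ler_normD _ _)) // !normrM lerD // ler_pM // ?lM // (le_trans H2).
by rewrite normrM ler_pM ?gM.
Qed.

Lemma ucvg_sum D (I : finType) (H : I -> nat -> X -> R) (G : I -> X -> R) :
  (forall i, ucvg D (H i) (G i)) ->
  ucvg D (fun n x => \sum_i H i n x) (fun x => \sum_i G i x).
Proof.
move=> HG; elim: (index_enum I) => [|i r IH].
  by move=> e e0; apply: filterE => n x _; rewrite !big_nil subrr normr0 ltW.
move=> e e0; apply: filterS (ucvgD (HG i) IH e0) => n Hn x Dx.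
by rewrite !big_cons; exact: Hn.
Qed.

Lemma ucvg_max D h g k l : ucvg D h g -> ucvg D k l ->
  ucvg D (fun n x => Num.max (h n x) (k n x)) (fun x => Num.max (g x) (l x)).
Proof.
move=> hg kl e e0; apply: filterS2 (hg _ e0) (kl _ e0) => n H1 H2 x Dx.
have := H1 x Dx; have := H2 x Dx; rewrite !ler_norml => /andP[? ?] /andP[? ?].
by rewrite /Num.max; do 2 (case: ifPn; rewrite -?leNgt => ?); lra.
Qed.

Lemma ucvg_exp D h g : bounded_on D g -> ucvg D h g ->
  ucvg D (fun n x => expR (h n x)) (fun x => expR (g x)).
Proof.
move=> [M M0 gM] hg e e0.
have eM : 0 < e / expR M by rewrite divr_gt0 // expR_gt0.
have /cvgrPdist_le/(_ _ eM)[d /= d0 Hd] := @continuous_expR R 0.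
have d2 : 0 < d / 2 by rewrite divr_gt0.
apply: filterS (hg _ d2) => n H x Dx.
have -> : expR (h n x) - expR (g x) = expR (g x) * (expR (h n x - g x) - 1).
  by rewrite mulrBr -expRD [g x + _]addrC subrK mulr1.
have := Hd (h n x - g x); rewrite /ball_ /= sub0r normrN expR0 distrC => {}Hd.
rewrite normrM -ler_pdivlMl ?normr_gt0 ?gt_eqF ?expR_gt0 //.
rewrite distrC; apply: le_trans (Hd _) _.
  by rewrite distrC; apply: le_lt_trans (H x Dx) _; lra.
rewrite mulrC ler_pM2r // ?lef_pV2 ?posrE ?normr_gt0 ?gt_eqF ?expR_gt0 //.
by rewrite ger0_norm ?expR_ge0 // ler_expR (le_trans (ler_norm _)) // gM.
Qed.

End UniformLimits.

Section Tube.
Context {U : set_system nat} {UU : UltraFilter U} {R : realType}.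

(** Tube lemma: the neighbourhoods of l provided by the continuity of H at the
    points (x, l) can be taken uniform in x, as D is compact. *)
Lemma ucvg_tube {X Y : topologicalType} (D : set X) (H : X * Y -> R)
    (y : nat -> Y) (l : Y) :
  compact D -> {within D `*` [set: Y], continuous H} -> y @ U --> l ->
  ucvg (U := U) D (fun n x => H (x, y n)) (fun x => H (x, l)).
Proof.
move=> cD /subspace_continuousP cH yl e e0.
have e2 : 0 < e / 2 by rewrite divr_gt0.
pose P n x := D x -> `|H (x, y n) - H (x, l)| <= e.
suff /((compact_near_coveringP D).1 cD nat U P _) :
    forall x, D x -> \forall x' \near x & n \near U, P n x'.
  by apply: filterS => n HD x Dx; exact: HD.
move=> x Dx.
have : \forall p \near (x, l), (D `*` setT) p -> `|H (x, l) - H p| <= e / 2.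
  by have /cvgrPdist_le/(_ _ e2) := cH (x, l) (conj Dx I).
move=> [[/= B C] [Bx Cl] BC].
have Cy := yl _ Cl.
exists (B, [set n | C (y n)]) => // -[x' n] /= [Bx' Cyn] Dx'.
have h1 := BC (x', y n) (conj Bx' Cyn) (conj Dx' I).
have h2 := BC (x', l) (conj Bx' (nbhs_singleton Cl)) (conj Dx' I).
rewrite -(subrKA (H (x, l))) [e]splitr (le_trans (ler_normD _ _)) // lerD //.
by rewrite distrC.
Qed.
End Tube.

Section WeakCompactness.
Context {R : realType} {S : pmetricType R}.
Hypothesis compactS : compact [set: S].
Implicit Types (f g : S -> R) (nu : Psub R S).

Lemma compact_bmeas f : continuous f -> bmeas [set: borel S] f.
Proof.
move=> cf; apply: (within_continuous_bmeas (A := [set: S])) => //.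
exact: continuous_subspaceT.
Qed.

Lemma compact_bounded_on f : continuous f -> bounded_on [set: S] f.
Proof. by move=> /compact_bmeas[_ ?]; exact: bounded_onP. Qed.

Lemma compact_Cb f : continuous f -> exists F : Cb R S, sval F = f.
Proof.
move=> cf; have [_ [M fM]] := compact_bmeas cf.
suff bf : bounded_fun f by exists (exist _ f (conj cf bf)).
exists M; split; first exact: num_real.
by move=> y My x _; apply: le_trans (fM x I) (ltW My).
Qed.

Lemma subprobability_fin {d} {X : measurableType d} (nu : subprobability X R) :
  (nu setT < +oo)%E.
Proof. by apply: le_lt_trans (sprobability_setT) _; rewrite ltry. Qed.

Lemma subprob_fine_le1 {d} {X : measurableType d} (nu : subprobability X R) :
  fine (nu setT) <= 1.
Proof. by rewrite -lee_fin fineK ?sprobability_setT // ge0_fin_numE // subprobability_fin. Qed.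

Lemma Rintegral_continuous f : continuous f ->
  continuous (fun nu : Psub R S => \int[nu : subprobability (borel S) R]_x f x).
Proof. by move=> /compact_Cb[F <-]; exact: weak_sub_continuous. Qed.

Lemma Rintegral_prob_continuous f : continuous f ->
  continuous (fun nu : Prob R S => \int[nu : probability (borel S) R]_x f x).
Proof. by move=> /compact_Cb[F <-]; exact: weak_prob_continuous. Qed.

Section Ultra.
Context {U : set_system nat} {UU : UltraFilter U}.

Lemma psub_cvg (nu : nat -> Psub R S) (l : Psub R S) :
  (forall f, continuous f -> (fun n => \int[nu n : subprobability (borel S) R]_x f x) @ U
     --> \int[l : subprobability (borel S) R]_x f x) -> nu @ U --> l.
Proof. by move=> H; apply: weak_sub_cvgP => -[f [cf bf]]; exact: H. Qed.

Lemma psub_cvgE (nu : nat -> Psub R S) (l : Psub R S) f : nu @ U --> l -> continuous f ->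
  (fun n => \int[nu n : subprobability (borel S) R]_x f x) @ U
     --> \int[l : subprobability (borel S) R]_x f x.
Proof.
move=> nul cf.
apply: (@cvg_comp _ _ _ nu (fun nu : Psub R S => \int[nu : subprobability (borel S) R]_x f x)).
  exact: nul.
exact: Rintegral_continuous.
Qed.

Lemma psub_ucvg (nu : nat -> Psub R S) (l : Psub R S) (h : nat -> S -> R) f :
  nu @ U --> l -> (forall n, continuous (h n)) -> continuous f ->
  ucvg (U := U) [set: S] h f ->
  (fun n => \int[nu n : subprobability (borel S) R]_x h n x) @ U
     --> \int[l : subprobability (borel S) R]_x f x.
Proof.
move=> nul hc fc hf; apply/cvgrPdist_le => e e0.
have e2 : 0 < e / 2 by rewrite divr_gt0.
have /cvgrPdist_le/(_ _ e2) H1 := psub_cvgE nul fc.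
apply: filterS2 H1 (hf _ e2) => n H1 H2.
rewrite -(subrKA (\int[nu n : subprobability (borel S) R]_x f x)) [e]splitr.
rewrite (le_trans (ler_normD _ _)) // lerD //.
have bh := compact_bmeas (hc n); have bf := compact_bmeas fc.
rewrite distrC -bintB //; last exact: subprobability_fin.
apply: le_trans (bint_bound _ _ _ _) _ => //; [exact: subprobability_fin|exact: bmeasB| |].
  by move=> x _; exact: H2.
by rewrite ler_piMr ?subprob_fine_le1 // ltW.
Qed.

(** The integrals converge along the ultrafilter because they are bounded, and
    their limit is a positive linear functional, that is, the integral for some
    subprobability. *)
Lemma psub_compact (nu : nat -> Psub R S) : exists l : Psub R S, nu @ U --> l.
Proof.
have cvgL f : continuous f -> exists x : R,
    (fun n => \int[nu n : subprobability (borel S) R]_x f x) @ U --> x.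
  move=> /[dup] cf /compact_bmeas bf; have [M M0 fM] := compact_bounded_on cf.
  have [|x _ xl] := ultra_bounded_cvg (U := U) (a := - M) (b := M)
      (s := fun n => \int[nu n : subprobability (borel S) R]_x f x); last by exists x.
  move=> n; rewrite -ler_norml.
  apply: le_trans (bint_bound _ (subprobability_fin _) bf fM) _ => //.
  by rewrite ler_piMr ?subprob_fine_le1 // ltW.
have /choice[L LP] : forall f, exists x : R, continuous f ->
    (fun n => \int[nu n : subprobability (borel S) R]_x f x) @ U --> x.
  move=> f; have [/cvgL[x xl]|ncf] := pselect (continuous f); first by exists x.
  by exists 0.
have uniq (s : nat -> R) (x y : R) : s @ U --> x -> s @ U --> y -> x = y.
  by move=> sx sy; rewrite -(cvg_lim (@Rhausdorff R) sx) -(cvg_lim (@Rhausdorff R) sy).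
have [|||l Hl] := riesz_subprobability compactS (L := L).
- move=> a f g cf cg; apply: uniq (LP _ _) _.
    move=> x; apply: cvgD; [apply: cvgM; [exact: cvg_cst|exact: cf]|exact: cg].
  have bf := compact_bmeas cf; have bg := compact_bmeas cg.
  have -> : (fun n => \int[nu n : subprobability (borel S) R]_x (a * f x + g x)) =
     (fun n => a * \int[nu n : subprobability (borel S) R]_x f x +
               \int[nu n : subprobability (borel S) R]_x g x).
    apply/funext => n; rewrite bintD ?bintZ //; do ?exact: subprobability_fin.
    exact: bmeasZ.
  by apply: cvgD; [apply: cvgM; [exact: cvg_cst|exact: LP]|exact: LP].
- move=> f cf f0; apply: (limit_le (cvg_cst 0) (LP f cf)).
  by apply: filterE => n; apply: Rintegral_ge0.
- have c1 : continuous (fun _ : S => 1 : R) by move=> x; exact: cvg_cst.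
  apply: (limit_le (LP _ c1) (cvg_cst (1 : R))).
  by apply: filterE => n; rewrite Rintegral_cst // mul1r subprob_fine_le1.
by exists l; apply: psub_cvg => f cf; rewrite Hl //; exact: LP.
Qed.
End Ultra.
End WeakCompactness.

(** * Lebesgue measure on row vectors *)

Section LebesgueMeasure.
Context {R : realType}.

(** An open set of row vectors is the union of countably many boxes with
    rational sides. *)
Lemma measurable_fun_rV {d} {X : measurableType d} (n : nat) (f : X -> 'rV[R]_n) :
  (forall j, measurable_fun [set: X] (fun x => f x ord0 j)) ->
  measurable_fun [set: X] (f : X -> borel 'rV[R]_n).
Proof.
move=> mf.
have: @measurable _ (borel 'rV[R]_n) = <<s @open 'rV[R]_n >> by [].
move=> /measurability; apply => _ [G oG <-]; rewrite setTI.
pose box (q : {ffun 'I_n -> rat * rat}) : set X :=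
  \bigcap_(j in [set: 'I_n])
    [set x | ratr (q j).1 < f x ord0 j /\ f x ord0 j < ratr (q j).2].
have mbox q : measurable (box q).
  apply: fin_bigcap_measurable => // j _.
  have -> : [set x | ratr (q j).1 < f x ord0 j /\ f x ord0 j < ratr (q j).2] =
     setT `&` (fun x => f x ord0 j) @^-1` `](ratr (q j).1 : R), (ratr (q j).2 : R)[.
    by apply/seteqP; split=> x; rewrite /= in_itv /=; [move=> [-> ->]|move=> [_ /andP[]]].
  by apply: mf => //; exact: measurable_itv.
pose F (i : nat) : set X := if @unpickle {ffun 'I_n -> rat * rat} i is Some q then
   (if `[< box q `<=` f @^-1` G >] then box q else set0) else set0.
have -> : f @^-1` G = \bigcup_i F i.
  apply/seteqP; split=> [x Gx|x [i _]]; last first.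
    by rewrite /F; case: unpickle => // q; case: ifPn => // /asboolP H /H.
  have : nbhs (f x) G by exact: open_nbhs_nbhs.
  move=> [P Pf PG].
  have /choice[q Hq] : forall j : 'I_n, exists q : rat * rat,
      [/\ ratr q.1 < f x ord0 j, f x ord0 j < ratr q.2 &
       forall y, ratr q.1 < y -> y < ratr q.2 -> P ord0 j y].
    move=> j; have /nbhs_ballP[e /= e0 eP] := Pf ord0 j.
    have [a] := @rat_in_itvoo R (f x ord0 j - e) (f x ord0 j) ltac:(by rewrite ltrBlDr ltrDl).
    have [b] := @rat_in_itvoo R (f x ord0 j) (f x ord0 j + e) ltac:(by rewrite ltrDl).
    rewrite !in_itv /= => /andP[? ?] /andP[? ?]; exists (a, b); split=> //= y ya yb.
    by apply: eP; rewrite /ball /= ltr_distlC; apply/andP; split; lra.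
  exists (pickle [ffun j => q j]) => //; rewrite /F pickleK ifT.
    by move=> j _ /=; rewrite ffunE; have [] := Hq j.
  apply/asboolP => y yb; apply: PG => i j; rewrite (ord1 i).
  by have := yb j Logic.I; rewrite /= ffunE => -[? ?]; have [_ _] := Hq j; apply.
apply: bigcupT_measurable => i; rewrite /F; case: unpickle => [q|] //.
by case: ifP => _.
Qed.

Definition rV_cons (n : nat) (p : measurableTypeR R * borel 'rV[R]_n) : borel 'rV[R]_n.+1 :=
  (row_mx (p.1 : R)%:M (p.2 : 'rV[R]_n) : 'rV[R]_n.+1).

Lemma measurable_rV_cons n : measurable_fun [set: _] (@rV_cons n).
Proof.
apply: measurable_fun_rV => j; rewrite /rV_cons.
have -> : (fun x : measurableTypeR R * borel 'rV[R]_n =>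
    (row_mx (x.1 : R)%:M (x.2 : 'rV[R]_n) : 'rV[R]_n.+1) ord0 j) =
  (fun x => match fintype.split (j : 'I_(1 + n)) with inl _ => (x.1 : R)
            | inr k => (x.2 : 'rV[R]_n) ord0 k end).
  apply/funext => x; rewrite mxE; case: fintype.split => // k.
  by rewrite mxE (ord1 k) eqxx mulr1n.
case: fintype.split => k; first exact: measurable_fst.
apply: (@measurableT_comp _ _ _ _ _ _ (fun v : borel 'rV[R]_n => (v : 'rV[R]_n) ord0 k)) => //.
by apply: continuous_measurable; exact: coord_continuous.
Qed.

Section LebesgueStep.
Variables (n : nat) (m : {sigma_finite_measure set (borel 'rV[R]_n) -> \bar R}).

Definition lebesgue_step : set (borel 'rV[R]_n.+1) -> \bar R :=
  fun B => product_measure1 (@lebesgue_measure R) m (@rV_cons n @^-1` B).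

Let step0 : lebesgue_step set0 = 0%E.
Proof. by rewrite /lebesgue_step preimage_set0 measure0. Qed.

Let step_ge0 B : (0 <= lebesgue_step B)%E.
Proof. exact: measure_ge0. Qed.

Let step_additive : semi_sigma_additive lebesgue_step.
Proof.
move=> F mF tF mUF; rewrite /lebesgue_step preimage_bigcup.
apply: measure_semi_sigma_additive.
- by move=> i; rewrite -[X in measurable X]setTI; exact: measurable_rV_cons.
- apply/trivIsetP => /= i j _ _ ij; rewrite -preimage_setI.
  by move/trivIsetP : tF => /(_ _ _ _ _ ij) ->//; rewrite preimage_set0.
- by rewrite -preimage_bigcup -[X in measurable X]setTI; exact: measurable_rV_cons.
Qed.

HB.instance Definition _ := isMeasure.Build _ _ _ lebesgue_step
  step0 step_ge0 step_additive.
End LebesgueStep.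

Definition cube (n : nat) (r : R) : set (borel 'rV[R]_n) :=
  [set v : 'rV[R]_n | forall j, `|v ord0 j| <= r].
Arguments cube : clear implicits.

Lemma measurable_cube n r : measurable (cube n r).
Proof.
have -> : cube n r = \bigcap_(j in [set: 'I_n])
    (setT `&` (fun v : borel 'rV[R]_n => (v : 'rV[R]_n) ord0 j) @^-1` `[- r, r]).
  by apply/seteqP; split=> v H j; [move=> _; split=> //|have [_] := H j Logic.I];
    rewrite /= in_itv /= -ler_norml.
apply: fin_bigcap_measurable => // j _.
by apply: continuous_measurable => //; exact: coord_continuous.
Qed.

Lemma cubes_sigma_finite n (m : {measure set (borel 'rV[R]_n) -> \bar R}) :
  (forall r, m (cube n r) < +oo)%E -> sigma_finite setT m.
Proof.
move=> mc; exists (fun i => cube n i%:R) => [|i]; last first.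
  by split; [exact: measurable_cube|exact: mc].
apply/seteqP; split=> // v _.
exists (\sum_j Num.bound (`|(v : 'rV[R]_n) ord0 j|))%N => // j.
apply: le_trans (ltW (archi_boundP _)) _ => //.
by rewrite ler_nat (bigD1 j) //= leq_addr.
Qed.

(** The finiteness on cubes is carried along the induction since it gives the
    sigma-finiteness which the next product measure requires. *)
Lemma lebesgue_is_measure n : exists m : {sigma_finite_measure set (borel 'rV[R]_n) -> \bar R},
  (@lebesgue R n : set (borel 'rV[R]_n) -> \bar R) = m /\
  forall r, (m (cube n r) < +oo)%E.
Proof.
elim: n => [|n [m [mE mc]]].
  exists (dirac (0 : borel 'rV[R]_0)); split=> // r.
  by rewrite /= /dirac indicE; case: (_ \in _); rewrite ltry.
have stepE : (@lebesgue R n.+1 : set (borel 'rV[R]_n.+1) -> \bar R) = lebesgue_step m.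
  by apply/funext => B; rewrite /= mE.
have stepc r : (lebesgue_step m (cube n.+1 r) < +oo)%E.
  rewrite /lebesgue_step; have -> : @rV_cons n @^-1` (cube n.+1 r) = `[- r, r]%classic `*` cube n r.
    apply/seteqP; split=> -[x v] /=; rewrite in_itv /=.
      move=> H; split=> [|j].
        have : `|(row_mx (x : R)%:M (v : 'rV[R]_n) : 'rV_(1 + n)) ord0 (lshift n ord0)| <= r.
          exact: H.
        by rewrite row_mxEl mxE eqxx mulr1n ler_norml.
      have : `|(row_mx (x : R)%:M (v : 'rV[R]_n) : 'rV_(1 + n)) ord0 (rshift 1 j)| <= r.
        exact: H.
      by rewrite row_mxEr.
    move=> [xr vr] j; rewrite mxE; case: fintype.split => k; last exact: vr.
    by rewrite mxE (ord1 k) eqxx mulr1n ler_norml.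
  rewrite product_measure1E //; last exact: measurable_cube.
  have Ifin : (@lebesgue_measure R `[(- r)%R, r]%classic < +oo)%E.
    by rewrite lebesgue_measure_itv /=; case: ifP => _; rewrite ?ltry // -EFinD ltry.
  by rewrite lte_mul_pinfty // ge0_fin_numE.
have sf := cubes_sigma_finite stepc.
pose m' : {sigma_finite_measure set (borel 'rV[R]_n.+1) -> \bar R} :=
  HB.pack (lebesgue_step m) (Measure_isSigmaFinite.Build _ _ _ (lebesgue_step m) sf).
by exists m'.
Qed.

End LebesgueMeasure.

(** * The reference measure on actions *)

Section Reference.
Import finmap.
Context {R : realType}.

Lemma compact_sub_cube n (B : set 'rV[R]_n) : compact B ->
  exists r : R, B `<=` @cube R n r.
Proof.
move=> cB.
have /choice[M HM] : forall j : 'I_n, exists M : R, forall v, B v -> `|v ord0 j| <= M.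
  move=> j; have cj : {within B, continuous (fun v : 'rV[R]_n => v ord0 j)}.
    by apply: continuous_subspaceT; exact: coord_continuous.
  have [M [_ HM]] := compact_bounded (continuous_compact cj cB).
  by exists (M + 1) => v Bv; apply: (HM (M + 1)); [rewrite ltrDl|exists v].
exists (\sum_j `|M j|) => v Bv j.
apply: le_trans (HM j v Bv) _; rewrite (bigD1 j) //= -[leLHS]addr0 lerD ?ler_norm //.
exact: sumr_ge0.
Qed.

Lemma rV_hausdorff n : hausdorff_space 'rV[R]_n.
Proof.
move=> p q pq; apply/rowP => j; apply: (@Rhausdorff R) => B C Bp Cq.
have cj (v : 'rV[R]_n) := @coord_continuous R 1 n ord0 j v.
have [v [Bv Cv]] := pq _ _ (cj p B Bp) (cj q C Cq).
by exists (v ord0 j).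
Qed.

Definition bool_counting : set (borel bool) -> \bar R :=
  measure_add (dirac (true : borel bool)) (dirac (false : borel bool)).

HB.instance Definition _ := Measure.on bool_counting.

Lemma bool_countingE X : bool_counting X =
  (dirac (true : borel bool) X + dirac (false : borel bool) X)%E.
Proof. exact: measure_addE. Qed.

Lemma bool_counting_fin X : (bool_counting X < +oo)%E.
Proof. by rewrite bool_countingE !diracE -EFinD ltry. Qed.

HB.instance Definition _ := Measure_isFinite.Build _ _ _ bool_counting
  (fun X _ => eq_ind_r is_true (bool_counting_fin X) (ge0_fin_numE (measure_ge0 bool_counting X))).

(** These five facts are all that the analysis of the major player's problem
    uses of the action space: the two kinds of action space are not
    distinguished any more. *)
Lemma reference_is_measure (A : action_space R) : admissible_actions A ->
  exists m : {sigma_finite_measure set (borel (ambient A)) -> \bar R},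
   [/\ @reference R A = m, compact (@actions R A),
       measurable (@actions R A : set (borel (ambient A))),
       (0 < m (@actions R A))%E & (m (@actions R A) < +oo)%E].
Proof.
case: A => [l B|] /=.
  move=> [l0 cB B0]; have [m [mE mc]] := @lebesgue_is_measure R l.
  have mB : measurable (B : set (borel 'rV[R]_l)).
    by apply: borel_closed; apply: compact_closed cB; exact: rV_hausdorff.
  exists m; split=> //; first by rewrite -mE.
  have [r Br] := compact_sub_cube cB.
  apply: le_lt_trans (mc r); apply: (@le_measure _ _ _ m _ _ _ _ Br).
    exact/mem_set.
  by apply/mem_set; apply: (@measurable_cube R l r).
move=> _.
have fb (X : set bool) : finite_set X by exact: finite_finset.
exists bool_counting; split=> //.
- apply/funext => X; apply: etrans (esym (bool_countingE X)).
  rewrite /= /counting asboolT // !diracE.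
  have -> : fset_set X = ((if true \in X then [fset true] else fset0) `|`
      (if false \in X then [fset false] else fset0))%fset.
    apply/fsetP => b; rewrite in_fset_set // !inE.
    by case: b; case: (true \in X); case: (false \in X); rewrite !inE.
  by case: (true \in X); case: (false \in X);
    rewrite ?fsetU0 ?fset0U ?cardfs2 ?cardfs1 ?cardfs0 ?adde0 ?add0e -?EFinD.
- by apply: finite_compact.
- change (0 < bool_counting [set: bool])%E.
  by rewrite bool_countingE !diracE -EFinD lte_fin !in_setT addr_gt0.
- exact: bool_counting_fin.
Qed.
End Reference.

(** * Densities and the Gibbs variational principle *)

Section Densities.
Context {d} {X : measurableType d} {R : realType}.
Variables (ref : {sigma_finite_measure set X -> \bar R}) (A : set X).
Hypotheses (mA : measurable A) (refA0 : (0 < ref A)%E) (refAy : (ref A < +oo)%E).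
Implicit Types (phi psi F Q : X -> R) (nu : probability X R).

Definition is_density nu phi :=
  [/\ measurable_fun A phi, forall a, A a -> 0 <= phi a &
    forall B, measurable B -> nu B = (\int[ref]_(a in A `&` B) (phi a)%:E)%E].

Lemma density_integrable nu phi : is_density nu phi ->
  ref.-integrable A (EFin \o phi).
Proof.
move=> [mphi phi0 nuE]; apply/integrableP; split; first exact/measurable_EFinP.
have := nuE setT measurableT; rewrite setIT probability_setT => nu1.
apply: (@le_lt_trans _ _ (\int[ref]_(a in A) (phi a)%:E)%E); last by rewrite -nu1 ltry.
rewrite le_eqVlt; apply/orP; left; apply/eqP; apply: eq_integral => a /set_mem Aa /=.
by rewrite ger0_norm // phi0.
Qed.

Lemma density_ae nu phi (g : X -> \bar R) : is_density nu phi -> measurable_fun A g ->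
  (forall B, measurable B -> B `<=` A -> nu B = (\int[ref]_(a in B) g a)%E) ->
  ae_eq ref A (EFin \o phi) g.
Proof.
move=> dphi mg nug; apply: integral_ae_eq => //; first exact: density_integrable dphi.
move=> B BA mB; rewrite -nug //; have [_ _ ->//] := dphi.
by rewrite setIidr.
Qed.

(** The density agrees almost everywhere with the Radon-Nikodym derivative, for
    which the formula is known. *)
Lemma density_change_of_variables nu phi F : is_density nu phi -> bmeas A F ->
  \int[nu]_(a in A) F a = \int[ref]_(a in A) (F a * phi a).
Proof.
move=> dphi bF; have [mphi phi0 nuE] := dphi.
have dom : nu `<< ref.
  apply/null_content_dominatesP => B mB B0; rewrite nuE //.
  have mAB : measurable (A `&` B) by exact: measurableI.
  apply: null_set_integral => //.
    by apply/measurable_EFinP; apply: measurable_funS mphi => //; exact: subIsetl.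
  by apply: (subset_measure0 _ mB _ B0) => //; exact: subIsetr.
pose g := Radon_Nikodym (charge_of_finite_measure nu) ref.
have mg : measurable_fun A g.
  apply: measurable_funTS; apply: measurable_int.
  exact: Radon_Nikodym_integrable.
have phig : ae_eq ref A (EFin \o phi) g.
  apply: (density_ae dphi) => // B mB _.
  by rewrite -Radon_Nikodym_integral.
have nuAy : (nu A < +oo)%E by apply: le_lt_trans (probability_le1 _ mA) _; rewrite ltry.
have iF := bmeas_integrable (mu := nu) mA nuAy bF.
rewrite /Rintegral -[in LHS](Radon_Nikodym_change_of_variables dom mA iF).
congr fine; apply: ae_eq_integral => //.
- by apply: emeasurable_funM => //; apply/measurable_EFinP; case: bF.
- by apply/measurable_EFinP; apply: measurable_funM => //; case: bF.
- by apply: filterS phig => a H Aa; have /= e := H Aa; rewrite /= EFinM e.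
Qed.

(** The entropy of a law is computed with a chosen density; this shows that the
    choice has no influence. *)
Lemma density_xlnx nu phi psi : is_density nu phi -> is_density nu psi ->
  (\int[ref]_(a in A) (phi a * ln (phi a))%:E = \int[ref]_(a in A) (psi a * ln (psi a))%:E)%E.
Proof.
move=> dphi dpsi; have [mphi _ _] := dphi; have [mpsi _ psiE] := dpsi.
have mxlnx (f : X -> R) : measurable_fun A f -> measurable_fun A (fun a => (f a * ln (f a))%:E).
  move=> mf; apply/measurable_EFinP; apply: measurable_funM => //.
  by apply: (measurableT_comp (@measurable_ln R)).
apply: ae_eq_integral => //; [exact: mxlnx|exact: mxlnx|].
have : ae_eq ref A (EFin \o phi) (EFin \o psi).
  apply: (density_ae dphi) => [|B mB BA]; first exact/measurable_EFinP.
  by rewrite psiE // setIidr.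
by apply: filterS => a H Aa /=; have [->] := H Aa.
Qed.

(** The graph of x ln x lies above its tangent at y. *)
Lemma xlnx_ge (x y : R) : 0 <= x -> 0 < y -> x * ln y + x - y <= x * ln x.
Proof.
move=> + y0; rewrite le_eqVlt => /predU1P[<-|x0]; first by rewrite !mul0r; lra.
have yx0 : 0 < y / x by rewrite divr_gt0.
have : ln (y / x) <= y / x - 1.
  have h : -1 < y / x - 1 by lra.
  by have := le_ln1Dx h; rewrite addrC subrK.
rewrite ln_div ?posrE // -(ler_pM2l x0) !mulrBr mulr1 mulrCA divff ?gt_eqF // mulr1.
lra.
Qed.

(** As x ln x >= -1, the negative part is integrable on A, and the upper bound
    on the integral controls the positive part. *)
Lemma xlnx_integrable phi : measurable_fun A phi -> (forall a, A a -> 0 <= phi a) ->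
  (\int[ref]_(a in A) (phi a * ln (phi a))%:E < +oo)%E ->
  ref.-integrable A (fun a => (phi a * ln (phi a))%:E).
Proof.
move=> mphi phi0; set f := fun a => (phi a * ln (phi a))%:E => fy.
have mf : measurable_fun A f.
  apply/measurable_EFinP; apply: measurable_funM => //.
  by apply: (measurableT_comp (@measurable_ln R)).
have neg : (\int[ref]_(a in A) f^\- a < +oo)%E.
  apply: (@le_lt_trans _ _ (\int[ref]_(a in A) (cst 1%E) a)%E); last first.
    by rewrite integral_cst // mul1e.
  apply: ge0_le_integral => //; first exact: measurable_funeneg.
  move=> a Aa; rewrite funenegE /f -EFinN -EFin_max lee_fin ge_max ler01 andbT.
  by have := xlnx_ge (phi0 a Aa) ltr01; rewrite ln1 mulr0; have := phi0 a Aa; lra.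
have negfin : (\int[ref]_(a in A) f^\- a)%E \is a fin_num.
  by rewrite ge0_fin_numE // integral_ge0.
have pos : (\int[ref]_(a in A) f^\+ a < +oo)%E.
  by move: fy; rewrite integralE lteBlDr // addye // -ltNye (lt_le_trans _ (integral_ge0 _ _)).
apply/integrableP; split=> //.
under eq_integral => a _ do rewrite -[`|f a|%E]/((abse \o f) a) fune_abse.
rewrite ge0_integralD //; [exact: lte_add_pinfty|exact: measurable_funepos|exact: measurable_funeneg].
Qed.

Section Gibbs.
Variables (lambda : R) (Q : X -> R).
Hypotheses (lambda0 : 0 < lambda) (bQ : bmeas A Q).

Definition partition_function : R := \int[ref]_(a in A) expR (Q a / lambda).
Definition gibbs_density (a : X) : R := expR (Q a / lambda) / partition_function.

Let bE : bmeas A (fun a => expR (Q a / lambda)).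
Proof.
apply: bmeas_exp; have -> : (fun a => Q a / lambda) = (fun a => lambda^-1 * Q a).
  by apply/funext => a; rewrite mulrC.
exact: bmeasZ.
Qed.

Lemma partition_function_gt0 : 0 < partition_function.
Proof.
have [_ [M QM]] := bQ.
have refA1 : 0 < fine (ref A) by rewrite fine_gt0 // refA0 refAy.
apply: (@lt_le_trans _ _ (expR (- M / lambda) * fine (ref A))).
  by rewrite mulr_gt0 // expR_gt0.
rewrite -Rintegral_cst //; apply: le_bint => //; first exact: bmeas_cst.
move=> a Aa; rewrite ler_expR ler_pM2r ?invr_gt0 //.
by have := QM a Aa; rewrite ler_norml => /andP[].
Qed.

Lemma bmeas_gibbs : bmeas A gibbs_density.
Proof. by apply: bmeasM => //; exact: bmeas_cst. Qed.

Lemma gibbs_density_gt0 a : 0 < gibbs_density a.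
Proof. by rewrite divr_gt0 ?expR_gt0 // partition_function_gt0. Qed.

Lemma gibbs_density_int : \int[ref]_(a in A) gibbs_density a = 1.
Proof.
have -> : gibbs_density = (fun a => partition_function^-1 * expR (Q a / lambda)).
  by apply/funext => a; rewrite /gibbs_density mulrC.
by rewrite bintZ // mulVf // gt_eqF // partition_function_gt0.
Qed.

Lemma ln_gibbs_density a : ln (gibbs_density a) = Q a / lambda - ln partition_function.
Proof.
by rewrite /gibbs_density ln_div ?posrE ?expR_gt0 ?partition_function_gt0 // expRK.
Qed.

Lemma gibbs_variational_eq :
  \int[ref]_(a in A) (Q a * gibbs_density a) -
  lambda * \int[ref]_(a in A) (gibbs_density a * ln (gibbs_density a)) =
  lambda * ln partition_function.
Proof.
have bQg := bmeasM bQ bmeas_gibbs.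
have -> : (fun a => gibbs_density a * ln (gibbs_density a)) =
  (fun a => lambda^-1 * (Q a * gibbs_density a) - ln partition_function * gibbs_density a).
  by apply/funext => a; rewrite ln_gibbs_density; ring.
rewrite bintB //; try (apply: bmeasZ => //; exact: bmeas_gibbs).
rewrite !bintZ //; last exact: bmeas_gibbs.
rewrite gibbs_density_int mulr1 mulrBr mulVKf ?gt_eqF //; ring.
Qed.

Lemma bmeas_xlnx_gibbs : bmeas A (fun a => gibbs_density a * ln (gibbs_density a)).
Proof.
have bQg := bmeasM bQ bmeas_gibbs.
have -> : (fun a => gibbs_density a * ln (gibbs_density a)) =
  (fun a => lambda^-1 * (Q a * gibbs_density a) - ln partition_function * gibbs_density a).
  by apply/funext => a; rewrite ln_gibbs_density; ring.
by apply: bmeasB; apply: bmeasZ => //; exact: bmeas_gibbs.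
Qed.

(** Gibbs' inequality: integrate the tangent inequality for x ln x at the Gibbs
    density. *)
Lemma gibbs_variational_le phi : measurable_fun A phi -> (forall a, A a -> 0 <= phi a) ->
  ref.-integrable A (EFin \o phi) -> \int[ref]_(a in A) phi a = 1 ->
  ref.-integrable A (fun a => (phi a * ln (phi a))%:E) ->
  \int[ref]_(a in A) (Q a * phi a) - lambda * \int[ref]_(a in A) (phi a * ln (phi a))
  <= lambda * ln partition_function.
Proof.
move=> mphi phi0 iphi phi1 ixlnx.
have [mQ [M QM]] := bQ.
have iQphi : ref.-integrable A (EFin \o (fun a => Q a * phi a)).
  have := @integrableMr _ _ _ ref A mA Q (EFin \o phi) mQ _ iphi.
  have : [bounded Q a | a in A].
    exists M; split; first exact: num_real.
    by move=> y My a Aa; apply: le_trans (QM a Aa) (ltW My).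
  by move=> b /(_ b).
have i1 : ref.-integrable A (EFin \o (fun a => lambda^-1 * (Q a * phi a))).
  exact: (@integrableZl _ _ _ ref A mA lambda^-1 _ iQphi).
pose c := 1 - ln partition_function.
have i2 : ref.-integrable A (EFin \o (fun a => c * phi a)).
  exact: (@integrableZl _ _ _ ref A mA c _ iphi).
have i3 := bmeas_integrable (mu := ref) mA refAy bmeas_gibbs.
have i12 : ref.-integrable A (EFin \o (fun a => lambda^-1 * (Q a * phi a) + c * phi a)).
  exact: (integrableD mA i1 i2).
have : \int[ref]_(a in A) (lambda^-1 * (Q a * phi a) + c * phi a - gibbs_density a) <=
       \int[ref]_(a in A) (phi a * ln (phi a)).
  apply: le_Rintegral => //; first exact: (integrableB mA i12 i3).
  move=> a Aa; have := xlnx_ge (phi0 a Aa) (gibbs_density_gt0 a).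
  by rewrite ln_gibbs_density /c; apply: le_trans; rewrite le_eqVlt; apply/orP; left; apply/eqP; ring.
rewrite RintegralB // RintegralD // !RintegralZl // gibbs_density_int phi1 /c => H.
rewrite -(ler_pM2l lambda0) !mulrDr mulVKf ?gt_eqF // in H.
lra.
Qed.

End Gibbs.

Section DensityMeasure.
Variable phi : X -> R.
Hypotheses (mphi : measurable_fun A phi) (phi_ge0 : forall a, A a -> 0 <= phi a).
Hypothesis phi_int : (\int[ref]_(a in A) (phi a)%:E = 1)%E.

Definition density_measure (B : set X) : \bar R := (\int[ref]_(a in A `&` B) (phi a)%:E)%E.

Let dm0 : density_measure set0 = 0%E.
Proof. by rewrite /density_measure setI0 integral_set0. Qed.

Let dm_ge0 B : (0 <= density_measure B)%E.
Proof. by apply: integral_ge0 => a [Aa _]; rewrite lee_fin phi_ge0. Qed.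

Let dm_additive : semi_sigma_additive density_measure.
Proof.
move=> F mF tF mUF; rewrite /density_measure setI_bigcupr ge0_integral_bigcup //=.
- apply: is_cvg_ereal_nneg_natsum_cond => n _ _; exact: dm_ge0.
- by move=> i; exact: measurableI.
- apply/measurable_EFinP; apply: measurable_funS mphi => //.
  by move=> a [i _ []].
- by move=> a [i _ [Aa _]]; rewrite lee_fin phi_ge0.
- exact: trivIset_setIl.
Qed.

HB.instance Definition _ := isMeasure.Build _ _ _ density_measure dm0 dm_ge0 dm_additive.

Let dm1 : density_measure setT = 1%E.
Proof. by rewrite /density_measure setIT. Qed.

HB.instance Definition _ := Measure_isProbability.Build _ _ _ density_measure dm1.

Lemma density_measure_exists : exists nu : probability X R, is_density nu phi.
Proof. by exists (density_measure : probability X R). Qed.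
End DensityMeasure.
End Densities.

(** * Recursions in time and the space of paths *)

Lemma tnextE T (t : 'I_T) : tnext t = t.+1 :> nat.
Proof. by rewrite /= /bump leq0n. Qed.

Section TimeRecursion.
Variables (T : nat) (Y : Type).

(** k is the number of steps to go: for 0 < k <= T the time T - k is below T,
    so that insub succeeds. *)
Fixpoint backward_from (y : Y) (F : 'I_T -> Y -> Y) (k : nat) : Y :=
  if k is k'.+1 then
    if insub (T - k)%N is Some i then F i (backward_from y F k') else y
  else y.

Definition backward y F (s : 'I_T.+1) : Y := backward_from y F (T - s).

Lemma backward_max y F : backward y F ord_max = y.
Proof. by rewrite /backward /= subnn. Qed.

Lemma backward_now y F (t : 'I_T) : backward y F (tnow t) = F t (backward y F (tnext t)).
Proof.
rewrite /backward tnextE /=.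
have -> : (T - t = (T - t.+1).+1)%N by have := ltn_ord t; lia.
rewrite /=; have -> : (T - (T - t.+1).+1 = t)%N by have := ltn_ord t; lia.
by rewrite valK.
Qed.

Fixpoint forward_to (y : Y) (F : 'I_T -> Y -> Y) (k : nat) : Y :=
  if k is k'.+1 then
    if insub k' is Some i then F i (forward_to y F k') else y
  else y.

Definition forward y F (s : 'I_T.+1) : Y := forward_to y F s.

Lemma forward_next y F (t : 'I_T) : forward y F (tnext t) = F t (forward y F (tnow t)).
Proof. by rewrite /forward tnextE /= valK. Qed.

Lemma backward_ind (P : 'I_T.+1 -> Prop) : P ord_max ->
  (forall t : 'I_T, P (tnext t) -> P (tnow t)) -> forall s, P s.
Proof.
move=> Pmax Pnow s; have [k] := ubnP (T - s); elim: k s => // k IH s Hk.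
have [sT|Ts] := ltnP s T.
  have -> : s = tnow (Ordinal sT) by apply: val_inj.
  by apply: Pnow; apply: IH; rewrite tnextE /=; lia.
by have -> : s = ord_max by apply: val_inj => /=; have := ltn_ord s; lia.
Qed.

Lemma forward_ind (P : 'I_T.+1 -> Prop) : P ord0 ->
  (forall t : 'I_T, P (tnow t) -> P (tnext t)) -> forall s, P s.
Proof.
move=> P0 Pnext [k]; elim: k => [|k IH] kT.
  by have -> : Ordinal kT = ord0 by apply: val_inj.
have kT' : (k < T)%N by [].
have -> : Ordinal kT = tnext (Ordinal kT') by apply: ord_inj; rewrite tnextE.
apply: Pnext; have -> : tnow (Ordinal kT') = Ordinal (ltnW kT) by apply: val_inj.
exact: IH.
Qed.
End TimeRecursion.

Lemma slice_continuous (X Y Z : topologicalType) (f : X * Y -> Z) y :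
  continuous f -> continuous (fun x => f (x, y)).
Proof.
move=> fc x B /(fc (x, y))[[C D] /= [Cx Dy] CD].
apply: filterS Cx => x' Cx'; apply: (CD (x', y)).
by split=> //=; exact: nbhs_singleton.
Qed.

Section PathSpace.
Context {T N : nat}.

Lemma path_discrete (u : W T N) : nbhs u [set u].
Proof.
exists (fun i j => [set u i j]) => [i j|v H]; first exact: discrete_set1.
by apply/matrixP => i j; exact: H.
Qed.

Lemma path_continuous (Y : topologicalType) (f : W T N -> Y) : continuous f.
Proof.
move=> u B Bfu; apply: filterS (path_discrete u) => v ->; exact: (nbhs_singleton Bfu).
Qed.

Lemma state_path_continuous (S Y : topologicalType) (f : S * W T N -> Y) :
  (forall u, continuous (fun x => f (x, u))) -> continuous f.
Proof.
move=> fc [x u] B /(fc u x) Bx.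
exists ([set x' | B (f (x', u))], [set u]); first by split; [exact: Bx|exact: path_discrete].
by move=> [x' u'] [/= Bx' ->].
Qed.

End PathSpace.

(** * Path transitions of the major player *)

Section Transitions.
Context {R : realType} {T N : nat} {S : pmetricType R} {A : action_space R}.
Variable G : mmgame T N S A.
Hypothesis hP : assumption_P G.
Local Notation W := (W T N).

Lemma path_measurable (B : set (borel W)) : measurable B.
Proof.
apply: borel_open; rewrite openE => u Bu.
by apply: filterS (path_discrete u) => v ->.
Qed.

Lemma P0mass_ge0 t u a m u' : 0 <= P0mass G t u a m u'.
Proof. by rewrite fine_ge0. Qed.

Lemma path_bmeas (f : W -> R) : bmeas [set: borel W] f.
Proof.
split; first by move=> _ B _; exact: path_measurable.
exists (\sum_u `|f u|) => u _; rewrite (bigD1 u) //= -[leLHS]addr0 lerD //.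
exact: sumr_ge0.
Qed.

Lemma prob_fin {d} {X : measurableType d} (nu : probability X R) : (nu setT < +oo)%E.
Proof. by rewrite probability_setT ltry. Qed.

Lemma prob_Rintegral_cst {d} {X : measurableType d} (nu : probability X R) (c : R) :
  \int[nu]_x c = c.
Proof.
rewrite Rintegral_cst // -[RHS]mulr1; congr (_ * _).
exact: (congr1 fine (probability_setT nu)).
Qed.

Lemma indicator_Rintegral {d} {X : measurableType d} (nu : probability X R) (B : set X)
    (f : X -> R) : measurable B -> (forall x, f x = \1_B x) ->
  fine (nu B) = \int[nu]_x f x.
Proof.
move=> mB fE; rewrite /Rintegral; under eq_integral do rewrite fE.
by rewrite integral_indic // setIT.
Qed.

Lemma P0massE t u a m u' :
  P0mass G t u a m u' = \int[P0 G t u a m : probability (borel W) R]_v (v == u')%:R.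
Proof.
apply: indicator_Rintegral => [|v]; first exact: path_measurable.
by rewrite indicE; congr (_%:R); apply: congr1; apply/eqP/idP => [->|/set_mem //]; exact/mem_set.
Qed.

Lemma P0mass_sum t u a m : \sum_u' P0mass G t u a m u' = 1.
Proof.
under eq_bigr do rewrite P0massE.
rewrite -(bint_sum (mu := (P0 G t u a m : probability (borel W) R)) measurableT (prob_fin _)
   (index_enum _) xpredT (F := fun u' (v : borel W) => (v == u')%:R)); last by move=> i; exact: path_bmeas.
under eq_Rintegral => v _.
  rewrite (bigD1 v) //= eqxx big1 ?addr0; last by move=> i /negbTE; rewrite eq_sym => ->.
  over.
exact: prob_Rintegral_cst.
Qed.

Lemma P0mass_continuous t u u' :
  {within @actions R A `*` [set: Psub R S],
     continuous (fun p : ambient A * Psub R S => P0mass G t u p.1 p.2 u')}.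
Proof.
have [/(_ t u) cP _ _] := hP.
have ci : continuous (fun v : W => (v == u')%:R : R) by exact: path_continuous.
have bi : bounded_fun (fun v : W => (v == u')%:R : R).
  exists 1; split; first exact: num_real.
  by move=> y y1 v _ /=; apply: le_trans (ltW y1); rewrite ger0_norm // lern1 leq_b1.
have -> : (fun p : ambient A * Psub R S => P0mass G t u p.1 p.2 u') =
   (fun p => weak_prob (P0 G t u p.1 p.2) (exist _ _ (conj ci bi))).
  by apply/funext => p; rewrite P0massE.
move=> p; apply: (@continuous_comp _ _ _ (fun p : subspace _ => P0 G t u p.1 p.2)
  (fun nu => weak_prob nu (exist _ _ (conj ci bi)))); first exact: cP.
exact: weak_prob_continuous.
Qed.

Lemma within_slice (X Y Z : topologicalType) (D : set X) (f : X * Y -> Z) y :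
  {within D `*` [set: Y], continuous f} -> {within D, continuous (fun x => f (x, y))}.
Proof.
move=> /subspace_continuousP fc; apply/subspace_continuousP => x Dx B Bf.
have [[C E] /= [Cx Ey] CE] := fc (x, y) (conj Dx Logic.I) B Bf.
apply: filterS Cx => x' Cx' Dx'; apply: (CE (x', y)) => //.
by split=> //=; exact: nbhs_singleton.
Qed.

End Transitions.

(** * The major player's regularized problem *)

Section Major.
Context {R : realType} {T N : nat} {S : pmetricType R} {A : action_space R}.
Variable G : mmgame T N S A.
Hypotheses (hP : assumption_P G) (hR0 : assumption_R0 G).
Local Notation W := (W T N).
Local Notation Act := (@actions R A).
Variable ref : {sigma_finite_measure set (borel (ambient A)) -> \bar R}.
Hypotheses (refE : @reference R A = ref) (cA : compact Act)
  (mA : measurable (Act : set (borel (ambient A))))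
  (ref_gt0 : (0 < ref Act)%E) (ref_fin : (ref Act < +oo)%E).
Variable lambda : R.
Hypothesis lambda_gt0 : 0 < lambda.

Lemma densityE (nu : Prob R (ambient A)) phi :
  density nu phi <-> is_density ref Act (nu : probability _ _) phi.
Proof. by rewrite /density refE. Qed.

Lemma P0mass_bmeas t u m u' : bmeas (Act : set (borel (ambient A)))
  (fun a => P0mass G t u a m u').
Proof.
apply: within_continuous_bmeas => //.
exact: (within_slice (P0mass_continuous hP (t := t) (u := u) (u' := u'))).
Qed.

Lemma f0_bmeas t z m : bmeas (Act : set (borel (ambient A))) (fun a => f0 G t z a m).
Proof.
apply: within_continuous_bmeas => //; have [cf _ _] := hR0.
exact: (within_slice (cf t z)).
Qed.

Lemma Qfun_bmeas m v t u : bmeas (Act : set (borel (ambient A))) (Qfun G m v t u).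
Proof.
apply: bmeasD; first exact: f0_bmeas.
by apply: bmeas_sum => u'; apply: bmeasZ; exact: P0mass_bmeas.
Qed.

Section Relaxed.
Variable nu : Prob R (ambient A).
Hypothesis nuA : (nu : probability _ _) Act = 1%E.

Let nuAy : ((nu : probability _ _) Act < +oo)%E.
Proof. by rewrite nuA ltry. Qed.

Lemma pi0_ge0 t u m u' : 0 <= pi0 G t u nu m u'.
Proof. by apply: Rintegral_ge0 => a _; exact: P0mass_ge0. Qed.

Lemma pi0_sum t u m : \sum_u' pi0 G t u nu m u' = 1.
Proof.
rewrite /pi0 -(bint_sum (mu := (nu : probability (borel (ambient A)) R)) mA nuAy
  (index_enum _) xpredT (F := fun u' a => P0mass G t u a m u')); last first.
  by move=> u'; exact: P0mass_bmeas.
under eq_Rintegral => a _ do rewrite P0mass_sum.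
by rewrite Rintegral_cst // mul1r -[RHS]/(fine 1%E); congr fine.
Qed.

Lemma Qfun_Rintegral m v t u :
  \int[nu : probability _ _]_(a in Act) Qfun G m v t u a =
  \int[nu : probability _ _]_(a in Act) f0 G t (PsiG G (tnow t) u) a (m t u) +
  \sum_u' pi0 G t u nu (m t u) u' * v (tnext t) u'.
Proof.
rewrite /Qfun bintD //; [|exact: f0_bmeas|]; last first.
  by apply: bmeas_sum => u'; apply: bmeasZ; exact: P0mass_bmeas.
congr (_ + _); rewrite bint_sum //; last first.
  by move=> u'; apply: bmeasZ; exact: P0mass_bmeas.
apply: eq_bigr => u' _; rewrite bintZ //; last exact: P0mass_bmeas.
by rewrite mulrC.
Qed.

End Relaxed.

Section Chain.
Variables (beta : control T N A) (m : Cm T N S).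
Hypothesis rbeta : relaxed beta.

Lemma law_from_ge0 s q k u : (forall u, 0 <= q u) -> 0 <= law_from G beta m s q k u.
Proof.
move=> q0; elim: k u => [|k IH] u //=.
case: ifP => // _; case: insubP => // i _ _.
by apply: sumr_ge0 => u' _; rewrite mulr_ge0 // pi0_ge0.
Qed.

Lemma law_from_start s q : law_from G beta m s q s = q.
Proof. by case: s => [//|s] /=; rewrite ltnn. Qed.

Lemma law_from_next s q (t : 'I_T) u : (s <= t)%N ->
  law_from G beta m s q t.+1 u =
  \sum_u' pi0 G t u' (beta t u') (m t u') u * law_from G beta m s q t u'.
Proof. by move=> st /=; rewrite st valK. Qed.

(** Summing the increments of V along the chain shows that V exceeds the payoff
    by the accumulated one-step Bellman defects, whatever the control. *)
Lemma J0_telescope mu s q (V : 'I_T.+1 -> W -> R) (hs : (s <= T)%N) :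
  (forall u, V ord_max u = final0 G mu u) ->
  \sum_u q u * V (inord s) u - J0_from G lambda mu m s q beta =
  \sum_(t < T | (s <= t)%N) \sum_u law_from G beta m s q t u *
     (V (tnow t) u - (reward0 G lambda m beta t u +
       \sum_u' pi0 G t u (beta t u) (m t u) u' * V (tnext t) u')).
Proof.
move=> Vmax; rewrite /J0_from.
pose w k := \sum_u law_from G beta m s q k u * V (inord k) u.
have -> : \sum_u q u * V (inord s) u = w s by rewrite /w law_from_start.
have -> : \sum_u law_from G beta m s q T u * final0 G mu u = w T.
  apply: eq_bigr => u _; congr (_ * _); rewrite -Vmax; congr (V _ u).
  by apply: ord_inj; rewrite inordK.
have tel : \sum_(t < T | (s <= t)%N) (w t - w t.+1) = w s - w T.
  rewrite -(big_geq_mkord _ _ xpredT (fun t => w t - w t.+1)).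
  rewrite -[LHS]opprK -sumrN; under eq_bigr do rewrite opprB.
  by rewrite telescope_sumr // opprB.
rewrite opprD addrA addrAC -tel -sumrB; apply: eq_bigr => t st.
rewrite /w; under [X in _ - X - _]eq_bigr => u _ do rewrite law_from_next // mulr_suml.
rewrite exchange_big /= -!sumrB; apply: eq_bigr => u _.
have -> : inord t = tnow t by apply: ord_inj; rewrite inordK //= ltnW // ltnS.
have -> : inord t.+1 = tnext t by apply: ord_inj; rewrite inordK ?tnextE // ltnS.
rewrite [X in _ - X - _](_ : _ = law_from G beta m s q t u *
  \sum_u' pi0 G t u (beta t u) (m t u) u' * V (tnext t) u'); first ring.
by rewrite mulr_sumr; apply: eq_bigr => u' _; ring.
Qed.

End Chain.

(** The Bellman recursion in which the maximum over densities is replaced by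
    its closed form, lambda times the logarithm of the partition function. *)
Definition major_value (mu : Cmu T N S) (m : Cm T N S) : 'I_T.+1 -> W -> R :=
  backward (final0 G mu) (fun t v u =>
    lambda * ln (partition_function ref Act lambda (Qfun G m (fun=> v) t u))).

Lemma major_value_now mu m t u : major_value mu m (tnow t) u =
  lambda * ln (partition_function ref Act lambda (Qfun G m (major_value mu m) t u)).
Proof. by rewrite {1}/major_value backward_now. Qed.

Definition major_gibbs mu m t u : ambient A -> R :=
  gibbs_density ref Act lambda (Qfun G m (major_value mu m) t u).

Lemma shannonE phi : fine (@shannon R A phi) =
  - \int[ref]_(a in Act) (phi a * ln (phi a)).
Proof. by rewrite /shannon /ref_int refE fineN. Qed.

Lemma shannon_Nyt phi : ((-oo < @shannon R A phi) =
  (\int[ref]_(a in Act) (phi a * ln (phi a))%:E < +oo))%E.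
Proof. by rewrite /shannon /ref_int refE lteNr. Qed.

Lemma entropic_payoff_le (Q phi : ambient A -> R) : bmeas (Act : set (borel (ambient A))) Q ->
  measurable_fun (Act : set (borel (ambient A))) phi ->
  (forall a, Act a -> 0 <= phi a) ->
  (\int[ref]_(a in Act) (phi a)%:E = 1)%E -> (-oo < @shannon R A phi)%E ->
  \int[ref]_(a in Act) (Q a * phi a) + lambda * fine (@shannon R A phi)
  <= lambda * ln (partition_function ref Act lambda Q).
Proof.
move=> bQ mphi phi0 phi1 Hphi; rewrite shannonE mulrN.
apply: gibbs_variational_le => //.
- apply/integrableP; split; first exact/measurable_EFinP.
  apply: (@le_lt_trans _ _ (\int[ref]_(a in Act) (phi a)%:E)%E); last by rewrite phi1 ltry.
  rewrite le_eqVlt; apply/orP; left; apply/eqP; apply: eq_integral => a /set_mem Aa /=.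
  by rewrite ger0_norm // phi0.
- by rewrite /Rintegral phi1.
- by apply: xlnx_integrable => //; rewrite -shannon_Nyt.
Qed.

Section Gibbs.
Variables (Q : ambient A -> R).
Hypothesis bQ : bmeas (Act : set (borel (ambient A))) Q.
Local Notation w := (gibbs_density ref Act lambda Q).

Lemma gibbs_entropic : @entropic_pdf R A w.
Proof.
have bw := bmeas_gibbs ref lambda bQ.
split.
- by case: bw.
- by move=> a _; apply/ltW/(gibbs_density_gt0 mA ref_gt0 ref_fin lambda_gt0 bQ).
- rewrite /ref_int refE -[LHS]fineK.
    by congr EFin; exact: (gibbs_density_int mA ref_gt0 ref_fin lambda_gt0 bQ).
  by apply: integrable_fin_num => //; exact: bmeas_integrable.
- rewrite shannon_Nyt; apply: integrable_lty => //.
  by apply: (bmeas_integrable (mu := ref) mA ref_fin); exact: bmeas_xlnx_gibbs.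
Qed.

Lemma gibbs_payoff : \int[ref]_(a in Act) (Q a * w a) + lambda * fine (@shannon R A w) =
  lambda * ln (partition_function ref Act lambda Q).
Proof. by rewrite shannonE mulrN gibbs_variational_eq. Qed.

End Gibbs.

Lemma major_value_function mu m : value_function G lambda mu m (major_value mu m).
Proof.
split=> [u|t u]; first by rewrite /major_value backward_max.
have bQ := Qfun_bmeas m (major_value mu m) t u.
split.
  exists (major_gibbs mu m t u); first exact: gibbs_entropic.
  by rewrite major_value_now /ref_int refE -gibbs_payoff.
move=> _ [phi [mphi phi0 phi1 Hphi] <-].
rewrite major_value_now /ref_int refE; apply: entropic_payoff_le => //.
by move: phi1; rewrite /ref_int refE.
Qed.

Lemma gibbsE mu m t u : gibbs G lambda m (major_value mu m) t u = major_gibbs mu m t u.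
Proof. by rewrite /gibbs /major_gibbs /gibbs_density /partition_function /ref_int refE. Qed.

(** The density chosen in the definition of entropy can be replaced by any
    density at hand. *)
Lemma density_entropy (nu : Prob R (ambient A)) phi : density nu phi ->
  entropy nu = @shannon R A phi /\ density nu (get (density nu)).
Proof.
move=> dphi; have dg : density nu (get (density nu)) by apply: getPex; exists phi.
split=> //; rewrite /entropy /shannon /ref_int refE; congr (- _)%E.
by apply: (density_xlnx mA); apply/densityE; eassumption.
Qed.

Lemma density_mass (nu : Prob R (ambient A)) phi : density nu phi ->
  (\int[ref]_(a in Act) (phi a)%:E = 1)%E.
Proof.
move=> /densityE[_ _ /(_ setT measurableT)]; rewrite setIT => <-.
exact: probability_setT.
Qed.

(** One step of dynamic programming: the reward and the expected value
    afterwards add up to the integral of Q plus the entropy term, which the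
    Gibbs principle bounds. *)
Lemma bellman_le mu m beta t u : entropic_control beta ->
  reward0 G lambda m beta t u +
    \sum_u' pi0 G t u (beta t u) (m t u) u' * major_value mu m (tnext t) u'
  <= major_value mu m (tnow t) u.
Proof.
move=> [rb eb]; have [phi [dphi Hphi]] := eb t u.
have [ee _] := density_entropy dphi.
rewrite /reward0 ee addrAC -(Qfun_Rintegral (rb t u)).
have bQ := Qfun_bmeas m (major_value mu m) t u.
have /densityE d' := dphi; have [mphi phi0 _] := d'.
rewrite (density_change_of_variables mA d' bQ) major_value_now.
by apply: entropic_payoff_le => //; exact: density_mass dphi.
Qed.

Lemma bellman_eq mu m beta t u : relaxed beta ->
  density (beta t u) (major_gibbs mu m t u) ->
  reward0 G lambda m beta t u +
    \sum_u' pi0 G t u (beta t u) (m t u) u' * major_value mu m (tnext t) u'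
  = major_value mu m (tnow t) u.
Proof.
move=> rb dphi; have [ee _] := density_entropy dphi.
rewrite /reward0 ee addrAC -(Qfun_Rintegral (rb t u)).
have bQ := Qfun_bmeas m (major_value mu m) t u.
have /densityE d' := dphi.
by rewrite (density_change_of_variables mA d' bQ) major_value_now -gibbs_payoff.
Qed.

(** J0_telescope turns the one-step inequality into optimality from every time
    and every initial law simultaneously. The last clause describes the
    transitions of the optimal chain as an explicit function of (mu, m), which
    is what continuity arguments need. *)
Lemma alpha_lambda_exists mu m : exists alpha,
  [/\ is_alpha_lambda G lambda mu m alpha, relaxed alpha &
   forall t u u', pi0 G t u (alpha t u) (m t u) u' =
     \int[ref]_(a in Act) (P0mass G t u a (m t u) u' * major_gibbs mu m t u a)].
Proof.
have bQ t u := Qfun_bmeas m (major_value mu m) t u.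
have ex t u : exists nu : Prob R (ambient A), density nu (major_gibbs mu m t u).
  have [mg g0 g1 _] := gibbs_entropic (bQ t u).
  rewrite /ref_int refE in g1.
  by have [nu dnu] := density_measure_exists mA mg g0 g1; exists nu; apply/densityE.
have /choice[al Hal] : forall tu : 'I_T * W, exists nu : Prob R (ambient A),
    density nu (major_gibbs mu m tu.1 tu.2) by move=> [t u]; exact: ex.
pose alpha t u := al (t, u).
have dal t u : density (alpha t u) (major_gibbs mu m t u) := Hal (t, u).
have ral : relaxed alpha.
  move=> t u; have /densityE[_ _ ->//] := dal t u.
  by rewrite setIid (density_mass (dal t u)).
have eal : entropic_control alpha.
  split=> // t u; exists (major_gibbs mu m t u); split=> //.
  by have [] := gibbs_entropic (bQ t u).
have Vmax u : major_value mu m ord_max u = final0 G mu u.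
  by rewrite /major_value backward_max.
have opt s q : (s <= T)%N -> (forall u, 0 <= q u) ->
    maximizer (J0_from G lambda mu m s q) alpha.
  move=> sT q0; split=> // beta eb.
  apply: (@le_trans _ _ (\sum_u q u * major_value mu m (inord s) u)).
    have rb : relaxed beta by case: eb.
    rewrite -subr_ge0 J0_telescope //.
    apply: sumr_ge0 => t _; apply: sumr_ge0 => u _; rewrite mulr_ge0 //.
      by apply: law_from_ge0 => //; case: eb.
    by rewrite subr_ge0 bellman_le.
  rewrite -subr_le0 J0_telescope //.
  rewrite big1 // => t _; rewrite big1 // => u _.
  by rewrite bellman_eq // subrr mulr0.
exists alpha; split=> //.
  split.
  - apply: opt => // u; exact: fine_ge0.
  - by move=> t u; apply: opt => [|u']; [exact: ltnW|exact: ler0n].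
  - exists (major_value mu m); first exact: major_value_function.
    by move=> t u; rewrite gibbsE.
move=> t u u'; have /densityE d' := dal t u.
by rewrite /pi0 (density_change_of_variables mA d' (P0mass_bmeas _ _ _ _)).
Qed.
End Major.

(** * Continuity of the major player's response *)

Section UniformIntegral.
Context {U : set_system nat} {UU : UltraFilter U}.
Context {d} {X : measurableType d} {R : realType}.
Variables (mu : {measure set X -> \bar R}) (D : set X).
Hypotheses (mD : measurable D) (muD : (mu D < +oo)%E).

Lemma ucvg_bint (h : nat -> X -> R) (g : X -> R) :
  (forall n, bmeas D (h n)) -> bmeas D g -> ucvg (U := U) D h g ->
  (fun n => \int[mu]_(x in D) h n x) @ U --> \int[mu]_(x in D) g x.
Proof.
move=> bh bg hg; apply/cvgrPdist_le => e e0.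
have D1 : 0 < fine (mu D) + 1 by rewrite ltr_wpDl // fine_ge0.
have e' : 0 < e / (fine (mu D) + 1) by rewrite divr_gt0.
apply: filterS (hg _ e') => n H.
rewrite distrC -bintB //.
apply: le_trans (bint_bound mD muD (bmeasB (bh n) bg) H) _.
by rewrite mulrAC ler_pdivrMr // ler_pM2l // lerDl.
Qed.
End UniformIntegral.

Section TransitionContinuity.
Context {R : realType} {T N : nat} {S : pmetricType R} {A : action_space R}.
Variable G : mmgame T N S A.
Hypotheses (hP : assumption_P G) (hR0 : assumption_R0 G).
Local Notation W := (W T N).
Local Notation Act := (@actions R A).
Variable ref : {sigma_finite_measure set (borel (ambient A)) -> \bar R}.
Hypotheses (cA : compact Act)
  (mA : measurable (Act : set (borel (ambient A))))
  (ref_gt0 : (0 < ref Act)%E) (ref_fin : (ref Act < +oo)%E).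
Variable lambda : R.
Hypothesis lambda_gt0 : 0 < lambda.
Context {U : set_system nat} {UU : UltraFilter U}.

(** The path transition probabilities under the Gibbs response, in a form which
    does not involve the control. *)
Definition transition (mu : Cmu T N S) (m : Cm T N S) t u u' : R :=
  \int[ref]_(a in Act) (P0mass G t u a (m t u) u' * major_gibbs G ref lambda mu m t u a).

Variables (mus : nat -> Cmu T N S) (ms : nat -> Cm T N S) (mu : Cmu T N S) (m : Cm T N S).
Hypothesis mus_cvg : forall t u, (fun n => mus n t u) @ U --> mu t u.
Hypothesis ms_cvg : forall t u, (fun n => ms n t u) @ U --> m t u.

Let bmeas_bounded (f : ambient A -> R) :
  bmeas (Act : set (borel (ambient A))) f -> bounded_on Act f.
Proof. by case=> _; exact: bounded_onP. Qed.

Let Qfun_ucvg vs v t u : (forall u', (fun n => vs n u') @ U --> (v u' : R)) ->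
  ucvg (U := U) Act (fun n => Qfun G (ms n) (fun=> vs n) t u) (Qfun G m (fun=> v) t u).
Proof.
move=> vsv; have [cf _ _] := hR0; apply: ucvgD.
  exact: (ucvg_tube cA (cf t (PsiG G (tnow t) u)) (@ms_cvg t u)).
apply: ucvg_sum => u'; apply: ucvgM.
- exact/bmeas_bounded/bmeas_cst.
- exact/bmeas_bounded/P0mass_bmeas.
- exact: ucvg_cst.
- exact: (ucvg_tube cA (P0mass_continuous hP (t := t) (u := u) (u' := u')) (@ms_cvg t u)).
Qed.

Let expQ_ucvg vs v t u : (forall u', (fun n => vs n u') @ U --> (v u' : R)) ->
  ucvg (U := U) Act (fun n a => expR (Qfun G (ms n) (fun=> vs n) t u a / lambda))
    (fun a => expR (Qfun G m (fun=> v) t u a / lambda)).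
Proof.
move=> vsv; have bQ := Qfun_bmeas hP hR0 cA mA m (fun=> v) t u.
apply: ucvg_exp; first by apply: bmeas_bounded; apply: bmeasM => //; exact: bmeas_cst.
apply: ucvgM; [exact: bmeas_bounded|exact/bmeas_bounded/bmeas_cst|exact: Qfun_ucvg|].
by apply: ucvg_cst; exact: cvg_cst.
Qed.

Let expQ_bmeas m' v t u : bmeas (Act : set (borel (ambient A)))
  (fun a => expR (Qfun G m' (fun=> v) t u a / lambda)).
Proof.
have bQ := Qfun_bmeas hP hR0 cA mA m' (fun=> v) t u.
by apply: bmeas_exp; apply: bmeasM => //; exact: bmeas_cst.
Qed.

Let partition_cvg vs v t u : (forall u', (fun n => vs n u') @ U --> (v u' : R)) ->
  (fun n => partition_function ref Act lambda (Qfun G (ms n) (fun=> vs n) t u)) @ U -->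
  partition_function ref Act lambda (Qfun G m (fun=> v) t u).
Proof.
move=> vsv; apply: ucvg_bint => //; exact: expQ_ucvg.
Qed.

Lemma major_value_cvg s u :
  (fun n => major_value G ref lambda (mus n) (ms n) s u) @ U -->
  major_value G ref lambda mu m s u.
Proof.
elim/backward_ind: s u => [|t IH] u.
  under eq_fun do rewrite /major_value backward_max.
  rewrite /major_value backward_max /final0.
  have [_ _ cg] := hR0.
  by apply: (@cvg_comp _ _ _ (fun n => mus n ord_max u) (g0 G _) _ _ _ (@mus_cvg _ _)); exact: cg.
under eq_fun do rewrite major_value_now.
rewrite major_value_now; apply: cvgM; first exact: cvg_cst.
have Z0 : 0 < partition_function ref Act lambda (Qfun G m (major_value G ref lambda mu m) t u).
  by apply: partition_function_gt0 => //; exact: Qfun_bmeas.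
apply: (@cvg_comp _ _ _ _ (@ln R) _ _ _ _ (continuous_ln Z0)).
exact: (@partition_cvg (fun n => major_value G ref lambda (mus n) (ms n) (tnext t))
  (major_value G ref lambda mu m (tnext t)) t u IH).
Qed.

(** The functions Q converge uniformly on the compact set of actions, hence the
    Gibbs densities do too, their partition functions staying away from 0. *)
Lemma transition_cvg t u u' :
  (fun n => transition (mus n) (ms n) t u u') @ U --> transition mu m t u u'.
Proof.
have IH := @major_value_cvg (tnext t).
pose vs n := major_value G ref lambda (mus n) (ms n) (tnext t).
have bg mu' m' : bmeas (Act : set (borel (ambient A))) (major_gibbs G ref lambda mu' m' t u).
  by apply: bmeas_gibbs; exact: Qfun_bmeas.
have Z0 : 0 < partition_function ref Act lambda (Qfun G m (major_value G ref lambda mu m) t u).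
  by apply: partition_function_gt0 => //; exact: Qfun_bmeas.
apply: ucvg_bint => //.
- by move=> n; apply: bmeasM; [exact: P0mass_bmeas|exact: bg].
- by apply: bmeasM; [exact: P0mass_bmeas|exact: bg].
- apply: ucvgM; [exact/bmeas_bounded/P0mass_bmeas|exact: bmeas_bounded| |].
    exact: (ucvg_tube cA (P0mass_continuous hP (t := t) (u := u) (u' := u')) (@ms_cvg t u)).
  apply: ucvgM; [exact/bmeas_bounded/expQ_bmeas|exact/bmeas_bounded/bmeas_cst| |].
    exact: (@expQ_ucvg vs (major_value G ref lambda mu m (tnext t)) t u IH).
  apply: ucvg_cst; apply: cvgV; first by rewrite gt_eqF.
  exact: (@partition_cvg vs (major_value G ref lambda mu m (tnext t)) t u IH).
Qed.

End TransitionContinuity.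

(** * Continuous functions on a compact metric space *)

Section RealContinuity.
Context {X : topologicalType} {R : realType}.
Implicit Types f g : X -> R.

Lemma creal_cst (c : R) : continuous (fun _ : X => c).
Proof. by move=> x; exact: cvg_cst. Qed.

Lemma crealD f g : continuous f -> continuous g -> continuous (fun x => f x + g x).
Proof. by move=> cf cg x; apply: cvgD; [exact: cf|exact: cg]. Qed.

Lemma crealM f g : continuous f -> continuous g -> continuous (fun x => f x * g x).
Proof. by move=> cf cg x; apply: cvgM; [exact: cf|exact: cg]. Qed.

Lemma crealB f g : continuous f -> continuous g -> continuous (fun x => f x - g x).
Proof. by move=> cf cg x; apply: cvgB; [exact: cf|exact: cg]. Qed.

Lemma creal_max f g : continuous f -> continuous g ->
  continuous (fun x => Num.max (f x) (g x)).
Proof. exact: max_fun_continuous. Qed.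

Lemma creal_sum (I : Type) (r : seq I) (P : pred I) (F : I -> X -> R) :
  (forall i, continuous (F i)) -> continuous (fun x => \sum_(i <- r | P i) F i x).
Proof.
move=> cF; elim: r => [|i r IH].
  by under eq_fun do rewrite big_nil; exact: creal_cst.
case Pi: (P i); under eq_fun do rewrite big_cons Pi; last exact: IH.
by apply: crealD; [exact: cF|exact: IH].
Qed.
End RealContinuity.

Section CompactMetric.
Context {R : realType} {S : pmetricType R}.
Hypothesis compactS : compact [set: S].

Lemma mdist_continuous (y : S) : continuous (fun x => mdist x y : R).
Proof. by apply: lipschitz1_continuous => x x'; rewrite addrC; exact: metric_triangle. Qed.

Lemma finite_net (e : R) : 0 < e ->
  exists (I : finType) (y : I -> S), forall x, exists i, mdist x (y i) < e.
Proof.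
move=> e0; move: compactS; rewrite compact_cover => cS.
pose ballf (y : S) := [set x : S | mdist x y < e].
have oball y : open (ballf y).
  apply: (@open_comp _ _ (fun x => mdist x y) [set r | r < e]) => //.
  by move=> x _; exact: mdist_continuous.
have [D _ HD] := cS S [set: S] ballf (fun y _ => oball y)
  (fun x _ => ex_intro2 _ _ x Logic.I (eq_ind_r (fun z => z < e) e0 (mdistxx x))).
exists (seq_sub (finmap.enum_fset D)), (@ssval _ _) => x.
by have [y /= yD xy] := HD x Logic.I; exists (SeqSub yD).
Qed.

(** Normalised tents max(0, e - d(x, y i)) around the points of a finite e-net. *)
Lemma partition_of_unity (e : R) : 0 < e ->
  exists (I : finType) (y : I -> S) (theta : I -> S -> R),
  [/\ forall i, continuous (theta i), forall i x, 0 <= theta i x,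
      forall x, \sum_i theta i x = 1 & forall i x, 0 < theta i x -> mdist x (y i) < e].
Proof.
move=> /finite_net[I [y Hy]].
pose b i x := Num.max 0 (e - mdist x (y i)).
pose s x := \sum_i b i x.
have b0 i x : 0 <= b i x by rewrite le_max lexx.
have bc i : continuous (b i).
  apply: creal_max; first exact: creal_cst.
  by apply: crealB; [exact: creal_cst|exact: mdist_continuous].
have s0 x : 0 < s x.
  have [i xi] := Hy x; rewrite /s (bigD1 i) //= ltr_wpDr ?sumr_ge0 //.
  by rewrite lt_max subr_gt0 xi orbT.
exists I, y, (fun i x => b i x / s x); split=> [i|i x|x|i x].
- move=> x; apply: cvgM; first exact: bc.
  by apply: cvgV; [rewrite gt_eqF|exact: creal_sum].
- by rewrite divr_ge0 // ltW.
- by rewrite -mulr_suml -/(s x) divff // lt0r_neq0.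
- by rewrite pmulr_lgt0 ?invr_gt0 // lt_max ltxx subr_gt0.
Qed.

(** Heine's theorem, along the radii 1/(n+1). *)
Lemma uniformly_continuous (h : S -> R) (e : R) : continuous h -> 0 < e ->
  \forall n \near \oo, forall x y, mdist x y < n.+1%:R^-1 -> `|h x - h y| <= e.
Proof.
move=> ch e0; have e2 : 0 < e / 2 by rewrite divr_gt0.
pose P (n : nat) x := forall y, mdist x y < n.+1%:R^-1 -> `|h x - h y| <= e.
suff /((compact_near_coveringP [set: S]).1 compactS nat \oo P _) :
    forall x, [set: S] x -> \forall x' \near x & n \near \oo, P n x'.
  by apply: filterS => n Hn x y; exact: Hn.
move=> x _; have /cvgrPdist_le/(_ _ e2) := ch x.
move=> /nbhs_ballP[r /= r0]; rewrite ballEmdist => rh.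
have r2 : 0 < r / 2 by rewrite divr_gt0.
exists ([set x' | mdist x x' < r / 2], [set n | n.+1%:R^-1 < r / 2]).
  split=> /=; first by have := nbhsx_ballx x _ r2; rewrite ballEmdist.
  have := @cvg_harmonic R; move=> /cvgrPdist_lt/(_ _ r2); apply: filterS => n.
  by rewrite /= sub0r normrN ger0_norm.
move=> [x' n] /= [xx' nr] y x'y.
have rr : r / 2 < r by lra.
have h1 := rh x' (lt_trans xx' rr).
have xy : mdist x y < r.
  rewrite (le_lt_trans (metric_triangle x x' y)) // [r]splitr ltrD //.
  exact: lt_trans x'y nr.
have h2 := rh y xy.
rewrite -(subrKA (h x)) [e]splitr (le_trans (ler_normD _ _)) // lerD //.
by rewrite distrC.
Qed.
End CompactMetric.

(** * Operations on subprobabilities *)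

Section Integrals.
Context {R : realType} {S : pmetricType R}.
Hypothesis compactS : compact [set: S].
Implicit Types (nu : Psub R S) (f g : S -> R).

(** The sigma-algebra of S cannot be inferred from the type Psub R S; sint and
    pint fix it once and for all. *)
Definition sint nu f : R := \int[nu : subprobability (borel S) R]_x f x.

Definition pint (nu : Prob R S) f : R := \int[nu : probability (borel S) R]_x f x.

Let cb f : continuous f -> bmeas [set: borel S] f := @compact_bmeas R S compactS f.

Lemma sintD nu f g : continuous f -> continuous g ->
  sint nu (fun x => f x + g x) = sint nu f + sint nu g.
Proof. by move=> cf cg; rewrite /sint bintD //; [exact: subprobability_fin|exact: cb|exact: cb]. Qed.

Lemma sintB nu f g : continuous f -> continuous g ->
  sint nu (fun x => f x - g x) = sint nu f - sint nu g.
Proof. by move=> cf cg; rewrite /sint bintB //; [exact: subprobability_fin|exact: cb|exact: cb]. Qed.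

Lemma sintZ nu c f : continuous f -> sint nu (fun x => c * f x) = c * sint nu f.
Proof. by move=> cf; rewrite /sint bintZ //; [exact: subprobability_fin|exact: cb]. Qed.

Lemma sint_sum nu (I : Type) (r : seq I) (P : pred I) (F : I -> S -> R) :
  (forall i, continuous (F i)) ->
  sint nu (fun x => \sum_(i <- r | P i) F i x) = \sum_(i <- r | P i) sint nu (F i).
Proof.
move=> cF; rewrite /sint (bint_sum (mu := (nu : subprobability (borel S) R)) measurableT) //.
  exact: subprobability_fin.
by move=> i; exact: cb.
Qed.

Lemma sint_ge0 nu f : (forall x, 0 <= f x) -> 0 <= sint nu f.
Proof. by move=> f0; apply: Rintegral_ge0. Qed.

Lemma le_sint nu f g : continuous f -> continuous g -> (forall x, f x <= g x) ->
  sint nu f <= sint nu g.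
Proof.
move=> cf cg fg; apply: le_bint => //; [exact: subprobability_fin|exact: cb|exact: cb].
Qed.

Lemma sint_1 nu : sint nu (fun=> 1) <= 1.
Proof. by rewrite /sint Rintegral_cst // mul1r; exact: subprob_fine_le1. Qed.

Lemma sint_0 nu : sint nu (fun=> 0) = 0.
Proof. by rewrite /sint Rintegral_cst // mul0r. Qed.

Lemma pintD (nu : Prob R S) f g : continuous f -> continuous g ->
  pint nu (fun x => f x + g x) = pint nu f + pint nu g.
Proof. by move=> cf cg; rewrite /pint bintD //; [exact: prob_fin|exact: cb|exact: cb]. Qed.

Lemma pintZ (nu : Prob R S) c f : continuous f -> pint nu (fun x => c * f x) = c * pint nu f.
Proof. by move=> cf; rewrite /pint bintZ //; [exact: prob_fin|exact: cb]. Qed.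

Lemma pint_cst (nu : Prob R S) c : pint nu (fun=> c) = c.
Proof. exact: prob_Rintegral_cst. Qed.

Lemma pint_ge0 (nu : Prob R S) f : (forall x, 0 <= f x) -> 0 <= pint nu f.
Proof. by move=> f0; apply: Rintegral_ge0. Qed.

Lemma pint_dist (nu : Prob R S) f g e : continuous f -> continuous g ->
  (forall x, `|f x - g x| <= e) -> `|pint nu f - pint nu g| <= e.
Proof.
move=> cf cg fg.
have e_ge0 : 0 <= e by apply: le_trans (fg point).
rewrite /pint -bintB //; [|exact: prob_fin|exact: cb|exact: cb].
apply: le_trans (bint_bound measurableT (prob_fin _) (bmeasB (cb cf) (cb cg)) (fun x _ => fg x)) _.
have -> : fine ((nu : probability (borel S) R) setT) = 1.
  exact: (congr1 fine (probability_setT _)).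
by rewrite mulr1.
Qed.

(** The measure with density h, constructed from its integrals. *)
Lemma cut_exists nu (h : S -> R) : continuous h -> (forall x, 0 <= h x <= 1) ->
  exists nu', forall f, continuous f -> sint nu' f = sint nu (fun x => f x * h x).
Proof.
move=> ch h01; apply: (riesz_subprobability compactS).
- move=> a f g cf cg; rewrite -sintZ; last exact: crealM.
  rewrite -sintD; [|apply: crealM => //; [exact: creal_cst|exact: crealM]|exact: crealM].
  by congr sint; apply/funext => x; ring.
- by move=> f cf f0; apply: sint_ge0 => x; have /andP[h0 _] := h01 x; rewrite mulr_ge0.
- apply: le_trans (sint_1 nu); apply: le_sint; [|exact: creal_cst|].
    by apply: crealM => //; exact: creal_cst.
  by move=> x; have /andP[_ h1] := h01 x; rewrite mul1r.
Qed.

Lemma kernel_continuous {Y : topologicalType} (P : S * Y -> Prob R S) f :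
  continuous P -> continuous f -> continuous (fun p => pint (P p) f).
Proof.
move=> cP cf p; apply: (@continuous_comp _ _ _ P (fun nu : Prob R S => pint nu f)).
  exact: cP.
exact: (Rintegral_prob_continuous compactS).
Qed.

Lemma push_exists nu (P : S -> Prob R S) :
  (forall f, continuous f -> continuous (fun x => pint (P x) f)) ->
  exists nu', forall f, continuous f -> sint nu' f = sint nu (fun x => pint (P x) f).
Proof.
move=> cP; apply: (riesz_subprobability compactS).
- move=> a f g cf cg; have cf' := cP _ cf; have cg' := cP _ cg.
  rewrite -sintZ // -sintD //; last by apply: crealM => //; exact: creal_cst.
  congr sint; apply/funext => x; rewrite pintD // ?pintZ //.
  by apply: crealM => //; exact: creal_cst.
- by move=> f cf f0; apply: sint_ge0 => x; exact: pint_ge0.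
- apply: le_trans (sint_1 nu); suff -> : (fun x => pint (P x) (fun=> 1)) = fun=> 1 by [].
  by apply/funext => x; exact: pint_cst.
Qed.

End Integrals.

Section StatePath.
Context {R : realType} {S : pmetricType R} {T N : nat}.
Hypothesis compactS : compact [set: S].
Local Notation W := (W T N).
Local Notation SW := ((S * W)%type : Type).

Lemma state_path_bmeas (f : SW -> R) : continuous f -> bmeas [set: borel SW] f.
Proof.
move=> cf; split; first exact: continuous_measurable.
have /choice[M HM] : forall u : W, exists M : R, forall x, `|f (x, u)| <= M.
  move=> u; have [M _ HM] := compact_bounded_on compactS (slice_continuous (y := u) cf).
  by exists M => x; exact: HM.
exists (\sum_u `|M u|) => -[x u] _; apply: le_trans (HM u x) _.
rewrite (bigD1 u) //= -[leLHS]addr0 lerD ?ler_norm //; exact: sumr_ge0.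
Qed.

Lemma state_path_continuous1 (f : S -> R) (u : W) : continuous f ->
  continuous (fun q : SW => f q.1 * (q.2 == u)%:R).
Proof.
move=> cf; apply: state_path_continuous => u' /=.
by apply: crealM => //; exact: creal_cst.
Qed.

Lemma path_slice_measurable (B : set W) :
  measurable ([set q : S * W | B q.2] : set (borel SW)).
Proof.
apply: borel_open; rewrite openE => -[x u] /= Bu.
exists (setT, [set u]); first by split; [exact: filterT|exact: path_discrete].
by move=> [x' u'] [_ /= ->].
Qed.

Variable m0 : Prob R SW.
Local Notation nu0 := (m0 : probability (borel SW) R).

Definition path_mass (u : W) : R := fine (nu0 [set q : S * W | q.2 = u]).

Lemma path_massE u : path_mass u = \int[nu0]_q (q.2 == u)%:R.
Proof.
apply: indicator_Rintegral => [|q]; first exact: (path_slice_measurable [set u]).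
rewrite indicE; congr (_%:R); apply: congr1.
by apply/eqP/idP => [qu|/set_mem //]; exact/mem_set.
Qed.

Lemma path_mass_ge0 u : 0 <= path_mass u.
Proof. by rewrite fine_ge0. Qed.

Lemma init_integral_bound (f : S -> R) u M : continuous f -> (forall x, `|f x| <= M) ->
  `|\int[nu0]_q (f q.1 * (q.2 == u)%:R)| <= M * path_mass u.
Proof.
move=> cf fM.
have c1 : continuous (fun q : SW => (q.2 == u)%:R : R).
  apply: state_path_continuous => u' /=; exact: creal_cst.
have b1 := state_path_bmeas c1.
have bf := state_path_bmeas (state_path_continuous1 (u := u) cf).
have H q : - (M * (q.2 == u)%:R) <= f q.1 * (q.2 == u)%:R <= M * (q.2 == u)%:R.
  rewrite -ler_norml normrM ler_pM // ?fM //.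
  by rewrite ger0_norm // ler0n.
have bM := bmeasZ M b1.
rewrite path_massE -(bintZ measurableT (prob_fin _) _ b1).
rewrite ler_norml -[X in X <= _ <= _]mulN1r -(bintZ measurableT (prob_fin _) _ bM).
apply/andP; split.
  apply: (le_bint measurableT (prob_fin _) (bmeasZ (-1) bM) bf) => q _.
  by rewrite mulN1r; have /andP[] := H q.
by apply: (le_bint measurableT (prob_fin _) bf bM) => q _; have /andP[] := H q.
Qed.

(** The conditional law of the initial state given the path u; it is the zero
    measure when u has probability 0, since then the inverse is 0. *)
Lemma init_exists u : exists nu : Psub R S, forall f, continuous f ->
  sint nu f = (path_mass u)^-1 * \int[nu0]_q (f q.1 * (q.2 == u)%:R).
Proof.
have bf f := fun cf => state_path_bmeas (@state_path_continuous1 f u cf).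
apply: (riesz_subprobability compactS).
- move=> a f g cf cg; rewrite mulrCA -mulrDr; congr (_ * _).
  rewrite -bintZ //; [|exact: prob_fin|exact: bf].
  rewrite -bintD //; [|exact: prob_fin|apply: bmeasZ; exact: bf|exact: bf].
  by apply: eq_Rintegral => q _; ring.
- move=> f cf f0; rewrite mulr_ge0 ?invr_ge0 ?path_mass_ge0 //.
  by apply: Rintegral_ge0 => q _; rewrite mulr_ge0.
- under eq_Rintegral do rewrite mul1r.
  rewrite -path_massE; have [->|m0u] := eqVneq (path_mass u) 0; first by rewrite mulr0.
  by rewrite mulVf.
Qed.

Lemma init_disintegration (rho : W -> Psub R S) :
  (forall u f, continuous f ->
    sint (rho u) f = (path_mass u)^-1 * \int[nu0]_q (f q.1 * (q.2 == u)%:R)) ->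
  forall phi : SW -> R, continuous phi ->
  \int[nu0]_q phi q = \sum_u path_mass u * sint (rho u) (fun x => phi (x, u)).
Proof.
move=> Hrho phi cphi.
have cs u := slice_continuous (y := u) cphi.
have -> : \int[nu0]_q phi q = \int[nu0]_q (\sum_u phi (q.1, u) * (q.2 == u)%:R).
  apply: eq_Rintegral => -[x u] _ /=; rewrite (bigD1 u) //= eqxx mulr1 big1 ?addr0 //.
  by move=> u' /negbTE; rewrite eq_sym => ->; rewrite mulr0.
rewrite (bint_sum (mu := nu0) measurableT (prob_fin _) (index_enum _) xpredT
  (F := fun u (q : borel SW) => phi (q.1, u) * (q.2 == u)%:R)); last first.
  by move=> u; exact: (state_path_bmeas (state_path_continuous1 (u := u) (cs u))).
apply: eq_bigr => u _; rewrite Hrho; last exact: cs.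
have [p0|p0] := eqVneq (path_mass u) 0; last by rewrite mulVKf.
have [M M0 HM] := compact_bounded_on compactS (cs u).
have := init_integral_bound u (cs u) (fun x => HM x Logic.I).
by rewrite p0 mulr0 mul0r normr_le0 => /eqP.
Qed.

End StatePath.

(** * The minor player's rewards *)

Section Equilibrium.
Context {R : realType} {T N : nat} {S : pmetricType R} {A : action_space R}.
Variable G : mmgame T N S A.
Hypotheses (compactS : compact [set: S]) (hP : assumption_P G) (hR0 : assumption_R0 G)
  (hR1 : assumption_R1 G).
Local Notation W := (W T N).
Local Notation Act := (@actions R A).
Variable ref : {sigma_finite_measure set (borel (ambient A)) -> \bar R}.
Hypotheses (cA : compact Act)
  (mA : measurable (Act : set (borel (ambient A))))
  (ref_gt0 : (0 < ref Act)%E) (ref_fin : (ref Act < +oo)%E).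
Variable lambda : R.
Hypothesis lambda_gt0 : 0 < lambda.
Context {U : set_system nat} {UU : UltraFilter U}.

Local Notation uc := (ucvg (U := U) [set: S]).
Local Notation trans := (transition G ref lambda).

Lemma P1_continuous t u f : continuous f ->
  continuous (fun p : S * Psub R S => pint (P1 G t p.1 u p.2) f).
Proof. by move=> cf; apply: kernel_continuous => //; have [_ _] := hP; apply. Qed.

Lemma P1_slice_continuous t u eta f : continuous f ->
  continuous (fun x => pint (P1 G t x u eta) f).
Proof.
by move=> cf; exact: (@slice_continuous _ _ _ (fun p => pint (P1 G t p.1 u p.2) f) eta (P1_continuous cf)).
Qed.

Lemma state_ucvg (Y : topologicalType) (H : S * Y -> R) (y : nat -> Y) (l : Y) :
  continuous H -> y @ U --> l -> uc (fun n x => H (x, y n)) (fun x => H (x, l)).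
Proof.
move=> cH yl; apply: ucvg_tube => //.
by rewrite setXTT; exact: continuous_subspaceT.
Qed.

(** Integrands vary uniformly and kernels weakly: the former is controlled by
    the sup norm, the latter by the tube lemma. *)
Lemma pint_ucvg t u (w : nat -> S -> R) (w0 : S -> R) (eta : nat -> Psub R S) (eta0 : Psub R S) :
  (forall n, continuous (w n)) -> continuous w0 -> uc w w0 -> eta @ U --> eta0 ->
  uc (fun n x => pint (P1 G t x u (eta n)) (w n)) (fun x => pint (P1 G t x u eta0) w0).
Proof.
move=> cw cw0 ww0 eta_cvg e e0; have e2 : 0 < e / 2 by rewrite divr_gt0.
apply: filterS2 (ww0 _ e2) (state_ucvg (P1_continuous (t := t) (u := u) cw0) eta_cvg e2) => n H1 H2 x _.
rewrite -(subrKA (pint (P1 G t x u (eta n)) w0)) [e]splitr (le_trans (ler_normD _ _)) // lerD //.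
  by apply: pint_dist => // y; exact: H1.
exact: H2.
Qed.

(** The reward of going on at time t for one step when v is the value at time t
    + 1. *)
Definition continuation (mu : Cmu T N S) (m : Cm T N S) (t : 'I_T) (v : W -> S -> R)
    (u : W) (x : S) : R :=
  f1 G t x u (m t u) + \sum_u' trans mu m t u u' * pint (P1 G t x u (m t u)) (v u').

Definition stop_reward (mu : Cmu T N S) (s : 'I_T.+1) (u : W) (x : S) : R :=
  g1 G s x u (mu s u).

Definition minor_value (mu : Cmu T N S) (m : Cm T N S) : 'I_T.+1 -> W -> S -> R :=
  backward (stop_reward mu ord_max)
    (fun t v u x => Num.max (stop_reward mu (tnow t) u x) (continuation mu m t v u x)).

Definition continue_reward (mu : Cmu T N S) (m : Cm T N S) (t : 'I_T) : W -> S -> R :=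
  continuation mu m t (minor_value mu m (tnext t)).

Lemma minor_value_max mu m : minor_value mu m ord_max = stop_reward mu ord_max.
Proof. exact: backward_max. Qed.

Lemma minor_value_now mu m t u x : minor_value mu m (tnow t) u x =
  Num.max (stop_reward mu (tnow t) u x) (continue_reward mu m t u x).
Proof. by rewrite {1}/minor_value backward_now. Qed.

Lemma stop_reward_continuous mu s u : continuous (stop_reward mu s u).
Proof.
have [_ cg] := hR1 u.
exact: (@slice_continuous _ _ _ (fun p => g1 G s p.1 u p.2) (mu s u) (cg s)).
Qed.

Lemma continuation_continuous mu m t v u : (forall u', continuous (v u')) ->
  continuous (continuation mu m t v u).
Proof.
move=> cv; have [cf _] := hR1 u; apply: crealD.
  exact: (@slice_continuous _ _ _ (fun p => f1 G t p.1 u p.2) (m t u) (cf t)).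
apply: creal_sum => u'; apply: crealM; first exact: creal_cst.
exact: P1_slice_continuous.
Qed.

Lemma minor_value_continuous mu m s u : continuous (minor_value mu m s u).
Proof.
elim/backward_ind: s u => [|t IH] u.
  by rewrite minor_value_max; exact: stop_reward_continuous.
have -> : minor_value mu m (tnow t) u = fun x =>
    Num.max (stop_reward mu (tnow t) u x) (continue_reward mu m t u x).
  by apply/funext => x; exact: minor_value_now.
apply: creal_max; first exact: stop_reward_continuous.
exact: continuation_continuous.
Qed.

Lemma continue_reward_continuous mu m t u : continuous (continue_reward mu m t u).
Proof. by apply: continuation_continuous => u'; exact: minor_value_continuous. Qed.

Section Convergence.
Variables (mus : nat -> Cmu T N S) (ms : nat -> Cm T N S) (mu : Cmu T N S) (m : Cm T N S).
Hypothesis mus_cvg : forall t u, (fun n => mus n t u) @ U --> mu t u.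
Hypothesis ms_cvg : forall t u, (fun n => ms n t u) @ U --> m t u.

Lemma stop_reward_ucvg s u : uc (fun n => stop_reward (mus n) s u) (stop_reward mu s u).
Proof.
have [_ cg] := hR1 u.
exact: (@state_ucvg _ (fun p => g1 G s p.1 u p.2) _ _ (cg s) (@mus_cvg s u)).
Qed.

Lemma continuation_ucvg t u vs v :
  (forall n u', continuous (vs n u')) -> (forall u', continuous (v u')) ->
  (forall u', uc (fun n => vs n u') (v u')) ->
  uc (fun n => continuation (mus n) (ms n) t (vs n) u) (continuation mu m t v u).
Proof.
move=> cvs cv vsv; have [cf _] := hR1 u; apply: ucvgD.
  exact: (@state_ucvg _ (fun p => f1 G t p.1 u p.2) _ _ (cf t) (@ms_cvg t u)).
apply: ucvg_sum => u'; apply: ucvgM.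
- exact/(compact_bounded_on compactS)/creal_cst.
- apply: (compact_bounded_on compactS); exact: P1_slice_continuous.
- by apply: ucvg_cst; exact: transition_cvg.
- by apply: pint_ucvg.
Qed.

Lemma minor_value_ucvg s u :
  uc (fun n => minor_value (mus n) (ms n) s u) (minor_value mu m s u).
Proof.
elim/backward_ind: s u => [|t IH] u.
  under eq_fun do rewrite minor_value_max.
  by rewrite minor_value_max; exact: stop_reward_ucvg.
move=> e e0.
have cu := @continuation_ucvg t u _ _
  (fun n u' => @minor_value_continuous (mus n) (ms n) (tnext t) u')
  (fun u' => @minor_value_continuous mu m (tnext t) u') IH.
apply: filterS (ucvg_max (@stop_reward_ucvg (tnow t) u) cu e0) => n Hn x Dx.
by rewrite !minor_value_now; exact: Hn.
Qed.

Lemma continue_reward_ucvg t u :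
  uc (fun n => continue_reward (mus n) (ms n) t u) (continue_reward mu m t u).
Proof.
exact: (@continuation_ucvg t u _ _ (fun n u' => @minor_value_continuous (mus n) (ms n) (tnext t) u')
  (fun u' => @minor_value_continuous mu m (tnext t) u') (@minor_value_ucvg (tnext t))).
Qed.

End Convergence.
End Equilibrium.

(** * Flows driven by a stopping rule *)

Section StoppingFlow.
Context {R : realType} {T N : nat} {S : pmetricType R}.
Hypothesis compactS : compact [set: S].
Local Notation W := (W T N).
Variable P : 'I_T -> S -> W -> Psub R S -> Prob R S.
Hypothesis P_continuous : forall t u, continuous (fun p : S * Psub R S => P t p.1 u p.2).
Variables (parent : 'I_T -> W -> W) (rho0 : W -> Psub R S).
Context {U : set_system nat} {UU : UltraFilter U}.
Local Notation uc := (ucvg (U := U) [set: S]).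

Definition unit_valued (h : S -> R) := forall x, 0 <= h x <= 1.

Section Flow.
Variables (cut : (S -> R) -> Psub R S -> Psub R S) (push : 'I_T -> W -> Psub R S -> Psub R S).
Hypothesis cutE : forall h nu, continuous h -> unit_valued h ->
  forall f, continuous f -> sint (cut h nu) f = sint nu (fun x => f x * h x).
Hypothesis pushE : forall t u nu f, continuous f ->
  sint (push t u nu) f = sint nu (fun x => pint (P t x u nu) f).

(** Conditional law, given the path, of the state of a minor player who has not
    stopped before time s. The probabilities of the steps of the path cancel in
    the conditioning, so that only the minor kernel enters. *)
Definition flow (sigma : 'I_T -> W -> S -> R) : 'I_T.+1 -> W -> Psub R S :=
  forward rho0 (fun t rho u' =>
    push t (parent t u') (cut (fun x => 1 - sigma t (parent t u') x) (rho (parent t u')))).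

Definition flow_m sigma : Cm T N S :=
  fun t u => cut (fun x => 1 - sigma t u x) (flow sigma (tnow t) u).

(** At the final time everybody stops. *)
Definition flow_mu sigma : Cmu T N S :=
  fun s u => if insub (s : nat) is Some t then cut (sigma t u) (flow sigma s u)
             else flow sigma s u.

Definition stopping_rule (sigma : 'I_T -> W -> S -> R) :=
  forall t u, continuous (sigma t u) /\ unit_valued (sigma t u).

Lemma flow_mu_now sigma t u : flow_mu sigma (tnow t) u = cut (sigma t u) (flow sigma (tnow t) u).
Proof. by rewrite /flow_mu /= valK. Qed.

Lemma flow_mu_max sigma u : flow_mu sigma ord_max u = flow sigma ord_max u.
Proof. by rewrite /flow_mu insubF //= ltnn. Qed.

Lemma flow_next sigma t u' : flow sigma (tnext t) u' =
  push t (parent t u') (flow_m sigma t (parent t u')).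
Proof. by rewrite /flow forward_next. Qed.

Lemma continue_continuous sigma t u : stopping_rule sigma ->
  continuous (fun x => 1 - sigma t u x) /\ unit_valued (fun x => 1 - sigma t u x).
Proof.
move=> /(_ t u)[cs s01]; split; first by apply: crealB => //; exact: creal_cst.
by move=> x; have := s01 x; lra.
Qed.

Lemma flow_split sigma t u f : stopping_rule sigma -> continuous f ->
  sint (flow_mu sigma (tnow t) u) f + sint (flow_m sigma t u) f = sint (flow sigma (tnow t) u) f.
Proof.
move=> sr cf; have [cs s01] := sr t u; have [cs' s01'] := continue_continuous t u sr.
rewrite flow_mu_now !cutE // -sintD //; [|exact: crealM|exact: crealM].
by congr sint; apply/funext => x; ring.
Qed.

Lemma cut_cvg nus nu hs h : (forall n, continuous (hs n) /\ unit_valued (hs n)) ->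
  continuous h -> unit_valued h -> nus @ U --> nu -> uc hs h ->
  (fun n => cut (hs n) (nus n)) @ U --> cut h nu.
Proof.
move=> hs1 ch h1 nucvg hcvg; apply: psub_cvg => f cf.
change ((fun n => sint (cut (hs n) (nus n)) f) @ U --> sint (cut h nu) f).
have -> : (fun n => sint (cut (hs n) (nus n)) f) = fun n => sint (nus n) (fun x => f x * hs n x).
  by apply/funext => n; have [? ?] := hs1 n; rewrite cutE.
rewrite cutE //.
apply: (psub_ucvg compactS nucvg).
- by move=> n; apply: crealM => //; exact: (hs1 n).1.
- exact: crealM.
- apply: ucvgM => //; [exact: compact_bounded_on|exact: compact_bounded_on|exact: ucvg_same].
Qed.

Lemma push_cvg t u nus nu : nus @ U --> nu ->
  (fun n => push t u (nus n)) @ U --> push t u nu.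
Proof.
move=> nucvg; apply: psub_cvg => f cf.
change ((fun n => sint (push t u (nus n)) f) @ U --> sint (push t u nu) f).
rewrite pushE //; under eq_fun do rewrite pushE //.
have ck := @kernel_continuous _ _ compactS _ _ f (@P_continuous t u) cf.
apply: (psub_ucvg compactS nucvg).
- by move=> n; exact: (@slice_continuous _ _ _ _ (nus n) ck).
- exact: (@slice_continuous _ _ _ _ nu ck).
- exact: (@state_ucvg _ _ compactS _ _ _ (fun p => pint (P t p.1 u p.2) f)).
Qed.

Section Convergence.
Variables (sigmas : nat -> 'I_T -> W -> S -> R) (sigma : 'I_T -> W -> S -> R).
Hypotheses (srs : forall n, stopping_rule (sigmas n)) (sr : stopping_rule sigma).
Hypothesis sigma_cvg : forall t u, uc (fun n => sigmas n t u) (sigma t u).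

Lemma continue_ucvg t u : uc (fun n x => 1 - sigmas n t u x) (fun x => 1 - sigma t u x).
Proof.
move=> e e0; apply: filterS (sigma_cvg t u e0) => n Hn x Dx.
by have := Hn x Dx; rewrite distrC => H; rewrite (_ : _ - _ = sigma t u x - sigmas n t u x) //; ring.
Qed.

Lemma flow_m_cvg_of t u : (fun n => flow (sigmas n) (tnow t) u) @ U --> flow sigma (tnow t) u ->
  (fun n => flow_m (sigmas n) t u) @ U --> flow_m sigma t u.
Proof.
move=> H; have [cs s01] := continue_continuous t u sr.
apply: cut_cvg => // [n|]; first exact: continue_continuous.
exact: continue_ucvg.
Qed.

Lemma flow_cvg s u : (fun n => flow (sigmas n) s u) @ U --> flow sigma s u.
Proof.
elim/forward_ind: s u => [|t IH] u; first exact: cvg_cst.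
rewrite flow_next; under eq_fun do rewrite flow_next.
exact/push_cvg/flow_m_cvg_of/IH.
Qed.

Lemma flow_m_cvg t u : (fun n => flow_m (sigmas n) t u) @ U --> flow_m sigma t u.
Proof. exact: (flow_m_cvg_of (@flow_cvg (tnow t) u)). Qed.

Lemma flow_mu_cvg s u : (fun n => flow_mu (sigmas n) s u) @ U --> flow_mu sigma s u.
Proof.
have H := @flow_cvg s u.
rewrite /flow_mu; case: (insub (s : nat)) => [t|] //.
have [cs s01] := sr t u; apply: cut_cvg => // n; exact: srs.
Qed.
End Convergence.

End Flow.
End StoppingFlow.

(** * Approximate equilibrium rules *)

Section ApproximateStopping.
Context {R : realType} {T N : nat} {S : pmetricType R}.
Hypothesis compactS : compact [set: S].
Local Notation W := (W T N).
Variable P : 'I_T -> S -> W -> Psub R S -> Prob R S.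
Hypothesis P_continuous : forall t u, continuous (fun p : S * Psub R S => P t p.1 u p.2).
Variables (parent : 'I_T -> W -> W) (rho0 : W -> Psub R S).
Context {U : set_system nat} {UU : UltraFilter U}.
Hypothesis leU : \oo `<=` U.
Local Notation uc := (ucvg (U := U) [set: S]).

Variables (g : Cmu T N S -> 'I_T.+1 -> W -> S -> R)
  (c : Cmu T N S -> Cm T N S -> 'I_T -> W -> S -> R).
Hypothesis reward_ucvg : forall (mus : nat -> Cmu T N S) (ms : nat -> Cm T N S) mu m,
  (forall t u, (fun n => mus n t u) @ U --> mu t u) ->
  (forall t u, (fun n => ms n t u) @ U --> m t u) ->
  (forall s u, uc (fun n => g (mus n) s u) (g mu s u)) /\
  (forall t u, uc (fun n => c (mus n) (ms n) t u) (c mu m t u)).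

Section Flow.
Variables (cut : (S -> R) -> Psub R S -> Psub R S) (push : 'I_T -> W -> Psub R S -> Psub R S).
Hypothesis cutE : forall h nu, continuous h -> unit_valued h ->
  forall f, continuous f -> sint (cut h nu) f = sint nu (fun x => f x * h x).
Hypothesis pushE : forall t u nu f, continuous f ->
  sint (push t u nu) f = sint nu (fun x => pint (P t x u nu) f).

Local Notation fmu := (flow_mu parent rho0 cut push).
Local Notation fm := (flow_m parent rho0 cut push).

(** The gain from stopping rather than continuing, when the population follows
    sigma. *)
Definition advantage sigma t u x : R :=
  g (fmu sigma) (tnow t) u x - c (fmu sigma) (fm sigma) t u x.

Lemma advantage_cvg sigmas sigma t u x :
  (forall n, stopping_rule (sigmas n)) -> stopping_rule sigma ->
  (forall t u, uc (fun n => sigmas n t u) (sigma t u)) ->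
  (fun n => advantage (sigmas n) t u x) @ U --> advantage sigma t u x.
Proof.
move=> srs sr sigma_cvg.
have [Hg Hc] := reward_ucvg
  (flow_mu_cvg compactS P_continuous (parent := parent) (rho0 := rho0) cutE pushE srs sr sigma_cvg)
  (flow_m_cvg compactS P_continuous (parent := parent) (rho0 := rho0) cutE pushE srs sr sigma_cvg).
by apply: cvgB; [exact: (ucvg_cvg (D := setT) I (Hg _ _))|exact: (ucvg_cvg (D := setT) I (Hc _ _))].
Qed.

(** Complementarity on the cube equilibrates the advantage at the nodes y i of
    a partition of unity of mesh e. If sigma(x) > 0, some theta_i(x) > 0 has a
    coefficient s_i > 0, and then y i is within e of x; likewise for 1 - sigma. *)
Lemma approximate_rule (e : R) : 0 < e -> exists2 sigma, stopping_rule sigma &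
  forall t u x,
    (0 < sigma t u x -> exists2 y, mdist x y < e & - advantage sigma t u y <= 0) /\
    (0 < 1 - sigma t u x -> exists2 y, mdist x y < e & advantage sigma t u y <= 0).
Proof.
move=> e0; have [I [y [theta [ctheta theta0 theta1 theta_near]]]] := partition_of_unity compactS e0.
pose sig (s : 'I_T * W * I -> R) : 'I_T -> W -> S -> R :=
  fun t u x => \sum_i s (t, u, i) * theta i x.
have sig_sr s : (forall k, 0 <= s k <= 1) -> stopping_rule (sig s).
  move=> s01 t u; split.
    by apply: creal_sum => i; apply: crealM => //; exact: creal_cst.
  move=> x; apply/andP; split.
    by apply: sumr_ge0 => i _; rewrite mulr_ge0 //; case/andP: (s01 (t, u, i)).
  rewrite -(theta1 x); apply: ler_sum => i _.
  by rewrite ler_piMl //; case/andP: (s01 (t, u, i)).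
have [|s s01 Hs] := cube_complementarity leU
    (F := fun s k => advantage (sig s) k.1.1 k.1.2 (y k.2)).
  move=> s l s01 l01 sl k; apply: advantage_cvg => [n||t u]; [exact: sig_sr|exact: sig_sr|].
  apply: ucvg_sum => i; apply: ucvgM.
  - exact/(compact_bounded_on compactS)/creal_cst.
  - exact: compact_bounded_on.
  - exact: ucvg_cst.
  - exact: ucvg_same.
exists (sig s) => [|t u x]; first exact: sig_sr.
split=> [sx|].
  have /existsP[i] : [exists i, (0 < s (t, u, i)) && (0 < theta i x)].
    apply: contraPT sx => /existsPn H; apply/negP; rewrite -leNgt.
    apply: sumr_le0 => i _; have /andP[s0 _] := s01 (t, u, i).
    move: (H i); rewrite negb_and -!leNgt => /orP[sle|tle].
      by rewrite mulr_le0_ge0.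
    by rewrite mulr_ge0_le0.
  move=> /andP[si ti]; exists (y i); first exact: theta_near.
  by rewrite oppr_le0; exact: (Hs (t, u, i)).2.
rewrite -(theta1 x) -sumrB => sx.
have /existsP[i] : [exists i, (s (t, u, i) < 1) && (0 < theta i x)].
  apply: contraPT sx => /existsPn H; apply/negP; rewrite -leNgt.
  apply: sumr_le0 => i _; have /andP[s0 s1] := s01 (t, u, i).
  move: (H i); rewrite negb_and -!leNgt -[X in X - _]mul1r -mulrBl => /orP[sle|tle].
    by rewrite mulr_le0_ge0 // subr_le0.
  by rewrite mulr_ge0_le0 // subr_ge0.
move=> /andP[si ti]; exists (y i); first exact: theta_near.
exact: (Hs (t, u, i)).1.
Qed.
End Flow.
End ApproximateStopping.

(** * Equilibrium flows *)

Section ExactStopping.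
Context {R : realType} {T N : nat} {S : pmetricType R}.
Hypothesis compactS : compact [set: S].
Local Notation W := (W T N).
Context {U : set_system nat} {UU : UltraFilter U}.
Hypothesis leU : \oo `<=` U.
Local Notation uc := (ucvg (U := U) [set: S]).

(** Where ks n is positive, h is at most e for large n, by the uniform
    continuity of h and the uniform convergence of hs. Thus the integral of the
    positive part of h against nus n is eventually at most e. *)
Lemma limit_complementarity (nus rhos : nat -> Psub R S) nu (ks hs : nat -> S -> R) h :
  (forall n, continuous (ks n) /\ unit_valued (ks n)) ->
  (forall n f, continuous f -> sint (nus n) f = sint (rhos n) (fun x => f x * ks n x)) ->
  nus @ U --> nu -> continuous h -> uc hs h ->
  (forall n x, 0 < ks n x -> exists2 y, mdist x y < n.+1%:R^-1 & hs n y <= 0) ->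
  sint nu (fun x => Num.max 0 (h x)) = 0.
Proof.
move=> ks1 nusE nucvg ch hcvg near_h.
have cm : continuous (fun x => Num.max 0 (h x)) by apply: creal_max => //; exact: creal_cst.
apply/eqP; rewrite eq_le; apply/andP; split; last first.
  by apply: sint_ge0 => x; rewrite le_max lexx.
apply/ler_addgt0Pl => e e0; rewrite addr0.
have e2 : 0 < e / 2 by rewrite divr_gt0.
have Ucst : (fun _ : nat => e) @ U --> e by exact: cvg_cst.
apply: (limit_le (psub_cvgE compactS nucvg cm) Ucst).
have Hu := leU (uniformly_continuous compactS ch e2).
apply: filterS2 (hcvg _ e2) Hu => n H1 H2; have [ck k1] := ks1 n.
change (sint (nus n) (fun x => Num.max 0 (h x)) <= e); rewrite nusE //.
apply: (@le_trans _ _ (sint (rhos n) (fun=> e * 1))); last first.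
  rewrite sintZ //; last exact: creal_cst.
  by apply: ler_piMr; [exact: ltW|exact: sint_1].
apply: le_sint => //; [exact: crealM|exact: creal_cst|].
move=> x; rewrite mulr1; have /andP[k0 kle1] := k1 x.
have [->|k_neq0] := eqVneq (ks n x) 0; first by rewrite mulr0 ltW.
have [|y xy hy] := near_h n x; first by rewrite lt_neqAle eq_sym k_neq0.
have := H1 y I; have := H2 x y xy; rewrite !ler_norml => /andP[_ A1] /andP[A2 _].
have hx : Num.max 0 (h x) <= e by rewrite ge_max ltW //=; lra.
by apply: le_trans hx; rewrite ler_piMr // le_max lexx.
Qed.

Variable P : 'I_T -> S -> W -> Psub R S -> Prob R S.
Hypothesis P_continuous : forall t u, continuous (fun p : S * Psub R S => P t p.1 u p.2).
Variables (parent : 'I_T -> W -> W) (rho0 : W -> Psub R S).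
Variables (g : Cmu T N S -> 'I_T.+1 -> W -> S -> R)
  (c : Cmu T N S -> Cm T N S -> 'I_T -> W -> S -> R).
Hypotheses (g_continuous : forall mu s u, continuous (g mu s u))
  (c_continuous : forall mu m t u, continuous (c mu m t u)).
Hypothesis reward_ucvg : forall (mus : nat -> Cmu T N S) (ms : nat -> Cm T N S) mu m,
  (forall t u, (fun n => mus n t u) @ U --> mu t u) ->
  (forall t u, (fun n => ms n t u) @ U --> m t u) ->
  (forall s u, uc (fun n => g (mus n) s u) (g mu s u)) /\
  (forall t u, uc (fun n => c (mus n) (ms n) t u) (c mu m t u)).

(** Limit of approximate equilibrium rules of mesh 1/(n+1). Only the flows have
    limits, so no rule is left: complementarity is expressed by the two
    integrals at the end. *)
Lemma stopping_equilibrium : exists (rho mu : Cmu T N S) (m : Cm T N S),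
  [/\ forall u f, continuous f -> sint (rho ord0 u) f = sint (rho0 u) f,
      forall t u' f, continuous f -> sint (rho (tnext t) u') f =
        sint (m t (parent t u')) (fun x => pint (P t x (parent t u') (m t (parent t u'))) f),
      (forall t u f, continuous f ->
        sint (mu (tnow t) u) f + sint (m t u) f = sint (rho (tnow t) u) f) /\
      (forall u f, continuous f -> sint (mu ord_max u) f = sint (rho ord_max u) f),
      forall t u, sint (mu (tnow t) u)
        (fun x => Num.max 0 (c mu m t u x - g mu (tnow t) u x)) = 0
    & forall t u, sint (m t u)
        (fun x => Num.max 0 (g mu (tnow t) u x - c mu m t u x)) = 0].
Proof.
have /choice[cut Hcut] : forall p : (S -> R) * Psub R S, exists nu' : Psub R S,
    continuous p.1 -> unit_valued p.1 ->
    forall f, continuous f -> sint nu' f = sint p.2 (fun x => f x * p.1 x).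
  move=> [h nu]; have [[ch h01]|H] := pselect (continuous h /\ unit_valued h).
    by have [nu' Hnu'] := cut_exists compactS nu ch h01; exists nu'.
  by exists nu => ch h01; exfalso; exact: H.
have /choice[push Hpush] : forall q : 'I_T * W * Psub R S, exists nu' : Psub R S,
    forall f, continuous f ->
      sint nu' f = sint q.2 (fun x => pint (P q.1.1 x q.1.2 q.2) f).
  move=> [[t u] nu]; apply: push_exists => // f cf.
  have ck := @kernel_continuous _ _ compactS _ _ f (@P_continuous t u) cf.
  exact: (@slice_continuous _ _ _ _ nu ck).
pose cut' h nu := cut (h, nu); pose push' t u nu := push (t, u, nu).
have cutE h nu : continuous h -> unit_valued h ->
    forall f, continuous f -> sint (cut' h nu) f = sint nu (fun x => f x * h x).
  exact: (Hcut (h, nu)).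
have pushE t u nu f : continuous f ->
    sint (push' t u nu) f = sint nu (fun x => pint (P t x u nu) f).
  exact: (Hpush (t, u, nu)).
have /choice[sig Hsig] : forall n, exists sigma, stopping_rule sigma /\
    forall t u x,
      (0 < sigma t u x -> exists2 y, mdist x y < n.+1%:R^-1
         & - advantage parent rho0 g c cut' push' sigma t u y <= 0) /\
      (0 < 1 - sigma t u x -> exists2 y, mdist x y < n.+1%:R^-1
         & advantage parent rho0 g c cut' push' sigma t u y <= 0).
  move=> n; have e0 : 0 < n.+1%:R^-1 :> R by rewrite invr_gt0.
  have [s s1 s2] := approximate_rule compactS P_continuous parent rho0 leU reward_ucvg cutE pushE e0.
  by exists s.
have srs n : stopping_rule (sig n) := (Hsig n).1.
pose rhos n := flow parent rho0 cut' push' (sig n).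
pose mus n := flow_mu parent rho0 cut' push' (sig n).
pose ms n := flow_m parent rho0 cut' push' (sig n).
have /choice[rho Hrho] : forall k : 'I_T.+1 * W, exists l : Psub R S, (fun n => rhos n k.1 k.2) @ U --> l.
  by move=> k; exact: psub_compact.
have /choice[mu Hmu] : forall k : 'I_T.+1 * W, exists l : Psub R S, (fun n => mus n k.1 k.2) @ U --> l.
  by move=> k; exact: psub_compact.
have /choice[m Hm] : forall k : 'I_T * W, exists l : Psub R S, (fun n => ms n k.1 k.2) @ U --> l.
  by move=> k; exact: psub_compact.
pose mu' s u := mu (s, u); pose m' s u := m (s, u).
have [gcvg ccvg] := reward_ucvg (mus := mus) (ms := ms) (mu := mu') (m := m')
  (fun t u => Hmu (t, u)) (fun t u => Hm (t, u)).
have rho_int s u f : continuous f ->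
  (fun n => sint (rhos n s u) f) @ U --> sint (rho (s, u)) f by exact: (psub_cvgE compactS (Hrho (s, u))).
have mu_int s u f : continuous f ->
  (fun n => sint (mus n s u) f) @ U --> sint (mu' s u) f by exact: (psub_cvgE compactS (Hmu (s, u))).
have m_int t u f : continuous f ->
  (fun n => sint (ms n t u) f) @ U --> sint (m' t u) f by exact: (psub_cvgE compactS (Hm (t, u))).
have lim_eq (a b : nat -> R) (x y : R) : a @ U --> x -> b @ U --> y -> (forall n, a n = b n) -> x = y.
  move=> ax bY ab; have E : a = b by apply/funext.
  by rewrite E in ax; apply: (cvg_unique _ ax bY).
exists (fun s u => rho (s, u)), mu', m'; split.
- move=> u f cf; apply: (lim_eq _ _ _ _ (rho_int ord0 u f cf) (cvg_cst (sint (rho0 u) f))).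
  by [].
- move=> t u' f cf; pose w := parent t u'.
  have ck := @kernel_continuous _ _ compactS _ _ f (@P_continuous t w) cf.
  have Hr : (fun n => sint (ms n t w) (fun x => pint (P t x w (ms n t w)) f)) @ U -->
      sint (m' t w) (fun x => pint (P t x w (m' t w)) f).
    apply: (psub_ucvg compactS (Hm (t, w))).
    + by move=> n; exact: (@slice_continuous _ _ _ _ (ms n t w) ck).
    + exact: (@slice_continuous _ _ _ _ (m' t w) ck).
    + exact: (@state_ucvg _ _ compactS _ _ _ (fun p => pint (P t p.1 w p.2) f) _ _ ck (Hm (t, w))).
  apply: (lim_eq _ _ _ _ (rho_int (tnext t) u' f cf) Hr) => n.
  by rewrite /rhos flow_next pushE.
- split=> [t u f cf|u f cf].
    apply: (lim_eq _ _ _ _ (cvgD (mu_int (tnow t) u f cf) (m_int t u f cf)) (rho_int (tnow t) u f cf)) => n.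
    exact: flow_split.
  apply: (lim_eq _ _ _ _ (mu_int ord_max u f cf) (rho_int ord_max u f cf)) => n.
  by rewrite /mus flow_mu_max.
- move=> t u.
  apply: (@limit_complementarity (fun n => mus n (tnow t) u) (fun n => rhos n (tnow t) u) _
    (fun n => sig n t u) (fun n x => - advantage parent rho0 g c cut' push' (sig n) t u x)).
  + by move=> n; exact: srs.
  + by move=> n f cf; rewrite /mus flow_mu_now cutE //; have [] := srs n t u.
  + exact: (Hmu (tnow t, u)).
  + exact: crealB.
  + move=> e e0; have e2 : 0 < e / 2 by rewrite divr_gt0.
    apply: filterS2 (gcvg (tnow t) u _ e2) (ccvg t u _ e2) => n H1 H2 x Dx.
    have := H1 x Dx; have := H2 x Dx; rewrite /advantage !ler_norml => /andP[? ?] /andP[? ?].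
    by rewrite -/(mus n) -/(ms n); lra.
  + by move=> n x; exact: ((Hsig n).2 t u x).1.
- move=> t u.
  apply: (@limit_complementarity (fun n => ms n t u) (fun n => rhos n (tnow t) u) _
    (fun n x => 1 - sig n t u x) (fun n x => advantage parent rho0 g c cut' push' (sig n) t u x)).
  + by move=> n; exact: continue_continuous.
  + by move=> n f cf; have [? ?] := continue_continuous t u (srs n); rewrite /ms /flow_m cutE.
  + exact: (Hm (t, u)).
  + exact: crealB.
  + move=> e e0; have e2 : 0 < e / 2 by rewrite divr_gt0.
    apply: filterS2 (gcvg (tnow t) u _ e2) (ccvg t u _ e2) => n H1 H2 x Dx.
    have := H1 x Dx; have := H2 x Dx; rewrite /advantage !ler_norml => /andP[? ?] /andP[? ?].
    by rewrite -/(mus n) -/(ms n); lra.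
  + by move=> n x; exact: ((Hsig n).2 t u x).2.
Qed.
End ExactStopping.

(** * Mixtures over paths *)

Section PathMixture.
Context {R : realType} {T N : nat} {S : pmetricType R}.
Hypothesis compactS : compact [set: S].
Local Notation W := (W T N).
Local Notation SW := ((S * W)%type : Type).
Variables (p : W -> R) (nu : W -> Psub R S).
Hypotheses (p_ge0 : forall u, 0 <= p u) (p_sum : \sum_u p u = 1).

Let at_path (u : W) (x : borel S) : borel SW := (x, u).

Let measurable_at_path u : measurable_fun [set: borel S] (at_path u).
Proof.
apply: (measurability _ (erefl : @measurable _ (borel SW) = <<s @open SW >>)).
have open_slice (B : set SW) : open B -> open [set x : S | B (x, u)].
  rewrite !openE => oB x /= /oB[[C D] /= [Cx Du] CD].
  by apply: filterS Cx => y Cy; apply: (CD (y, u)); split=> //=; exact: nbhs_singleton.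
by move=> _ [B oB <-]; rewrite setTI; apply: borel_open; exact: open_slice.
Qed.


Let nu' (u : W) := (nu u : subprobability (borel S) R).

Let mixture_path (k : nat) : W := nth point (enum W) k.

Let slice (u : W) : {measure set (borel SW) -> \bar R}.
Proof. by refine (pushforward (nu' u) (at_path u)); exact: measurable_at_path. Defined.

Let piece (k : nat) : {measure set (borel SW) -> \bar R} :=
  mscale (NngNum (p_ge0 (mixture_path k))) (slice (mixture_path k)).

Let mixture : {measure set (borel SW) -> \bar R} := msum piece #|{: W}|.

Let enum_sum (F : W -> \bar R) : (\sum_u F u = \sum_(k < #|{: W}|) F (mixture_path k))%E.
Proof.
have -> : (\sum_u F u = \sum_(u <- enum {: W}) F u)%E by rewrite big_enum.
by rewrite (big_nth point) big_mkord -cardE.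
Qed.

Let mixtureE B : mixture B = (\sum_u (p u)%:E * nu' u [set x | B (x, u)])%E.
Proof. by rewrite enum_sum. Qed.

Let mixture_le1 : (mixture [set: borel SW] <= 1)%E.
Proof.
rewrite mixtureE (_ : 1 = (\sum_u (p u)%:E)%E)%E; last by rewrite sumEFin p_sum.
apply: lee_sum => u _; rewrite -[leRHS]mule1 lee_wpmul2l ?lee_fin //.
exact: sprobability_setT.
Qed.

Let K : Psub R SW := HB.pack (msum piece #|{: W}|)
  (Measure_isSubProbability.Build _ _ _ (msum piece #|{: W}|) mixture_le1).

Let K_integral_ge0 (f : SW -> R) : continuous f -> (forall q, 0 <= f q) ->
  \int[K : subprobability _ _]_q f q = \sum_u p u * sint (nu u) (fun x => f (x, u)).
Proof.
move=> cf f0; rewrite /Rintegral.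
have mf : measurable_fun [set: borel SW] (fun q => (f q)%:E).
  by apply/measurable_EFinP; exact: (state_path_bmeas compactS cf).1.
change (fine (\int[mixture]_q (f q)%:E)%E = \sum_u p u * sint (nu u) (fun x => f (x, u))).
rewrite ge0_integral_measure_sum //; last by move=> q _; rewrite lee_fin.
have -> : (\sum_(k < #|{: W}|) \int[piece k]_q (f q)%:E =
    \sum_u (p u)%:E * \int[slice u]_q (f q)%:E)%E.
  rewrite enum_sum; apply: eq_bigr => k _.
  by rewrite ge0_integral_mscale // => q _; rewrite lee_fin.
rewrite (eq_bigr (fun u => (p u * sint (nu u) (fun x => f (x, u)))%:E)) ?sumEFin // => u _.
rewrite EFinM; congr (_ * _)%E.
rewrite ge0_integral_pushforward //; last by move=> q _; rewrite lee_fin.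
rewrite /sint /Rintegral fineK //.
apply: integrable_fin_num => //; apply: bmeas_integrable => //; first exact: subprobability_fin.
by apply: compact_bmeas => //; exact: slice_continuous.
Qed.

(** k is the sum over u of the images of p u * nu u under x |-> (x, u). *)
Lemma path_mixture : exists k : Psub R SW, disintegrates k nu p /\
  forall f : SW -> R, continuous f ->
  \int[k : subprobability _ _]_q f q = \sum_u p u * sint (nu u) (fun x => f (x, u)).
Proof.
exists K; split=> [B _|f cf]; first exact: mixtureE.
have [_ [M fM]] := state_path_bmeas compactS cf.
have cM : continuous (fun _ : SW => M) by exact: creal_cst.
have cfM : continuous (fun q => f q + M) by exact: crealD.
have M0 : 0 <= M by apply: le_trans (fM point I).
have fM0 q : 0 <= f q + M by have := fM q I; rewrite ler_norml => /andP[]; lra.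
have -> : f = fun q => (f q + M) - M by apply/funext => q; rewrite addrK.
rewrite bintB //; [|exact: subprobability_fin|exact: state_path_bmeas|exact: state_path_bmeas].
rewrite !K_integral_ge0 // -sumrB; apply: eq_bigr => u _.
rewrite -mulrBr -sintB //; [exact: (slice_continuous (y := u) cfM)|exact: creal_cst].
Qed.
End PathMixture.

(** * The law of the path process *)

Section PathLaw.
Context {R : realType} {T N : nat} {S : pmetricType R} {A : action_space R}.
Variable G : mmgame T N S A.
Hypothesis wpG : well_posed G.
Local Notation W := (W T N).
Variables (alpha : control T N A) (m : Cm T N S).
Local Notation law := (law G alpha m).
Local Notation step t u u' := (pi0 G t u (alpha t u) (m t u) u').

(** The path at time t from which the path u is reached at time t + 1. It does
    not depend on the major player's move, which is why the conditional flows
    can be computed without the control. *)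
Definition parent (t : 'I_T) (u : W) : W :=
  \matrix_(r, j) if r == tnext t then false else u r j.

Definition blank_after (s : nat) (u : W) := forall (r : 'I_T.+1) j, (s < r)%N -> u r j = false.

Lemma parent_extend (t : 'I_T) (u : W) z : blank_after t u -> parent t (extend u (tnext t) z) = u.
Proof.
move=> ut; apply/matrixP => r j; rewrite !mxE; case: eqP => [->|_].
  by rewrite ut.
by rewrite andFb orbF.
Qed.

Lemma blank_extend (t : 'I_T) (u : W) z : blank_after t u -> blank_after t.+1 (extend u (tnext t) z).
Proof.
move=> ut r j tr; rewrite !mxE ut //=; last exact: ltnW.
by rewrite -val_eqE /= -[bump 0 t]/(t.+1) gtn_eqF.
Qed.

Lemma step_extends (t : 'I_T) (u u' : W) : blank_after t u -> step t u u' != 0 ->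
  exists z, u' = extend u (tnext t) z.
Proof.
move=> ut H; suff /existsP[z /eqP] : [exists z, extend u (tnext t) z == u'] by exists z.
apply: contraNT H => /existsPn H; apply/eqP.
have [_ P0E _] := wpG.
transitivity (\int[alpha t u : probability _ _]_(a in @actions R A) (0 : R)); last first.
  by rewrite /Rintegral integral0.
apply: eq_Rintegral => a /set_mem Aa; rewrite P0E //; last by move=> j; exact: ut.
by rewrite big_pred0 // => z; exact/negbTE.
Qed.

(** Other paths are outside an event of probability 1. *)
Lemma law0_initial u : law0 G u != 0 -> exists z, u = Mmx ord0 z.
Proof.
have [_ _ m0_init] := wpG => H.
apply: contrapT => not_init; case/eqP: H; rewrite /law0.
pose B := [set q : S * W | exists z, q.2 = Mmx ord0 z].
have mB : measurable (B : set (borel (S * W)%type)).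
  exact: (path_slice_measurable [set v | exists z, v = Mmx ord0 z]).
suff -> : (m0star G : probability _ _) [set q | q.2 = u] = 0%E by [].
apply/eqP; rewrite -measure_le0.
apply: (@le_trans _ _ ((m0star G : probability _ _) (~` B))).
  apply: le_measure; rewrite ?inE.
  - exact: (path_slice_measurable [set u]).
  - exact: measurableC.
  - by move=> q /= qu [z qz]; apply: not_init; exists z; rewrite -qu.
by rewrite probability_setC // m0_init subee.
Qed.

Lemma law_next (t : 'I_T) u' : law (tnext t) u' = \sum_u step t u u' * law t u.
Proof. by rewrite /law tnextE law_from_next. Qed.

Lemma law_blank (s : 'I_T.+1) u : law s u != 0 -> blank_after s u.
Proof.
elim/forward_ind: s u => [|t IH] u.
  by move=> /law0_initial[z ->] r j r0; rewrite mxE; case: r r0 => -[|r].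
rewrite law_next => H.
have /existsP[v /andP[sv lv]] : [exists v, (step t v u != 0) && (law (tnow t) v != 0)].
  apply: contraNT H => /existsPn H; apply/eqP/big1 => v _.
  by apply/eqP; rewrite mulf_eq0; have := H v; rewrite negb_and !negbK.
have tv := IH v lv; have [z ->] := step_extends tv sv.
by rewrite tnextE; exact: blank_extend.
Qed.

(** A path of positive probability at time t has only zeros after t, so erasing
    the next row undoes the extension. *)
Lemma step_parent (t : 'I_T) (u u' : W) : law t u != 0 -> step t u u' != 0 -> parent t u' = u.
Proof.
move=> /(@law_blank (tnow t)) tu su; have [z ->] := step_extends tu su.
exact: parent_extend.
Qed.
End PathLaw.

(** * The occupation measures of the flow *)

Section Verification.
Context {R : realType} {T N : nat} {S : pmetricType R} {A : action_space R}.
Variable G : mmgame T N S A.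
Hypotheses (compactS : compact [set: S]) (wpG : well_posed G) (hP : assumption_P G)
  (hR1 : assumption_R1 G).
Local Notation W := (W T N).
Local Notation SW := ((S * W)%type : Type).
Variables (mu : Cmu T N S) (m : Cm T N S) (alpha : control T N A).
Local Notation law := (law G alpha m).
Local Notation step t u u' := (pi0 G t u (alpha t u) (m t u) u').
Hypotheses (step_sum : forall t u, \sum_u' step t u u' = 1) (law_ge0 : forall s u, 0 <= law s u).

Lemma law_sum (s : 'I_T.+1) : \sum_u law s u = 1.
Proof.
elim/forward_ind: s => [|t IH].
  have c1 : continuous (fun _ : SW => 1 : R) by exact: creal_cst.
  rewrite -(prob_Rintegral_cst (m0star G : probability _ _) 1).
  under eq_bigr => u _ do rewrite -[law _ u]/(path_mass (m0star G) u) path_massE.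
  have bind u : bmeas [set: borel SW] (fun q : SW => (q.2 == u)%:R : R).
    apply: state_path_bmeas => //; apply: state_path_continuous => u' /=; exact: creal_cst.
  rewrite -(bint_sum (mu := (m0star G : probability (borel SW) R)) measurableT (prob_fin _)
    (index_enum _) xpredT (F := fun u (q : borel SW) => (q.2 == u)%:R)) //.
  apply: eq_Rintegral => q _.
  by rewrite (bigD1 q.2) //= eqxx big1 ?addr0 // => i /negbTE; rewrite eq_sym => ->.
under eq_bigr => u' _ do rewrite law_next.
rewrite exchange_big /= -[RHS]IH; apply: eq_bigr => u _.
by rewrite -mulr_suml step_sum mul1r.
Qed.

Lemma generatorE (phi : 'I_T.+1 -> SW -> R) t x u : (forall s, continuous (phi s)) ->
  generator G phi t x u (alpha t u) (m t u) =
  \sum_u' step t u u' * pint (P1 G t x u (m t u)) (fun x' => phi (tnext t) (x', u'))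
  - phi (tnow t) (x, u).
Proof.
move=> cphi; rewrite /generator -[X in _ - X]mul1r -(step_sum t u) mulr_suml -sumrB.
apply: eq_bigr => u' _; rewrite -mulrBr; congr (_ * _).
rewrite /pint bintB //; [|exact: prob_fin| |exact: bmeas_cst].
  by congr (_ - _); exact: prob_Rintegral_cst.
by apply: compact_bmeas => //; exact: slice_continuous.
Qed.

Lemma generator_continuous (phi : 'I_T.+1 -> SW -> R) t : (forall s, continuous (phi s)) ->
  continuous (fun q : SW => generator G phi t q.1 q.2 (alpha t q.2) (m t q.2)).
Proof.
move=> cphi; apply: state_path_continuous => u /=.
rewrite [X in continuous X](_ : _ = fun x =>
  \sum_u' step t u u' * pint (P1 G t x u (m t u)) (fun x' => phi (tnext t) (x', u'))
  - phi (tnow t) (x, u)); last by apply/funext => x; exact: generatorE.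
apply: crealB; last exact: slice_continuous.
apply: creal_sum => u'; apply: crealM; first exact: creal_cst.
exact/P1_slice_continuous/slice_continuous.
Qed.

Variables (rho : Cmu T N S).
Hypotheses (rho_init : forall u f, continuous f -> sint (rho ord0 u) f =
    (path_mass (m0star G) u)^-1 * \int[m0star G : probability _ _]_q (f q.1 * (q.2 == u)%:R))
  (rho_next : forall t u' f, continuous f -> sint (rho (tnext t) u') f =
    sint (m t (parent t u')) (fun x => pint (P1 G t x (parent t u') (m t (parent t u'))) f))
  (rho_now : forall t u f, continuous f ->
    sint (mu (tnow t) u) f + sint (m t u) f = sint (rho (tnow t) u) f)
  (rho_max : forall u f, continuous f -> sint (mu ord_max u) f = sint (rho ord_max u) f).
Variable k : Vspace T N S.
Hypotheses (k1_int : forall s (f : SW -> R), continuous f ->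
    \int[k.1 s : subprobability _ _]_q f q = \sum_u law s u * sint (mu s u) (fun x => f (x, u)))
  (k2_int : forall (t : 'I_T) (f : SW -> R), continuous f ->
    \int[k.2 t : subprobability _ _]_q f q = \sum_u law t u * sint (m t u) (fun x => f (x, u))).

(** With a, b, d the integrals of phi for the laws rho, mu, m mixed by the law
    of the path, a_t = b_t + d_t and the generator contributes a_(t+1) - d_t:
    the weights pi0 p_t of the steps into u' add up to p_(t+1)(u'), and by
    step_parent each of them starts at the path parent t u' of rho_next. The
    sum over t telescopes. *)
Lemma mixture_Rset : Rset G m alpha k.
Proof.
move=> phi phi_cb; have cphi s : continuous (phi s) by have [] := phi_cb s.
have cphi' s u : continuous (fun x => phi s (x, u)) by exact: slice_continuous.
pose a (s : 'I_T.+1) := \sum_u law s u * sint (rho s u) (fun x => phi s (x, u)).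
pose b (s : 'I_T.+1) := \sum_u law s u * sint (mu s u) (fun x => phi s (x, u)).
pose d (t : 'I_T) := \sum_u law t u * sint (m t u) (fun x => phi (tnow t) (x, u)).
have b_now t : b (tnow t) = a (tnow t) - d t.
  rewrite /a /b /d -sumrB; apply: eq_bigr => u _.
  by rewrite -rho_now // mulrDr addrK.
have b_max : b ord_max = a ord_max.
  by apply: eq_bigr => u _; rewrite rho_max.
have gen t : \int[k.2 t : subprobability _ _]_q
    generator G phi t q.1 q.2 (alpha t q.2) (m t q.2) = a (tnext t) - d t.
  rewrite k2_int; last exact: generator_continuous.
  have cP u u' : continuous (fun x =>
      step t u u' * pint (P1 G t x u (m t u)) (fun x' => phi (tnext t) (x', u'))).
    by apply: crealM; [exact: creal_cst|exact: P1_slice_continuous].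
  transitivity (\sum_u law t u * (\sum_u' step t u u' *
      sint (m t u) (fun x => pint (P1 G t x u (m t u)) (fun x' => phi (tnext t) (x', u')))
      - sint (m t u) (fun x => phi (tnow t) (x, u)))).
    apply: eq_bigr => u _; congr (_ * _).
    under eq_fun => x do rewrite generatorE //.
    rewrite sintB //=; last by apply: creal_sum => u'; exact: cP.
    rewrite sint_sum //.
    congr (_ - _); apply: eq_bigr => u' _.
    by rewrite sintZ //; exact: P1_slice_continuous.
  rewrite /a /d; under eq_bigr do rewrite mulrBr.
  rewrite sumrB; congr (_ - _).
  under [RHS]eq_bigr => u' _ do rewrite law_next mulr_suml.
  rewrite [RHS]exchange_big /=; apply: eq_bigr => u _.
  rewrite mulr_sumr; apply: eq_bigr => u' _.
  rewrite mulrA [law t u * _]mulrC.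
  have [->|su] := eqVneq (step t u u') 0; first by rewrite !mul0r.
  have [->|lu] := eqVneq (law t u) 0; first by rewrite mulr0 !mul0r.
  congr (_ * _); rewrite rho_next // (step_parent wpG lu su) //.
under eq_bigr => s _ do rewrite k1_int //.
under [in RHS]eq_bigr => t _ do rewrite gen.
rewrite (init_disintegration compactS rho_init) //.
rewrite -[X in X + _]/(a ord0) -[LHS]/(\sum_s b s).
transitivity (\sum_s a s - \sum_t d t).
  rewrite !big_ord_recr /= -/(tnow _) b_max addrAC; congr (_ + _).
  by rewrite -sumrB; apply: eq_bigr => t _; exact: b_now.
by rewrite sumrB big_ord_recl addrA.
Qed.
End Verification.

(** * Optimality *)

Section Optimality.
Context {R : realType} {T N : nat} {S : pmetricType R} {A : action_space R}.
Variable G : mmgame T N S A.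
Hypotheses (compactS : compact [set: S]) (hP : assumption_P G) (hR1 : assumption_R1 G).
Local Notation W := (W T N).
Local Notation SW := ((S * W)%type : Type).
Variable ref : {sigma_finite_measure set (borel (ambient A)) -> \bar R}.
Variables (lambda : R) (mu : Cmu T N S) (m : Cm T N S) (alpha : control T N A).
Local Notation step t u u' := (pi0 G t u (alpha t u) (m t u) u').
Hypotheses (step_sum : forall t u, \sum_u' step t u u' = 1)
  (stepE : forall t u u', step t u u' = transition G ref lambda mu m t u u').
Local Notation v := (minor_value G ref lambda mu m).
Local Notation c := (continue_reward G ref lambda mu m).
Local Notation g := (stop_reward G mu).

(** The value is a maximum of two rewards; its excess over one of them is the
    positive part of their difference. *)
Lemma stop_regret x u s :
  v s u x - g s u x = if insub (s : nat) is Some t then Num.max 0 (c t u x - g s u x) else 0.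
Proof.
elim/backward_ind: s => [|t _].
  by rewrite insubF /= ?ltnn // minor_value_max subrr.
rewrite /= valK minor_value_now maxEle [in RHS]maxEle subr_ge0.
by case: ifP => _; rewrite ?subrr.
Qed.

Lemma continue_regret x u t :
  v (tnow t) u x - c t u x = Num.max 0 (g (tnow t) u x - c t u x).
Proof.
rewrite minor_value_now maxC maxEle [in RHS]maxEle subr_ge0.
by case: ifP => _; rewrite ?subrr.
Qed.

Lemma path_function_continuous (h : W -> S -> R) : (forall u, continuous (h u)) ->
  continuous (fun q : SW => h q.2 q.1).
Proof. by move=> ch; apply: state_path_continuous => u /=; exact: ch. Qed.

Let cv s : continuous (fun q : SW => v s q.2 q.1).
Proof. by apply: path_function_continuous => u; exact: minor_value_continuous. Qed.

Let cc t : continuous (fun q : SW => c t q.2 q.1).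
Proof. by apply: path_function_continuous => u; exact: continue_reward_continuous. Qed.

Let cg s : continuous (fun q : SW => g s q.2 q.1).
Proof. by apply: path_function_continuous => u; exact: stop_reward_continuous. Qed.

Let cf t : continuous (fun q : SW => f1 G t q.1 q.2 (m t q.2)).
Proof.
apply: state_path_continuous => u /=; have [cf _] := hR1 u.
exact: (@slice_continuous _ _ _ (fun p => f1 G t p.1 u p.2) (m t u) (cf t)).
Qed.

(** The defining equation of Rset tested with the value function: the generator
    of v is c - v minus the running reward f1. *)
Lemma payoff_regret (k : Vspace T N S) : Rset G m alpha k ->
  J1 G mu m k = \int[m0star G : probability _ _]_q v ord0 q.2 q.1
    - \sum_s \int[k.1 s : subprobability _ _]_q (v s q.2 q.1 - g s q.2 q.1)
    - \sum_t \int[k.2 t : subprobability _ _]_q (v (tnow t) q.2 q.1 - c t q.2 q.1).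
Proof.
move=> kR0; pose phi (s : 'I_T.+1) (q : SW) := v s q.2 q.1.
have phi_cb s : continuous (phi s) /\ bounded_fun (phi s).
  split; first exact: cv.
  have [_ [M fM]] := state_path_bmeas compactS (@cv s).
  exists M; split; first exact: num_real.
  by move=> y My q _; apply: le_trans (fM q I) (ltW My).
have kR := kR0 phi phi_cb.
have b (f : SW -> R) : continuous f -> bmeas [set: borel SW] f by exact: state_path_bmeas.
have genE t q : generator G phi t q.1 q.2 (alpha t q.2) (m t q.2) =
    (c t q.2 q.1 - v (tnow t) q.2 q.1) - f1 G t q.1 q.2 (m t q.2).
  case: q => x u; rewrite generatorE //= /phi /=.
  have -> : c t u x = f1 G t x u (m t u) +
      \sum_u' step t u u' * pint (P1 G t x u (m t u)) (v (tnext t) u').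
    by congr (_ + _); apply: eq_bigr => u' _; rewrite stepE.
  by ring.
rewrite /J1 -[RHS]addrA -opprD.
have -> : \sum_s \int[k.1 s : subprobability _ _]_q (v s q.2 q.1 - g s q.2 q.1) =
    \sum_s \int[k.1 s : subprobability _ _]_q phi s q
    - \sum_s \int[k.1 s : subprobability _ _]_q g s q.2 q.1.
  by rewrite -sumrB; apply: eq_bigr => s _; rewrite bintB //; [exact: subprobability_fin|exact: b|exact: b].
rewrite kR.
have -> : \sum_t \int[k.2 t : subprobability _ _]_q
      generator G phi t q.1 q.2 (alpha t q.2) (m t q.2) =
    - \sum_t \int[k.2 t : subprobability _ _]_q (v (tnow t) q.2 q.1 - c t q.2 q.1)
    - \sum_t \int[k.2 t : subprobability _ _]_q f1 G t q.1 q.2 (m t q.2).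
  rewrite -sumrN -sumrB; apply: eq_bigr => t _.
  have lin (w : SW -> R) : continuous w ->
      \int[k.2 t : subprobability _ _]_q (- (1 : R) * w q - f1 G t q.1 q.2 (m t q.2)) =
      - (\int[k.2 t : subprobability _ _]_q w q)
      - \int[k.2 t : subprobability _ _]_q f1 G t q.1 q.2 (m t q.2).
    move=> cw; rewrite bintB //; [|exact: subprobability_fin| |exact: b]; last first.
      by apply: b; apply: crealM => //; exact: creal_cst.
    by rewrite bintZ ?mulN1r //; (exact: b || exact: subprobability_fin).
  rewrite -lin; last exact: crealB.
  by apply: eq_Rintegral => q _; rewrite genE; ring.
rewrite /stop_reward /phi; ring.
Qed.

Lemma regret_optimal (k : Vspace T N S) : Rset G m alpha k ->
  (forall s, \int[k.1 s : subprobability _ _]_q (v s q.2 q.1 - g s q.2 q.1) = 0) ->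
  (forall t, \int[k.2 t : subprobability _ _]_q (v (tnow t) q.2 q.1 - c t q.2 q.1) = 0) ->
  Theta G mu m alpha k.
Proof.
move=> kR k1 k2; split=> // k' k'R.
rewrite !payoff_regret // [X in _ <= _ - X - _]big1 ?[X in _ <= _ - X]big1 // !subr0.
rewrite -addrA -opprD lerBlDr lerDl; apply: addr_ge0; apply: sumr_ge0 => i _.
  apply: Rintegral_ge0 => q _; rewrite stop_regret; case: insub => [t|//].
  by rewrite le_max lexx.
by apply: Rintegral_ge0 => q _; rewrite continue_regret le_max lexx.
Qed.
End Optimality.

(** * Existence of a regularized equilibrium *)

Theorem theorem4p4 (R : realType) (T N : nat) (S : pmetricType R)
    (A : action_space R) (G : mmgame T N S A)
    (T_ge1 : (1 <= T)%N) (compactS : compact [set: S])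
    (admA : admissible_actions A) (wpG : well_posed G)
    (hP : assumption_P G) (hR0 : assumption_R0 G) (hR1 : assumption_R1 G)
    (lambda : R) (lambda_gt0 : 0 < lambda) :
  exists (mu : Cmu T N S) (m : Cm T N S), Phi G lambda mu m (mu, m).
Proof.
have [ref [refE cA mA ref_gt0 ref_fin]] := reference_is_measure admA.
have [U [UU leU]] := @ultraFilterLemma nat \oo _.
have /choice[rho0 rho0E] := init_exists compactS (m0star G).
have [_ _ cP1] := hP.
have [||mus ms mu m mus_cvg ms_cvg|rho [mu [m [rhoI rhoN [rhoS rhoT] stop0 cont0]]]] :=
    @stopping_equilibrium R T N S compactS U UU leU (P1 G) cP1 (@parent T N) rho0
    (stop_reward G) (continue_reward G ref lambda).
- by move=> mu s u; exact: stop_reward_continuous.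
- by move=> mu m t u; exact: continue_reward_continuous.
- split=> [s u|t u]; first exact: stop_reward_ucvg.
  exact: continue_reward_ucvg.
have [alpha [is_alpha relA pi0E]] :=
  alpha_lambda_exists hP hR0 refE cA mA ref_gt0 ref_fin lambda_gt0 mu m.
have step_sum t u : \sum_u' pi0 G t u (alpha t u) (m t u) u' = 1 by exact: pi0_sum.
have lge0 (s : 'I_T.+1) u : 0 <= law G alpha m s u.
  by apply: law_from_ge0 => // v; exact: path_mass_ge0.
have lsum (s : 'I_T.+1) : \sum_u law G alpha m s u = 1 by exact: law_sum.
have /choice[k1 k1P] := fun s : 'I_T.+1 => path_mixture compactS (mu s) (lge0 s) (lsum s).
have /choice[k2 k2P] := fun t : 'I_T => path_mixture compactS (m t) (lge0 (tnow t)) (lsum (tnow t)).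
have kR : Rset G m alpha (k1, k2).
  apply: (@mixture_Rset _ _ _ _ _ _ compactS wpG hP mu m alpha step_sum rho) => //.
  - by move=> u f cf; rewrite rhoI // rho0E.
  - by move=> s f cf; exact: (k1P s).2.
  - by move=> t f cf; exact: (k2P t).2.
exists mu, m, alpha => //; exists (k1, k2) => /=; last first.
  by split=> [s|t]; [exact: (k1P s).1|exact: (k2P t).1].
apply: (@regret_optimal _ _ _ _ _ _ compactS hP hR1 ref lambda) => // [s|t] /=.
  rewrite (k1P s).2; last first.
    apply: crealB; apply: path_function_continuous => u.
      exact: minor_value_continuous.
    exact: stop_reward_continuous.
  apply: big1 => u _ /=; apply/eqP; rewrite mulf_eq0; apply/orP; right; apply/eqP.
  under eq_fun do rewrite stop_regret.
  case: insubP => [t _ ts|_]; last exact: sint_0.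
  have -> : s = tnow t by exact: ord_inj.
  exact: stop0.
rewrite (k2P t).2; last first.
  apply: crealB; apply: path_function_continuous => u.
    exact: minor_value_continuous.
  exact: continue_reward_continuous.
apply: big1 => u _ /=; apply/eqP; rewrite mulf_eq0; apply/orP; right; apply/eqP.
under eq_fun do rewrite continue_regret.
exact: cont0.
Qed.
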